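(* For every $\varepsilon>0$ there is a constant $C_\varepsilon>0$, depending only on $\varepsilon$, such that for every $\beta>0$ and every integer $1\le L<\infty$, with $\mathcal G_L=\mathbb Z^2\cap[-L,L]^2$ and $\lambda=1/\beta$, $$\sum_{j=1}^4\ \sum_{(x,y)\in\widetilde Q_j}\Big(\langle\sigma_x\cdot\sigma_y\rangle^{\mathrm{Vill},\mathcal G_L}_\beta\Big)^{1-\varepsilon}\ \ge\ \frac{4\,C_\varepsilon}{\sqrt\beta}\ \mathbb E^{\mathcal G_L^*}_{\lambda}\big[\mathcal N^{+,+}(f_0)+\mathcal N^{-,-}(f_0)\big].$$
   Context: Villain model on a finite graph $(V,E)$ with free boundary conditions: spins $\sigma_x=e^{i\theta_x}$, $\theta\in[-\pi,\pi)^V$, with probability density proportional to $\prod_{\{u,v\}\in E}\sum_{m\in\mathbb Z}\exp\big(-\frac\beta2(\theta_u-\theta_v+2\pi m)^2\big)$; $\langle\sigma_x\cdot\sigma_y\rangle$ is the expectation of $\cos(\theta_x-\theta_y)$. $\mathcal G_L$ is the nearest-neighbor graph on $\mathbb Z^2\cap[-L,L]^2$. Dual height function: the vertices of $\mathcal G_L^*$ are the faces of $\mathcal G_L$ (including the outer face), and each edge of $\mathcal G_L$ gives a dual edge joining the two faces it borders. $\mathbb E^{\mathcal G_L^*}_\lambda$ is expectation for the integer-restricted Gaussian field: integer-valued functions $n$ on faces vanishing on the outer face, with probabilities proportional to $\exp\big(-\frac\lambda2\sum(n_f-n_{f'})^2\big)$, the sum being over dual edges. Level lines: for $q\in\mathbb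 Z+\frac12$, an oriented edge of $\mathcal G_L$ is a $q$-edge if $n<q$ on the face to its right and $n>q$ on the face to its left. At each vertex the incoming and outgoing $q$-edges alternate in the cyclic order; each incoming $q$-edge is continued by the first outgoing $q$-edge met when rotating counterclockwise about the vertex starting from the incoming edge, i.e. starting on its right side. This decomposes the $q$-edges into oriented non-crossing closed contours ($q$-loops); counterclockwise loops have orientation $+$ and clockwise loops orientation $-$. For a face $f$ and $\eta=\pm$, $\mathcal N_q^\eta(f)$ is the number of $q$-loops of orientation $\eta$ surrounding $f$, and $\mathcal N^{\eta,r}(f)=\sum_{q\in\mathbb Z+1/2,\ \mathrm{sgn}(q)=r}\mathcal N_q^\eta(f)$. $f_0$ is the face centered at $(1/2,1/2)$. $Q_1,\dots,Q_4$ are the four standard quadrants translated so that their corners are the four vertices of $f_0$ and their intersection is $f_0$: $Q_1=\{a\ge0,b\ge0\}$, $Q_2=\{a\le1,b\ge0\}$, $Q_3=\{a\le1,b\le1\}$, $Q_4=\{a\ge0,b\le1\}$. $\widetilde Q_j$ is the collection of pairs of distinct sites $\{x,y\}$ of $\mathcal G_L$, one on the vertical and the other on the horizontal part of the boundary of $Q_j$. *)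

(* Defs.v *)
From HB Require Import structures.
From mathcomp Require Import all_boot all_order all_algebra.
From mathcomp Require Import all_classical all_reals all_analysis.

Set Implicit Arguments.
Unset Strict Implicit.
Unset Printing Implicit Defensive.

Import Order.TTheory GRing.Theory Num.Theory.

Local Open Scope classical_set_scope.
Local Open Scope ring_scope.

(* A site of Z^2 /\ [-L,L]^2, stored with its coordinates shifted by L. *)
Definition site (L : nat) := ('I_(2 * L).+1 * 'I_(2 * L).+1)%type.

Definition pos (L : nat) (v : site L) : int * int :=
  (v.1%:Z - L%:Z, v.2%:Z - L%:Z).

(* Directions d : 'Z_4 are 0 = east, 1 = north, 2 = west, 3 = south, so that
   d |-> d + 1 is the counterclockwise rotation by a quarter turn. *)
Definition step (d : 'Z_4) : int * int :=
  nth (0, 0) [:: (1, 0); (0, 1); (-1, 0); (0, -1)] d.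

Definition nbr (L : nat) (v : site L) (d : 'Z_4) : option (site L) :=
  [pick w : site L | pos w == pos v + step d].

(* The pair (v, d) is the oriented edge from v to its neighbour in direction d;
   it is an edge of G_L when that neighbour is in the box (is_edge). *)
Definition oedge (L : nat) := (site L * 'Z_4)%type.

Definition is_edge (L : nat) (e : oedge L) : bool := isSome (nbr e.1 e.2).

Definition tip (L : nat) (e : oedge L) : site L := odflt e.1 (nbr e.1 e.2).

(* The eastward and northward edges: each unoriented edge of G_L once. *)
Definition edges (L : nat) : {set oedge L} :=
  [set e : oedge L | is_edge e && (e.2 \in [:: 0; 1])].

(* A face is the unit square whose lower left corner is sqpos s, or the outer
   face None. *)
Definition square (L : nat) := ('I_(2 * L) * 'I_(2 * L))%type.

Definition face (L : nat) := option (square L).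

Definition sqpos (L : nat) (s : square L) : int * int :=
  (s.1%:Z - L%:Z, s.2%:Z - L%:Z).

Definition face_at (L : nat) (p : int * int) : face L :=
  [pick s : square L | sqpos s == p].

Definition f0 (L : nat) : face L := face_at L (0, 0).

(* The face located at v between the directions d and d + 1. *)
Definition sector (L : nat) (v : site L) (d : 'Z_4) : face L :=
  face_at L (pos v + nth (0, 0) [:: (0, 0); (-1, 0); (-1, -1); (0, -1)] d).

Definition left_face (L : nat) (e : oedge L) : face L := sector e.1 e.2.

Definition right_face (L : nat) (e : oedge L) : face L := sector e.1 (e.2 - 1).

Section Villain.
Variables (R : realType) (L : nat).

Definition villain_edge (beta t : R) : R :=
  fine (\esum_(m in [set: int])
    (expR (- (beta / 2) * (t + 2 * pi * m%:~R) ^+ 2))%:E).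

Definition villain_density (beta : R) (theta : site L -> R) : R :=
  \prod_(e in edges L) villain_edge beta (theta e.1 - theta (tip e)).

(* Iterated Lebesgue integral over [-pi, pi[ in each of the coordinates listed
   in s; it is only applied to bounded continuous F, and to an s enumerating
   all the sites, so that it is the integral over [-pi, pi[^V and does not
   depend on the initial theta. *)
Fixpoint angle_integral (s : seq (site L)) (F : (site L -> R) -> R)
    (theta : site L -> R) : R :=
  if s is v :: s' then
    \int[@lebesgue_measure R]_(t in `[(- pi : R), pi[)
      angle_integral s' F [eta theta with v |-> t]
  else F theta.

Definition spin_integral (F : (site L -> R) -> R) : R :=
  angle_integral (enum {: site L}) F (fun=> 0).

Definition villain_expect (beta : R) (X : (site L -> R) -> R) : R :=
  spin_integral (fun theta => X theta * villain_density beta theta) /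
  spin_integral (villain_density beta).

Definition villain_two_point (beta : R) (x y : site L) : R :=
  villain_expect beta (fun theta => cos (theta x - theta y)).

End Villain.

Definition height (L : nat) := {ffun face L -> int}.

Section IntegerGaussian.
Variables (R : realType) (L : nat).

Definition zero_boundary : set (height L) := [set n | n None = 0].

(* The dual edges are indexed by the edges they cross; in particular a corner
   square is joined to the outer face by two dual edges. *)
Definition ivg_weight (lambda : R) (n : height L) : R :=
  expR (- (lambda / 2) *
        \sum_(e in edges L) ((n (left_face e) - n (right_face e))%:~R) ^+ 2).

Definition ivg_partition (lambda : R) : R :=
  fine (\esum_(n in zero_boundary) (ivg_weight lambda n)%:E).

(* For nonnegative X. *)
Definition ivg_expect (lambda : R) (X : height L -> \bar R) : \bar R :=
  \esum_(n in zero_boundary)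
    ((ivg_weight lambda n / ivg_partition lambda)%:E * X n)%E.

End IntegerGaussian.

Section LevelLines.
Variables (L : nat) (n : height L) (q : rat).

Definition q_edge (e : oedge L) : bool :=
  [&& is_edge e, (n (right_face e))%:~R < q & q < (n (left_face e))%:~R].

(* Seen from its endpoint v, an edge of direction d arrives from the direction
   d + 2, and the other directions are listed counterclockwise from there. The
   default e is never used when e is a q-edge. *)
Definition next_q_edge (e : oedge L) : oedge L :=
  let: v := tip e in let: r := e.2 + 2 in
  head e [seq e' <- [:: (v, r + 1); (v, r + 2); (v, r + 3)] | q_edge e'].

Definition q_loops : {set {set oedge L}} :=
  [set [set e' | fconnect next_q_edge e e']%SET | e : oedge L & q_edge e].

End LevelLines.

(* The algebraic number of crossings, counted positively upwards, of an edge
   with the horizontal half-line going east from the center of s. *)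
Definition crossing (L : nat) (s : square L) (e : oedge L) : int :=
  if (sqpos s).1 < (pos e.1).1 then
    if (e.2 == 1) && ((pos e.1).2 == (sqpos s).2) then 1
    else if (e.2 == 3) && ((pos e.1).2 == (sqpos s).2 + 1) then -1
    else 0
  else 0.

Definition winding (L : nat) (c : {set oedge L}) (f : face L) : int :=
  if f is Some s then \sum_(e in c) crossing s e else 0.

Definition surrounds (L : nat) (c : {set oedge L}) (f : face L) : bool :=
  winding c f != 0.

(* Signs are booleans, true being +. *)
Definition has_sign (K : numDomainType) (r : bool) (x : K) : bool :=
  if r then 0 < x else x < 0.

(* A loop is counterclockwise (resp. clockwise) when it turns positively (resp.
   negatively) around the faces that it surrounds; a non-crossing loop is
   exactly one of the two. *)
Definition oriented (L : nat) (eta : bool) (c : {set oedge L}) : bool :=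
  [forall f : face L, surrounds c f ==> has_sign eta (winding c f)].

Definition num_q_loops (L : nat) (n : height L) (q : rat) (eta : bool)
    (f : face L) : nat :=
  #|[set c in q_loops n q | surrounds c f && oriented eta c]%SET|.

Definition half_integer : set rat :=
  [set q | exists k : int, q = k%:~R + 2^-1].

Definition num_loops (R : realType) (L : nat) (eta r : bool) (f : face L)
    (n : height L) : \bar R :=
  \esum_(q in [set q | half_integer q /\ has_sign r q])
    ((num_q_loops n q eta f)%:R)%:E.

(* Q_1, ..., Q_4 are indexed by 0, ..., 3. *)
Definition corner (j : 'I_4) : int * int :=
  nth (0, 0) [:: (0, 0); (1, 0); (1, 1); (0, 1)] j.

Definition quadrant (j : 'I_4) (p : int * int) : bool :=
  nth false [:: (0 <= p.1) && (0 <= p.2); (p.1 <= 1) && (0 <= p.2);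
                (p.1 <= 1) && (p.2 <= 1); (0 <= p.1) && (p.2 <= 1)] j.

Definition vertical_boundary (j : 'I_4) (p : int * int) : bool :=
  quadrant j p && (p.1 == (corner j).1).

Definition horizontal_boundary (j : 'I_4) (p : int * int) : bool :=
  quadrant j p && (p.2 == (corner j).2).

(* Each unordered pair {x,y} of the collection occurs as exactly one ordered
   pair: only the corner is on both parts, and x != y. *)
Definition boundary_pairs (L : nat) (j : 'I_4) : {set site L * site L} :=
  [set z : site L * site L | [&& vertical_boundary j (pos z.1),
     horizontal_boundary j (pos z.2) & z.1 != z.2]].

(* Main.v *)
Require Import Defs.
From HB Require Import structures.
From mathcomp Require Import all_boot all_order all_algebra.
From mathcomp Require Import all_classical all_reals all_analysis.
From mathcomp Require Import measurable_realfun complex zify ring lra.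

Set Implicit Arguments.
Unset Strict Implicit.
Unset Printing Implicit Defensive.

Import Order.TTheory GRing.Theory Num.Theory.
Import numFieldNormedType.Exports.
Local Open Scope ring_scope.

(* Let p = exp (- 1 / (2 beta)), the weight of a unit step of the height function,
   and let Z be the sum of the weights p ^ (sum_e k_e ^ 2) over the integer flows
   k without source. By Poisson summation the two-point function of the Villain
   model is T = Z_1 / (2 Z), where Z_1 is the sum over the flows with a source of
   strength 1 or -1 at x and its opposite at y.

   A q-loop of winding number different from 0 around f_0 crosses the two axes and
   joins some x = (0, a), with a >= 1, to some y = (b, 0), with b >= 1, inside the
   contours of {n > q}, and every edge belongs to one loop at most; so the expected
   number of loops is bounded by a sum over (x, y) of probabilities that x and y are
   joined by contours. In an Edwards-Sokal type expansion of the weights, such a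
   connection allows one to reflect the field n - q across a cut from x to y; the
   reflected weights are those of flows with odd sources at x and y on a graph where
   some edges are twisted. Griffiths' inequality removes the twist. The sum Z_m over
   flows with sources m is at most Z_1, since the correlation is a decreasing
   function of the angle (the Gaussian weights are limits of Jacobi triple products,
   and Griffiths' inequality applies to the half angles), and it is at most
   16 p ^ (m ^ 2 / 16) Z, because some edge at x carries at least m / 4.
   Hence sum_m Z_m <= C sqrt beta Z ^ eps Z_1 ^ (1 - eps), and dividing by the
   partition function, which is at least Z, gives C sqrt beta T ^ (1 - eps). *)

(** * Flow expansions and Griffiths inequalities *)

(** Griffiths' inequality is proved for finite sums. Cut after [N] factors, the Jacobi product has
    cosine coefficients that vanish beyond [N], are at most [p ^ (j^2)] and tend to it. So flows
    stay in a box, angles stay on a finite grid, and [N] goes to infinity only in inequalities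
    between finite sums and a bound independent of [N]. The twist comes from the reflection: on the
    cut an edge carries [m + m' + 1] in place of [m - m'], and conservation at the inner vertices of
    the cut is restored by letting the edges on one side of it enter with the opposite sign. At the
    two ends [2 m + 1] is left over, up to sign, which is why the sources are odd. The loss of [eps]
    comes from the sum over [m]. The bound by [Z_1] is not summable, and the decaying bound compares
    with [Z] instead of [Z_1]; their weighted geometric mean is summable, and its Gaussian sum is of
    order [sqrt (beta / eps)]. The sum over the levels costs nothing: as [n] vanishes on the outer
    face, the field [n - q] determines [n] and [q]. *)

Section Characters.
Variable R : realType.
Implicit Types x y : R.

Definition expi x : R[i] := Complex (cos x) (sin x).

Lemma expiD x y : expi (x + y) = expi x * expi y.
Proof. by rewrite /expi cosD sinD; congr (Complex _ _); rewrite addrC [X in _ + X]mulrC addrC. Qed.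

Lemma expi0 : expi 0 = 1.
Proof. by rewrite /expi cos0 sin0. Qed.

Lemma expi_sum (I : Type) (r : seq I) (P : pred I) (f : I -> R) :
  expi (\sum_(i <- r | P i) f i) = \prod_(i <- r | P i) expi (f i).
Proof. by apply: (big_morph expi expiD expi0). Qed.

Lemma Re_sum (I : Type) (r : seq I) (P : pred I) (f : I -> R[i]) :
  complex.Re (\sum_(i <- r | P i) f i) = \sum_(i <- r | P i) complex.Re (f i).
Proof.
by apply: (big_morph (@complex.Re R)) => // -[a b] [c d].
Qed.

Lemma Re_realM (a : R) (z : R[i]) : complex.Re (a%:C%C * z) = a * complex.Re z.
Proof. by case: z => b c /=; rewrite mul0r subr0. Qed.

End Characters.

Section BoxedFlows.
Variables (R : realType) (V E : finType) (src tgt : E -> V).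

Definition ib (N : nat) (i : 'I_(2 * N).+1) : int := i%:Z - N%:Z.

Definition flow (N : nat) := {ffun E -> 'I_(2 * N).+1}.

Definition fval (N : nat) (k : flow N) (e : E) : int := ib (k e).

(* Divergence of [k] on the signed graph where the edges of [neg] couple
   the angles through their sum instead of their difference. *)
Definition sdiv (neg : pred E) (k : E -> int) (v : V) : int :=
  \sum_(e | src e == v) k e
  - \sum_(e | tgt e == v) (if neg e then - k e else k e).

Definition trig (N : nat) (u : int -> R) (x : R) : R :=
  \sum_(i < (2 * N).+1) u (ib i) * cos ((ib i)%:~R * x).

Lemma ib_rev (N : nat) (i : 'I_(2 * N).+1) : ib (rev_ord i) = - ib i.
Proof. rewrite /ib /=; have := ltn_ord i; lia. Qed.

Lemma sum_ib (M : zmodType) (N : nat) (f : int -> M) :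
  \sum_(i < (2 * N).+1) f (ib i) = f 0 + \sum_(j < N) (f j.+1%:Z + f (- j.+1%:Z)).
Proof.
pose g (i : nat) := f (i%:Z - N%:Z).
rewrite (eq_bigr (fun i : 'I_(2 * N).+1 => g i)) //.
rewrite (_ : (2 * N).+1 = N + N.+1)%N; last lia.
rewrite /g big_split_ord /= addrC big_ord_recl /= addn0 subrr -addrA; congr (_ + _).
rewrite [X in _ + X](reindex_inj rev_ord_inj) /= -big_split /=; apply: eq_bigr => j _ /=.
by congr (f _ + f _); rewrite /bump /=; have := ltn_ord j; lia.
Qed.

Lemma trig_expi (N : nat) (u : int -> R) (x : R) : (forall k, u (- k) = u k) ->
  (trig N u x)%:C%C = \sum_(i < (2 * N).+1) (u (ib i))%:C%C * expi ((ib i)%:~R * x).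
Proof.
move=> uN; apply/eqP; rewrite eq_complex; apply/andP; split; apply/eqP.
  by rewrite Re_sum /trig; apply: eq_bigr => i _; rewrite Re_realM.
rewrite /=; set S := (X in complex.Im X).
have -> : complex.Im S = \sum_(i < (2 * N).+1) u (ib i) * sin ((ib i)%:~R * x).
  rewrite /S; rewrite (big_morph (@complex.Im R) (id1 := 0) (op1 := +%R)) //; last by move=> [a b] [c d].
  by apply: eq_bigr => i _ /=; rewrite mul0r addr0.
set T := \sum_(_ < _) _; suff : T = - T by lra.
rewrite {1}/T (reindex_inj rev_ord_inj) /= -sumrN.
by apply: eq_bigr => i _; rewrite ib_rev uN mulrNz mulNr sinN mulrN.
Qed.

(** Summation by parts; on a twisted edge the sign passes from the angle at the target to the flow,
    which is why [sdiv] negates it there. *)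
Lemma sum_angles (neg : pred E) (k : E -> int) (a : V -> R) :
  \sum_e (k e)%:~R * (a (src e) - (if neg e then - a (tgt e) else a (tgt e))) =
  \sum_v (sdiv neg k v)%:~R * a v.
Proof.
transitivity (\sum_e ((k e)%:~R * a (src e)) -
   \sum_e (if neg e then - k e else k e)%:~R * a (tgt e)).
  rewrite -sumrB; apply: eq_bigr => e _; rewrite mulrBr; congr (_ - _).
  by case: ifP => _ //; rewrite mulrN mulrNz mulNr.
rewrite (partition_big src predT) //= (partition_big tgt predT) //= -sumrB.
apply: eq_bigr => v _; rewrite /sdiv rmorphB /= mulrBl !rmorph_sum /= !mulr_suml.
by congr (_ - _); apply: eq_bigr => e /eqP ->.
Qed.

Lemma prod_trig (N : nat) (u : int -> R) (neg : pred E) (a : V -> R) :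
  (forall k, u (- k) = u k) ->
  (\prod_e trig N u (a (src e) - (if neg e then - a (tgt e) else a (tgt e))))%:C%C =
  \sum_(k : flow N) (\prod_e u (fval k e))%:C%C *
    \prod_v expi ((sdiv neg (fval k) v)%:~R * a v).
Proof.
move=> uN; rewrite rmorph_prod /=.
under eq_bigr do rewrite trig_expi //.
rewrite bigA_distr_bigA /=; apply: eq_bigr => k _.
by rewrite big_split /= rmorph_prod /= -!expi_sum -sum_angles.
Qed.

(* Expansion of a product of even trigonometric polynomials against product
   weights [l] on the (finitely many) angles [a v t], [t : T], at each vertex. *)
Lemma spin_flow (T : finType) (N : nat) (u : int -> R) (neg : pred E)
    (a : V -> T -> R) (l : V -> T -> R[i]) :
  (forall k, u (- k) = u k) ->
  \sum_(th : {ffun V -> T}) (\prod_v l v (th v)) *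
    (\prod_e trig N u (a (src e) (th (src e)) -
       (if neg e then - a (tgt e) (th (tgt e)) else a (tgt e) (th (tgt e)))))%:C%C =
  \sum_(k : flow N) (\prod_e u (fval k e))%:C%C *
    \prod_v \sum_t l v t * expi ((sdiv neg (fval k) v)%:~R * a v t).
Proof.
move=> uN.
under eq_bigr => th _ do rewrite (@prod_trig N u neg (fun v => a v (th v))) // mulr_sumr.
rewrite exchange_big /=; apply: eq_bigr => k _.
rewrite bigA_distr_bigA /= mulr_sumr; apply: eq_bigr => th _.
by rewrite mulrCA big_split.
Qed.

End BoxedFlows.

Section Griffiths.
Variables (R : realType) (V T : finType) (c s : V -> T -> R).
Local Notation config := {ffun V -> T}.

(** [c v] and [s v] stand for the cosine and the sine of the angle at [v], or of half of it; the
    cone consists of the polynomials in them with nonnegative coefficients. *)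
Inductive cone : (config -> R) -> Prop :=
| cone_const (x : R) : 0 <= x -> cone (fun=> x)
| cone_c v : cone (fun th => c v (th v))
| cone_s v : cone (fun th => s v (th v))
| cone_add F G : cone F -> cone G -> cone (fun th => F th + G th)
| cone_mul F G : cone F -> cone G -> cone (fun th => F th * G th)
| cone_ext F G : F =1 G -> cone F -> cone G.

(** After expansion into monomials the sum factors over the vertices, and the hypothesis gives the
    sign of each factor. *)
Lemma cone_ge0 (l : V -> T -> R) F :
  (forall v a b, 0 <= \sum_t l v t * (c v t ^+ a * s v t ^+ b)) ->
  cone F -> 0 <= \sum_(th : config) (\prod_v l v (th v)) * F th.
Proof.
move=> l_ge0 cF.
pose mon (ab : V -> nat * nat) (th : config) :=
  \prod_v (c v (th v) ^+ (ab v).1 * s v (th v) ^+ (ab v).2).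
(* Positivity against every monomial survives multiplication by [c v] or [s v], which only raises an
   exponent; the quantifier over [H] in [goodM] takes care of products. *)
pose good (G : config -> R) :=
  forall ab, 0 <= \sum_(th : config) (\prod_v l v (th v)) * (G th * mon ab th).
have good1 : good (fun=> 1).
  move=> ab; under eq_bigr do rewrite mul1r /mon -big_split /=.
  rewrite -(bigA_distr_bigA (fun v t => l v t * (c v t ^+ (ab v).1 * s v t ^+ (ab v).2))) /=.
  by apply: prodr_ge0 => v _; exact: l_ge0.
have goodM G : cone G -> forall H, good H -> good (fun th => G th * H th).
  elim=> {F cF G}.
  - move=> x x0 H gH ab; under eq_bigr do rewrite -mulrA mulrCA.
    by rewrite -mulr_sumr mulr_ge0.
  - move=> v H gH ab.
    pose ab' w := if w == v then ((ab w).1.+1, (ab w).2) else ab w.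
    suff eqF (th : config) : c v (th v) * H th * mon ab th = H th * mon ab' th.
      by under eq_bigr do rewrite eqF; exact: gH.
    rewrite [_ * H th]mulrC -mulrA; congr (_ * _).
    rewrite /mon [RHS](bigD1 v) //= [in LHS](bigD1 v) //= /ab' eqxx /= exprS.
    under [X in _ = _ * X]eq_bigr => w /negbTE -> do [].
    by ring.
  - move=> v H gH ab.
    pose ab' w := if w == v then ((ab w).1, (ab w).2.+1) else ab w.
    suff eqF (th : config) : s v (th v) * H th * mon ab th = H th * mon ab' th.
      by under eq_bigr do rewrite eqF; exact: gH.
    rewrite [_ * H th]mulrC -mulrA; congr (_ * _).
    rewrite /mon [RHS](bigD1 v) //= [in LHS](bigD1 v) //= /ab' eqxx /= exprS.
    under [X in _ = _ * X]eq_bigr => w /negbTE -> do [].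
    by ring.
  - move=> F G _ IF _ IG H gH ab.
    under eq_bigr do rewrite mulrDl mulrDl mulrDr.
    by rewrite big_split addr_ge0 // ?(IF _ gH) ?(IG _ gH).
  - move=> F G _ IF _ IG H gH ab.
    by under eq_bigr do rewrite -[F _ * G _ * _]mulrA; exact: (IF _ (IG _ gH)).
  - move=> F G FG _ IF H gH ab.
    by under eq_bigr do rewrite -FG; exact: (IF _ gH).
have := goodM _ cF _ good1 (fun=> (0%N, 0%N)).
have mon0 (th : config) : mon (fun=> (0%N, 0%N)) th = 1.
  by rewrite /mon big1 // => v _; rewrite !expr0 mulr1.
by under eq_bigr do rewrite mulr1 mon0 mulr1.
Qed.

(** Ginibre's condition. Asking for the sum as well as the difference makes it stable under
    products; [cone_ge0] applied to the difference then compares the weighted sums. *)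
Definition dominates (X Y : config -> R) :=
  cone (fun th => X th + Y th) /\ cone (fun th => X th - Y th).

(** Twice [X X' + Y Y'] is [(X + Y)(X' + Y') + (X - Y)(X' - Y')], and twice [X X' - Y Y'] is
    [(X + Y)(X' - Y') + (X - Y)(X' + Y')]. *)
Lemma dominatesM X Y X' Y' : dominates X Y -> dominates X' Y' ->
  dominates (fun th => X th * X' th) (fun th => Y th * Y' th).
Proof.
move=> [XYp XYm] [XYp' XYm'].
have h2 : cone (fun=> 2^-1) by constructor; rewrite invr_ge0.
split.
  apply: (cone_ext _ (cone_mul h2 (cone_add (cone_mul XYp XYp') (cone_mul XYm XYm')))).
  by move=> th /=; field.
apply: (cone_ext _ (cone_mul h2 (cone_add (cone_mul XYp XYm') (cone_mul XYm XYp')))).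
by move=> th /=; field.
Qed.

Lemma dominates1 : dominates (fun=> 1) (fun=> 1).
Proof. by split; apply: cone_const; rewrite ?subrr ?addr_ge0. Qed.

Lemma dominates_prod (I : Type) (r : seq I) (X Y : I -> config -> R) :
  (forall i, dominates (X i) (Y i)) ->
  dominates (fun th => \prod_(i <- r) X i th) (fun th => \prod_(i <- r) Y i th).
Proof.
move=> XY; elim: r => [|i r [IHp IHm]].
  by have [hp hm] := dominates1; split; [apply: cone_ext hp|apply: cone_ext hm] => th; rewrite !big_nil.
have [hp hm] := dominatesM (XY i) (conj IHp IHm).
by split; [apply: cone_ext hp|apply: cone_ext hm] => th; rewrite !big_cons.
Qed.

Lemma cone_prod (I : Type) (r : seq I) (X : I -> config -> R) :
  (forall i, cone (X i)) -> cone (fun th => \prod_(i <- r) X i th).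
Proof.
move=> cX; elim: r => [|i r IH].
  by apply: (cone_ext _ (cone_const ler01)) => th; rewrite big_nil.
by apply: (cone_ext _ (cone_mul (cX i) IH)) => th; rewrite big_cons.
Qed.

End Griffiths.

(** * Approximation of the Gaussian weights by Jacobi triple products *)

Section Jacobi.
Variables (R : realType) (p : R).
Hypothesis p01 : 0 < p < 1.

(* The coefficients of [prod_(n < N) (1 + 2 p^(2n+1) cos x + p^(4n+2))], up to
   normalization; see [trig_jac]. They tend to [p ^ (j^2)] as [N] grows. *)
Definition jac (N j : nat) : R :=
  p ^+ (j ^ 2) *
  \prod_(i < j) ((1 - p ^+ (2 * (N - i))) / (1 - p ^+ (2 * (N + i).+1))).

Definition jacw (N : nat) (k : int) : R := jac N `|k|%N.

Let p0 : 0 < p. Proof. by case/andP: p01. Qed.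
Let p1 : p < 1. Proof. by case/andP: p01. Qed.

Lemma expr_lt1_pos n : (0 < n)%N -> p ^+ n < 1.
Proof. by move=> n0; rewrite exprn_ilt1 // ?ltW // -lt0n. Qed.

Lemma one_sub_expr_gt0 n : 0 < 1 - p ^+ n.+1.
Proof. by rewrite subr_gt0 expr_lt1_pos. Qed.

Lemma one_sub_expr_ge0 n : 0 <= 1 - p ^+ n.
Proof. by rewrite subr_ge0 exprn_ile1 // ltW. Qed.

Lemma jac_ge0 N j : 0 <= jac N j.
Proof.
apply: mulr_ge0; first by rewrite exprn_ge0 // ltW.
apply: prodr_ge0 => i _.
by rewrite divr_ge0 ?one_sub_expr_ge0.
Qed.

Lemma jac_le N j : jac N j <= p ^+ (j ^ 2).
Proof.
apply: ler_piMr; first by rewrite exprn_ge0 // ltW.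
apply: prodr_ile1 => i _.
rewrite divr_ge0 ?one_sub_expr_ge0 //= ler_pdivrMr ?mulnS ?one_sub_expr_gt0 //.
rewrite mul1r lerD2l lerN2; apply: ler_wiXn2l; rewrite ?ltW //; lia.
Qed.

Lemma jac0 N : jac N 0 = 1.
Proof. by rewrite /jac big_ord0 mulr1. Qed.

Lemma jacS N j :
  jac N j.+1 = jac N j * (p ^+ (2 * j).+1 * ((1 - p ^+ (2 * (N - j))) / (1 - p ^+ (2 * (N + j).+1)))).
Proof.
rewrite /jac big_ord_recr /= [in RHS]mulrACA -exprD; congr (_ ^+ _ * _).
by rewrite -addn1 sqrnD; lia.
Qed.

Lemma jac_gt N j : (N < j)%N -> jac N j = 0.
Proof.
move=> Nj; rewrite /jac (bigD1 (Ordinal Nj)) //= subnn muln0 expr0 subrr.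
by rewrite !mul0r mulr0.
Qed.

Lemma jac_rec N j : (j <= N.+1)%N ->
  jac N.+1 j * (1 - p ^+ (2 * (N.+1 - j))) * (1 - p ^+ (2 * (N + j).+1)) =
  jac N j * (1 - p ^+ (2 * N.+1)) ^+ 2.
Proof.
elim: j => [|j IH] jN; first by rewrite !jac0 subn0 addn0; ring.
have h1 : 1 - p ^+ (2 * (N + j).+1) != 0 by rewrite mulnS gt_eqF ?one_sub_expr_gt0.
have h2 : 1 - p ^+ (2 * (N + j.+1).+1) != 0 by rewrite mulnS gt_eqF ?one_sub_expr_gt0.
have {}IH := IH (ltnW jN).
rewrite !jacS subSS (addSnnS N j).
transitivity (jac N.+1 j * (1 - p ^+ (2 * (N.+1 - j))) * (1 - p ^+ (2 * (N + j).+1))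
   * (p ^+ (2 * j).+1 * (1 - p ^+ (2 * (N - j))) / (1 - p ^+ (2 * (N + j).+1)))).
  by field; rewrite h1 h2.
by rewrite IH; field; rewrite h1.
Qed.

Lemma jac_recS N j : (j <= N)%N ->
  jac N.+1 j.+1 = jac N j * (p ^+ (2 * j).+1 * (1 - p ^+ (2 * N.+1)) ^+ 2 /
   ((1 - p ^+ (2 * (N + j).+1)) * (1 - p ^+ (2 * (N + j).+2)))).
Proof.
move=> jN.
have h1 : 1 - p ^+ (2 * (N + j).+1) != 0 by rewrite mulnS gt_eqF ?one_sub_expr_gt0.
have h2 : 1 - p ^+ (2 * (N + j).+2) != 0 by rewrite mulnS gt_eqF ?one_sub_expr_gt0.
have := @jac_rec N j (leqW jN); rewrite jacS addSn => e.
apply: (mulIf h1); apply: (mulIf h2).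
transitivity (jac N.+1 j * (1 - p ^+ (2 * (N.+1 - j))) * (1 - p ^+ (2 * (N + j).+1))
  * p ^+ (2 * j).+1); first by field.
by rewrite e; field; rewrite h1 h2.
Qed.

Let q N := p ^+ (2 * N).+1.
Let rho N := 1 + q N ^+ 2 + 2 * q N * jac N 1.

(** Multiplying a cosine polynomial by [1 + q^2 + 2 q cos x] combines neighbouring coefficients. The
    new constant coefficient is [rho N], and dividing by it restores the normalization
    [jac N.+1 0 = 1]. *)
Lemma jac_conv N j : (j <= N)%N ->
  rho N * jac N.+1 j.+1 =
  (1 + q N ^+ 2) * jac N j.+1 + q N * (jac N j + jac N j.+2).
Proof.
move=> jN.
have h1 : 1 - p ^+ (2 * (N + j).+1) != 0 by rewrite mulnS gt_eqF ?one_sub_expr_gt0.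
have h2 : 1 - p ^+ (2 * (N + j).+2) != 0 by rewrite mulnS gt_eqF ?one_sub_expr_gt0.
have h3 : 1 - p ^+ (2 * N.+1) != 0 by rewrite mulnS gt_eqF ?one_sub_expr_gt0.
rewrite jac_recS // [jac N j.+2]jacS /rho !jacS jac0 subn0 addn0 muln0 addnS -[X in X = _]mulrCA.
set b := jac N j.
suff -> : (1 + q N ^+ 2 + 2 * q N * (1 * (p ^+ 1 * ((1 - p ^+ (2 * N)) / (1 - p ^+ (2 * N.+1)))))) *
  (p ^+ (2 * j).+1 * (1 - p ^+ (2 * N.+1)) ^+ 2 / ((1 - p ^+ (2 * (N + j).+1)) * (1 - p ^+ (2 * (N + j).+2)))) =
  (1 + q N ^+ 2) * (p ^+ (2 * j).+1 * ((1 - p ^+ (2 * (N - j))) / (1 - p ^+ (2 * (N + j).+1)))) +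
  q N * (1 + (p ^+ (2 * j).+1 * ((1 - p ^+ (2 * (N - j))) / (1 - p ^+ (2 * (N + j).+1)))) *
    (p ^+ (2 * j.+1).+1 * ((1 - p ^+ (2 * (N - j.+1))) / (1 - p ^+ (2 * (N + j).+2))))) by ring.
rewrite /q.
(* With [N = j + d] both sides become rational functions of [p ^ j] and [p ^ d]. For [d = 0] the
   subtraction [N - j.+1] is truncated; the term containing it is multiplied by 0. *)
have [d Nd] : exists d, N = (j + d)%N by exists (N - j)%N; lia.
rewrite {}Nd {jN b} in h1 h2 h3 *; rewrite addKn; case: d h1 h2 h3 => [|d] h1 h2 h3; move: h1 h2 h3.
  rewrite !addn0 !muln0 expr0; move: (p ^+ (2 * (j - j.+1))) => z.
  rewrite (_ : 2 * j.+1 = j + j + 2)%N; last lia.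
  rewrite (_ : 2 * (j + j).+2 = j + j + j + j + 4)%N; last lia.
  rewrite (_ : 2 * (j + j).+1 = j + j + j + j + 2)%N; last lia.
  rewrite (_ : (2 * j).+1 = j + j + 1)%N; last lia.
  rewrite (_ : (2 * j) = j + j)%N; last lia.
  rewrite !exprD; move: (p ^+ j) => P h1 h2 h3; field.
  by rewrite ?h1 ?h2 ?h3.
rewrite (_ : j + d.+1 - j.+1 = d)%N; last lia.
rewrite (_ : 2 * (j + d.+1).+1 = j + j + d + d + 4)%N; last lia.
rewrite (_ : 2 * (j + d.+1 + j).+2 = j + j + j + j + d + d + 6)%N; last lia.
rewrite (_ : 2 * (j + d.+1 + j).+1 = j + j + j + j + d + d + 4)%N; last lia.
rewrite (_ : (2 * (j + d.+1)).+1 = j + j + d + d + 3)%N; last lia.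
rewrite (_ : (2 * (j + d.+1)) = j + j + d + d + 2)%N; last lia.
rewrite (_ : (2 * j.+1).+1 = j + j + 3)%N; last lia.
rewrite (_ : (2 * j).+1 = j + j + 1)%N; last lia.
rewrite (_ : 2 * d.+1 = d + d + 2)%N; last lia.
rewrite (_ : 2 * d = d + d)%N; last lia.
rewrite !exprD; move: (p ^+ j) (p ^+ d) => P D h1 h2 h3; field.
by rewrite ?h1 ?h2 ?h3.
Qed.

Lemma rho_gt0 N : 0 < rho N.
Proof.
have q0 : 0 < q N by rewrite exprn_gt0.
have := jac_ge0 N 1; rewrite /rho => j0; have : 0 <= q N * jac N 1 by rewrite mulr_ge0 // ltW.
nra.
Qed.

Definition csum (N M : nat) (x : R) : R :=
  1 + \sum_(j < M) 2 * jac N j.+1 * cos (j.+1%:R * x).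

Lemma csum_ext N M x : (N <= M)%N -> csum N M x = csum N N x.
Proof.
elim: M => [|M IH]; first by rewrite leqn0 => /eqP ->.
rewrite leq_eqVlt => /orP[/eqP <- //|]; rewrite ltnS => NM.
by rewrite -IH // /csum big_ord_recr /= jac_gt // mulr0 mul0r addr0.
Qed.

Lemma csumS N x :
  (1 + q N ^+ 2 + 2 * q N * cos x) * csum N N x = rho N * csum N.+1 N.+1 x.
Proof.
have cosr j : 2 * cos x * cos (j.+1%:R * x) = cos (j.+2%:R * x) + cos (j%:R * x).
  rewrite (_ : j.+2%:R * x = j.+1%:R * x + x); last by rewrite -[j.+2]addn1 natrD; ring.
  rewrite (_ : j%:R * x = j.+1%:R * x - x); last by rewrite -[j.+1]addn1 natrD; ring.
  by rewrite cosD cosB; ring.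
rewrite -(@csum_ext N N.+1) // /csum [in RHS]mulrDr mulr1 mulrDr mulr1.
rewrite [X in rho N + X]mulr_sumr.
under [X in rho N + X]eq_bigr => j _.
  rewrite mulrA (_ : rho N * _ = 2 * (rho N * jac N.+1 j.+1)); last by ring.
  rewrite jac_conv ?(leq_ord j) //.
  rewrite (_ : 2 * _ * _ = (1 + q N ^+ 2) * (2 * jac N j.+1 * cos (j.+1%:R * x))
    + (q N * (2 * jac N j * cos (j.+1%:R * x)) + q N * (2 * jac N j.+2 * cos (j.+1%:R * x)))); last by ring.
  over.
rewrite !big_split /= -!mulr_sumr [X in _ + X = _](mulrDl (1 + q N ^+ 2)).
have -> : 2 * q N * cos x * \sum_(j < N.+1) 2 * jac N j.+1 * cos (j.+1%:R * x) =
   q N * (\sum_(j < N.+1) 2 * jac N j.+1 * cos (j.+2%:R * x)) +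
   q N * (\sum_(j < N.+1) 2 * jac N j.+1 * cos (j%:R * x)).
  rewrite -mulrDr -big_split /= -!mulrA [in LHS]mulrCA; congr (_ * _).
  rewrite !mulr_sumr; apply: eq_bigr => j _; rewrite -mulrDr -cosr; ring.
have -> : \sum_(j < N.+1) 2 * jac N j * cos (j.+1%:R * x) =
  2 * cos x + \sum_(j < N.+1) 2 * jac N j.+1 * cos (j.+2%:R * x).
  rewrite big_ord_recl jac0 mulr1 mul1r; congr (_ + _).
  by rewrite [RHS]big_ord_recr /= jac_gt // mulr0 mul0r addr0.
have -> : \sum_(j < N.+1) 2 * jac N j.+1 * cos (j%:R * x) =
  2 * jac N 1 + \sum_(j < N.+1) 2 * jac N j.+2 * cos (j.+1%:R * x).
  rewrite big_ord_recl mul0r cos0 mulr1; congr (_ + _).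
  by rewrite [RHS]big_ord_recr /= jac_gt // mulr0 mul0r addr0.
rewrite /rho; ring.
Qed.

Lemma trig_csum N x : trig N (jacw N) x = csum N N x.
Proof.
rewrite /trig (sum_ib N (fun k => jacw N k * cos (k%:~R * x))) /csum /jacw.
rewrite absz0 mul0r cos0 mulr1 jac0; congr (_ + _); apply: eq_bigr => j _.
by rewrite abszN mulrNz mulNr cosN /=; ring.
Qed.

Lemma trig_jac N : exists2 C : R, 0 < C & forall x, trig N (jacw N) x =
  C * \prod_(n < N) (1 + q n ^+ 2 + 2 * q n * cos x).
Proof.
suff [C C0 h] : exists2 C : R, 0 < C & forall x, csum N N x =
    C * \prod_(n < N) (1 + q n ^+ 2 + 2 * q n * cos x).
  by exists C => // x; rewrite trig_csum.
elim: N => [|N [C C0 h]].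
  by exists 1 => // x; rewrite /csum !big_ord0 addr0 mulr1.
exists (C / rho N); first by rewrite divr_gt0 ?rho_gt0.
move=> x; rewrite big_ord_recr /=; apply: (mulfI (lt0r_neq0 (rho_gt0 N))).
by rewrite -csumS h; field; rewrite gt_eqF ?rho_gt0.
Qed.

Local Open Scope classical_set_scope.

Lemma cvg_jac j : jac N j @[N --> \oo] --> p ^+ (j ^ 2).
Proof.
have cp (f : nat -> nat) : (forall N, (N - j <= f N)%N) -> 1 - p ^+ f N @[N --> \oo] --> (1 : R).
  move=> fN; rewrite -[X in _ --> X]subr0; apply: cvgB; first exact: cvg_cst.
  have h : p ^+ (N - j) @[N --> \oo] --> (0 : R).
    rewrite -(cvg_shiftn j) /=; under eq_fun do rewrite addnK.
    by apply: cvg_expr; rewrite ger0_norm // ltW.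
  apply: (squeeze_cvgr _ (cvg_cst 0) h).
  apply: nearW => N; rewrite exprn_ge0 ?(ltW p0) //=.
  by apply: ler_wiXn2l; rewrite ?(ltW p0) ?(ltW p1).
suff h i : (i <= j)%N -> jac N i @[N --> \oo] --> p ^+ (i ^ 2) by exact: h.
elim: i => [|i IH] ij.
  have -> : (fun x => jac x 0) = cst (1 : R) by apply/funext => x; rewrite jac0.
  by rewrite exp0n // expr0; exact: cvg_cst.
under eq_fun do rewrite jacS.
rewrite (_ : p ^+ (i.+1 ^ 2) = p ^+ (i ^ 2) * (p ^+ (2 * i).+1 * (1 / 1))); last first.
  by rewrite divr1 mulr1 -exprD; congr (_ ^+ _); rewrite -addn1 sqrnD; lia.
apply: cvgM; first exact: IH (ltnW ij).
apply: cvgM; first exact: cvg_cst.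
apply: cvgM; first by apply: cp => N; lia.
by apply: cvgV; rewrite ?oner_neq0 //; apply: cp => N; lia.
Qed.

End Jacobi.

(** * Spin grids and the removal of the twist *)

Section GridAngles.
Variable R : realType.

Lemma sum_cos_odd (H : nat) (z : R) :
  2 * sin z * \sum_(j < H) cos ((2 * j).+1%:R * z) = sin ((2 * H)%:R * z).
Proof.
elim: H => [|H IH]; first by rewrite big_ord0 muln0 mul0r sin0 mulr0.
rewrite big_ord_recr /= mulrDr IH.
rewrite (_ : (2 * H)%:R * z = (2 * H).+1%:R * z - z); last by rewrite -(addn1 (2 * H)) natrD; ring.
rewrite (_ : (2 * H.+1)%:R * z = (2 * H).+1%:R * z + z); last by rewrite -(addn1 (2 * H)) mulnS !natrD; ring.
by rewrite sinB sinD; ring.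
Qed.

Lemma sin_int_pi (k : int) : sin (k%:~R * pi) = 0 :> R.
Proof.
have h (n : nat) : sin (n%:R * pi) = 0 :> R.
  by elim: n => [|n IH]; rewrite ?mul0r ?sin0 // -addn1 natrD mulrDl mul1r sinDpi IH oppr0.
by case: k => n; rewrite ?NegzE ?mulrNz ?mulNr ?sinN h ?oppr0.
Qed.

Lemma cos_int_pi (k : int) : cos (k%:~R * pi) = (-1) ^+ `|k|%N :> R.
Proof.
have h (n : nat) : cos (n%:R * pi) = (-1) ^+ n :> R.
  elim: n => [|n IH]; first by rewrite mul0r cos0.
  by rewrite -addn1 natrD mulrDl mul1r cosDpi IH addn1 exprS mulN1r.
by case: k => n; rewrite ?NegzE ?mulrNz ?mulNr ?cosN h.
Qed.

(* The angles are odd multiples of [pi / (4 H)], so that the grid is invariant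
   under the two reflections [t -> - t], [t -> pi - t] and avoids 0 and pi. *)
Definition gridT (H : nat) := ('I_H * bool * bool)%type.

Definition gbase (H j : nat) : R := (2 * j).+1%:R * (pi / (4 * H)%:R).

Definition gang (H : nat) (t : gridT H) : R :=
  let a := if t.1.2 then gbase H t.1.1 else pi - gbase H t.1.1 in
  if t.2 then a else - a.

Lemma gbase_itv (H : nat) (j : 'I_H) : 0 < gbase H j < pi / 2.
Proof.
have H0 : (0 < H)%N by have := ltn_ord j; lia.
have h4 : 0 < (4 * H)%:R :> R by rewrite ltr0n; lia.
rewrite /gbase mulr_gt0 ?divr_gt0 ?pi_gt0 //=.
rewrite mulrCA ltr_pM2l ?pi_gt0 // ltr_pdivrMr //.
rewrite (_ : 2^-1 * (4 * H)%:R = (2 * H)%:R) ?ltr_nat; first by have := ltn_ord j; lia.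
by rewrite !natrM; lra.
Qed.

Lemma sum_grid (M : zmodType) (H : nat) (f : gridT H -> M) :
  \sum_t f t = \sum_(j < H) (f (j, true, true) + f (j, true, false) +
                             f (j, false, true) + f (j, false, false)).
Proof.
rewrite (eq_bigr (fun t => (fun u b => f (u, b)) t.1 t.2)); last by case.
rewrite -(pair_bigA _ (fun u b => f (u, b))) /=.
rewrite (eq_bigr (fun t : 'I_H * bool => (fun j b => \sum_c f (j, b, c)) t.1 t.2)); last by case.
rewrite -(pair_bigA _ (fun j b => \sum_c f (j, b, c))) /=.
by apply: eq_bigr => j _; rewrite !big_bool /= !addrA.
Qed.

(** The four reflected angles run through all sign patterns of (cos, sin), so that the moment
    cancels unless both exponents are even. *)
Lemma grid_cs_ge0 (H : nat) (a b : nat) :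
  0 <= \sum_(t : gridT H) cos (gang t) ^+ a * sin (gang t) ^+ b.
Proof.
rewrite sum_grid sumr_ge0 // => j _; rewrite /gang /=.
have /andP[g0 g1] := gbase_itv j; set g := gbase H j in g0 g1 *.
have -> : cos (pi - g) = - cos g by rewrite addrC cosDpi cosN.
have -> : sin (pi - g) = sin g by rewrite addrC sinDpi sinN opprK.
rewrite !cosN !sinN (_ : sin (pi - g) = sin g); last by rewrite addrC sinDpi sinN opprK.
rewrite (_ : cos (pi - g) = - cos g); last by rewrite addrC cosDpi cosN.
have c0 : 0 <= cos g by apply: ltW; apply: cos_gt0_pihalf; have := pi_gt0 R; lra.
have s0 : 0 <= sin g by apply: ltW; apply: sin_gt0_pihalf; rewrite g0.
have ca := exprn_ge0 a c0; have sb := exprn_ge0 b s0.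
rewrite [(- cos g) ^+ a]exprNn [(- sin g) ^+ b]exprNn.
have h0 := mulr_ge0 ca sb.
by rewrite -!(signr_odd _ a) -!(signr_odd _ b); case: odd; case: odd; rewrite ?expr0 ?expr1; lra.
Qed.

(** Half of an angle of the grid lies strictly between [- pi / 2] and [pi / 2]: its cosine is
    positive, and only the odd powers of the sine cancel. *)
Lemma half_grid_ge0 (H : nat) (a b : nat) :
  0 <= \sum_(t : gridT H) cos (gang t / 2) ^+ a * sin (gang t / 2) ^+ b.
Proof.
rewrite sum_grid sumr_ge0 // => j _; rewrite /gang /=.
have /andP[g0 g1] := gbase_itv j; set g := gbase H j in g0 g1 *.
have pos z : 0 < z < pi -> 0 <= cos (z / 2) ^+ a * sin (z / 2) ^+ b + cos (- z / 2) ^+ a * sin (- z / 2) ^+ b.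
  move=> z0; rewrite mulNr cosN sinN [(- _) ^+ b]exprNn.
  have c0 : 0 <= cos (z / 2) by apply: ltW; apply: cos_gt0_pihalf; lra.
  have s0 : 0 <= sin (z / 2) by apply: ltW; apply: sin_gt0_pihalf; lra.
  have := mulr_ge0 (exprn_ge0 a c0) (exprn_ge0 b s0).
  by rewrite -!(signr_odd _ b); case: odd; rewrite ?expr0 ?expr1; lra.
rewrite -addrA; apply: addr_ge0; apply: pos; have := pi_gt0 R; lra.
Qed.

(** The grid consists of the [4 H] odd multiples of [pi / (4 H)] on the circle. Odd [d] cancel under
    [t -> pi - t], and nonzero even [d] by the closed form [sum_cos_odd]. *)
Lemma sum_grid_expi (H : nat) (d : int) : (`|d| < 4 * H)%N ->
  \sum_(t : gridT H) expi (d%:~R * gang t) = (if d == 0 then (4 * H)%:R else 0)%:C%C.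
Proof.
move=> dH.
have -> : \sum_(t : gridT H) expi (d%:~R * gang t) =
   (2 * (1 + (-1) ^+ `|d|%N) * \sum_(j < H) cos (d%:~R * gbase H j))%:C%C.
  rewrite sum_grid mulr_sumr rmorph_sum /=; apply: eq_bigr => j _; rewrite /gang /=.
  rewrite !mulrN mulrBr /expi !cosN !sinN cosB sinB sin_int_pi cos_int_pi !mul0r !add0r ?addr0 ?sub0r ?opprK.
  by apply/eqP; rewrite eq_complex /=; apply/andP; split; apply/eqP; ring.
congr (_%:C%C); have [->|d0] := eqVneq d 0.
  rewrite absz0 expr0; under eq_bigr do rewrite mul0r cos0.
  by rewrite sumr_const card_ord natrM; lra.
have [od|ev] := boolP (odd `|d|%N); first by rewrite -signr_odd od expr1; lra.
have H0 : (0 < H)%N by lia.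
set n := `|d|%N in dH ev *.
have n0 : (0 < n)%N by rewrite /n absz_gt0.
have nd : `|d%:~R : R| = n%:R by rewrite natr_absz intr_norm.
have h4 : 0 < (4 * H)%:R :> R by rewrite ltr0n; lia.
set z : R := n%:R * (pi / (4 * H)%:R).
have z0 : 0 < z by rewrite mulr_gt0 ?ltr0n // divr_gt0 ?pi_gt0.
have zpi : z < pi.
  by rewrite /z mulrCA gtr_pMr ?pi_gt0 // ltr_pdivrMr // mul1r ltr_nat.
have sz : sin z != 0 by rewrite gt_eqF // sin_gt0_pi // z0.
have := sum_cos_odd H z.
have -> : (2 * H)%:R * z = (n./2%:Z)%:~R * pi.
  have e : n%:R = n./2%:R * 2 :> R by rewrite -[in LHS](even_halfK ev) -muln2 natrM.
  rewrite /z e !natrM -pmulrn; field.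
  by rewrite pnatr_eq0 -lt0n.
rewrite sin_int_pi => /eqP; rewrite !mulf_eq0 pnatr_eq0 (negbTE sz) /= => /eqP h.
rewrite (eq_bigr (fun j : 'I_H => cos ((2 * j).+1%:R * z))) ?h ?mulr0 // => j _.
have g0 : 0 <= gbase H j by rewrite ltW // (andP (gbase_itv j)).1.
rewrite -cos_norm normrM nd (ger0_norm g0); congr cos; rewrite /gbase /z; ring.
Qed.

End GridAngles.

Lemma prodr_cond (R : comPzRingType) (V : finType) (P Q : pred V) :
  \prod_(v | Q v) (if P v then 1 else 0 : R) = (if [forall v, Q v ==> P v] then 1 else 0).
Proof.
case: ifP => [/forallP h|/forallPn[v]].
  by rewrite big1 // => v Qv; have := h v; rewrite Qv /= => ->.
by rewrite negb_imply => /andP[Qv /negbTE Pv]; rewrite (bigD1 v) //= Pv mul0r.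
Qed.

Lemma ifM1 (R : pzRingType) (b : bool) (x : R) : x * (if b then 1 else 0) = if b then x else 0.
Proof. by case: b; rewrite ?mulr1 ?mulr0. Qed.

Section FlowBounds.
Variables (V E : finType) (src tgt : E -> V) (N : nat).
Local Notation sdiv := (sdiv src tgt).

Lemma norm_ib (i : 'I_(2 * N).+1) : (`|ib i| <= N)%N.
Proof. rewrite /ib; have := ltn_ord i; lia. Qed.

Lemma norm_sdiv neg (k : flow E N) v : (`|sdiv neg (fval k) v| <= 2 * N * #|E|)%N.
Proof.
have h (P : pred E) (f : E -> int) : (forall e, (`|f e| <= N)%N) ->
    (`|(\sum_(e | P e) f e)%R| <= N * #|E|)%N.
  move=> fN; apply: leq_trans (_ : \sum_(e : E) N <= _)%N; last by rewrite sum_nat_const mulnC.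
  rewrite big_mkcond /=; elim/big_ind2: _ => //.
    by move=> x1 x2 y1 y2; lia.
  by move=> e _; case: ifP.
have gN e : (`|(if neg e then - fval k e else fval k e)%R| <= N)%N.
  by case: ifP => _; rewrite ?abszN; exact: norm_ib.
have tri (a b : int) (n : nat) : (`|a| <= n -> `|b| <= n -> `|a - b| <= 2 * n)%N by lia.
by rewrite -mulnA; apply: tri; [apply: h => e; exact: norm_ib | exact: h gN].
Qed.

End FlowBounds.

Section SpinBounds.
Variables (R : realType) (p : R).
Hypothesis p01 : 0 < p < 1.
Variables (V E : finType) (src tgt : E -> V) (N : nat).

Local Notation sdiv := (sdiv src tgt).
Local Notation jw := (jacw p N).
(** The grid must separate [sdiv], of size at most [2 N #|E|], from the sources in [fourier_max], of
    size at most [4 N #|E|]: their difference stays below [4 H]. *)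
Let H := (4 * N * #|E|).+1.
Local Notation T := (gridT H).

Lemma jacwN k : jw (- k) = jw k.
Proof. by rewrite /jacw abszN. Qed.

Lemma trig_ge0 x : 0 <= trig N jw x.
Proof.
have [C C0 ->] := trig_jac p01 N; rewrite mulr_ge0 ?ltW // prodr_gt0 // => n _.
have := cos_geN1 x; set q := p ^+ _; have q0 : 0 < q by rewrite exprn_gt0 // (andP p01).1.
have q1 : q < 1 by rewrite expr_lt1_pos.
by nra.
Qed.

Lemma sum_grid_weight (d : int) : (`|d| < 4 * H)%N ->
  \sum_(t : T) ((4 * H)%:R^-1 : R)%:C%C * expi (d%:~R * gang R t) =
  (if d == 0 then 1 else 0)%:C%C.
Proof.
move=> dH; rewrite -mulr_sumr sum_grid_expi // -rmorphM /=; congr (_%:C%C).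
by case: ifP => _; rewrite ?mulr0 // mulVf // pnatr_eq0.
Qed.

(** Both sides are Fourier coefficients of the product of the [trig N jw], which is nonnegative, and
    the right-hand one is its mean. *)
Lemma fourier_max (d : V -> int) : (forall v, `|d v| <= 4 * N * #|E|)%N ->
  \sum_(k : flow E N | [forall v, sdiv pred0 (fval k) v == d v]) \prod_e jw (fval k e) <=
  \sum_(k : flow E N | [forall v, sdiv pred0 (fval k) v == 0]) \prod_e jw (fval k e).
Proof.
move=> dH.
have main (b : bool) (d' := fun v => if b then d v else 0) :
    (\sum_(k : flow E N | [forall v, sdiv pred0 (fval k) v == d' v]) \prod_e jw (fval k e)) =
    complex.Re (\sum_(th : {ffun V -> T}) (\prod_v (((4 * H)%:R^-1 : R)%:C%C * expi (- (d' v)%:~R * gang R (th v)))) *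
    (\prod_e trig N jw (gang R (th (src e)) - gang R (th (tgt e))))%:C%C).
  rewrite (@spin_flow R V E src tgt T N jw pred0 (fun _ => @gang R H)
     (fun v t => ((4 * H)%:R^-1 : R)%:C%C * expi (- (d' v)%:~R * gang R t)) jacwN) Re_sum big_mkcond /=.
  apply: eq_bigr => k _; rewrite Re_realM.
  rewrite (eq_bigr (fun v => (if sdiv pred0 (fval k) v == d' v then 1 else 0)%:C%C)); last first.
    move=> v _; rewrite (eq_bigr (fun t : T => ((4 * H)%:R^-1 : R)%:C%C *
        expi ((sdiv pred0 (fval k) v - d' v)%:~R * gang R t))); last first.
      by move=> t _; rewrite -mulrA -expiD; congr (_ * expi _); move: (sdiv _ _ v) => D; rewrite rmorphB /=; ring.
    rewrite sum_grid_weight ?subr_eq0 //.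
    have := norm_sdiv src tgt pred0 k v; have : (`|d' v| <= 4 * N * #|E|)%N by rewrite /d'; case: (b).
    by rewrite /H; lia.
  rewrite -(rmorph_prod (real_complex R)) /= (prodr_cond _ _ predT) /= ifM1.
  by [].
rewrite (main true) (main false) !Re_sum; apply: ler_sum => th _.
rewrite !(mulrC _ (_%:C%C)) !Re_realM; apply: ler_wpM2l.
  by apply: prodr_ge0 => e _; exact: trig_ge0.
rewrite !big_split -!expi_sum -!(rmorph_prod (real_complex R)).
rewrite !Re_realM.
apply: ler_wpM2l; first by apply: prodr_ge0 => v _; rewrite invr_ge0.
rewrite [X in _ <= cos X]big1 ?cos0 ?cos_le1 // => v _.
by rewrite oppr0 mul0r.
Qed.

Variables x y : V.
Hypothesis xy : x != y.

Definition twisted (neg : pred E) (k : E -> int) : bool :=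
  [&& [forall v, (v != x) && (v != y) ==> (sdiv neg k v == 0)],
      odd `|sdiv neg k x| & odd `|sdiv neg k y|].

(** At a pole the angle is 0 or [pi] with weights 1 and -1, so that averaging gives
    [(1 - (-1)^d) / 2] and selects the odd divergences; elsewhere the uniform grid selects
    divergence 0. *)
Let a v (t : T) : R := if (v == x) || (v == y) then (if t.1.2 then 0 else pi) else gang R t.
Let l v (t : T) : R := (if (v == x) || (v == y) then (if t.1.2 then 1 else -1) else 1) / (4 * H)%:R.
Let phi (neg : pred E) (th : {ffun V -> T}) e : R :=
  a (src e) (th (src e)) - (if neg e then - a (tgt e) (th (tgt e)) else a (tgt e) (th (tgt e))).

Lemma twisted_spin neg :
  \sum_(k : flow E N | twisted neg (fval k)) \prod_e jw (fval k e) =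
  \sum_(th : {ffun V -> T}) (\prod_v l v (th v)) * \prod_e trig N jw (phi neg th e).
Proof.
have := @spin_flow R V E src tgt T N jw neg a (fun v t => (l v t)%:C%C) jacwN.
rewrite (eq_bigr (fun th : {ffun V -> T} => ((\prod_v l v (th v)) * \prod_e trig N jw (phi neg th e))%:C%C)); last first.
  by move=> th _; rewrite [RHS](rmorphM (real_complex R)) [in RHS](rmorph_prod (real_complex R)).
rewrite -rmorph_sum /= => e; apply: (@complexI R); rewrite e {e} rmorph_sum /= big_mkcond /=.
apply: eq_bigr => k _.
rewrite (eq_bigr (fun v => (if (if (v == x) || (v == y) then odd `|sdiv neg (fval k) v|
    else sdiv neg (fval k) v == 0) then 1 else 0)%:C%C)); last first.
  move=> v _; rewrite /l /a; case vxy : ((v == x) || (v == y)).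
    rewrite (eq_bigr (fun t : T =>
        ((if t.1.2 then 1 else - (-1) ^+ `|sdiv neg (fval k) v|) / (4 * H)%:R)%:C%C)); last first.
      move=> t _; rewrite /expi; case: (t.1.2); rewrite ?mulr0 ?sin0 ?cos0 ?sin_int_pi ?cos_int_pi;
      by apply/eqP; rewrite eq_complex /=; apply/andP; split; apply/eqP; try move: ((-1) ^+ _) => w; ring.
    rewrite -(rmorph_sum (real_complex R)) /=; congr (_%:C%C); rewrite sum_grid /=.
    rewrite sumr_const card_ord -signr_odd -mulr_natl natrM.
    by case: odd; rewrite ?expr1 ?expr0; field; rewrite pnatr_eq0.
  under eq_bigr do rewrite mul1r.
  rewrite sum_grid_weight //; have := norm_sdiv src tgt neg k v; rewrite /H; lia.
rewrite -(rmorph_prod (real_complex R)) /= -(rmorphM (real_complex R)) /= (prodr_cond _ _ predT) ifM1 /=.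
set b := [forall v, _]; suff -> : twisted neg (fval k) = b by case: ifP.
rewrite /twisted; apply/and3P/forallP.
  move=> [/forallP h hx hy] v /=; have := h v.
  have [e|vx] := eqVneq v x; first by rewrite e.
  by have [e|vy] := eqVneq v y; first by rewrite e.
move=> h; split.
- by apply/forallP => v; have := h v; case: eqP => //= _; case: eqP.
- by have := h x; rewrite eqxx.
- by have := h y; rewrite eqxx orbT.
Qed.

(* A twisted edge couples through [cos (a + b) = c c' - s s'] instead of
   [cos (a - b) = c c' + s s']: only the signs of the expansion change. *)
Lemma twist_removal neg :
  \sum_(k : flow E N | twisted neg (fval k)) \prod_e jw (fval k e) <=
  \sum_(k : flow E N | twisted pred0 (fval k)) \prod_e jw (fval k e).
Proof.
rewrite !twisted_spin -subr_ge0 -sumrB; under eq_bigr do rewrite -mulrBr.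
pose c v t := cos (a v t); pose s v t := sin (a v t).
apply: (@cone_ge0 _ _ _ c s) => [v i j|].
  (* At a pole the sine vanishes, and for [j = 0] the moment is a positive multiple of
     [1 - (-1)^i]. *)
  rewrite /c /s /l /a; case: ((v == x) || (v == y)).
    rewrite sum_grid /= sumr_ge0 // => u _; rewrite sin0 cos0 sinpi cospi expr1n.
    rewrite -(signr_odd _ i) -!addrA.
    have hi : 0 < (4 * H)%:R^-1 :> R by rewrite invr_gt0 ltr0n.
    by case: j => [|j]; rewrite ?expr0 ?expr0n /=; case: odd; rewrite ?expr0 ?expr1; lra.
  under eq_bigr do rewrite mul1r; rewrite -mulr_sumr mulr_ge0 ?invr_ge0 //; exact: grid_cs_ge0.
suff [_] : dominates c s (fun th : {ffun V -> T} => \prod_e trig N jw (phi pred0 th e))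
   (fun th => \prod_e trig N jw (phi neg th e)) by [].
apply: (@dominates_prod R V T c s E (index_enum E)
  (fun e (th : {ffun V -> T}) => trig N jw (phi pred0 th e)) (fun e th => trig N jw (phi neg th e))) => e.
have [C C0 CE] := trig_jac p01 N.
have ext X Y X' Y' : X =1 X' -> Y =1 Y' -> dominates c s X Y -> dominates c s X' Y'.
  by move=> XX YY [h1 h2]; split; [apply: cone_ext h1|apply: cone_ext h2] => th; rewrite XX YY.
apply: (ext _ _ _ _ (fun th => esym (CE (phi pred0 th e))) (fun th => esym (CE (phi neg th e)))).
apply: dominatesM.
  by split; apply: cone_const; rewrite ?subrr // addr_ge0 // ltW.
apply: (@dominates_prod R V T c s _ (index_enum _)
  (fun (n : 'I_N) (th : {ffun V -> T}) => 1 + (p ^+ (2 * n).+1) ^+ 2 + 2 * p ^+ (2 * n).+1 * cos (phi pred0 th e))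
  (fun n th => 1 + (p ^+ (2 * n).+1) ^+ 2 + 2 * p ^+ (2 * n).+1 * cos (phi neg th e))) => n.
set q := p ^+ _; have q0 : 0 <= q by rewrite exprn_ge0 // ltW // (andP p01).1.
have cc : cone c s (fun th : {ffun V -> T} => c (src e) (th (src e)) * c (tgt e) (th (tgt e))).
  by apply: cone_mul; apply: cone_c.
have ss : cone c s (fun th : {ffun V -> T} => s (src e) (th (src e)) * s (tgt e) (th (tgt e))).
  by apply: cone_mul; apply: cone_s.
have q2 := sqr_ge0 q.
have c1 : cone c s (fun=> 2 * (1 + q ^+ 2)) by apply: cone_const; nra.
have c4 : cone c s (fun=> 4 * q) by apply: cone_const; nra.
split.
  case neq : (neg e).
    by apply: (cone_ext _ (cone_add c1 (cone_mul c4 cc))) => th; rewrite /phi neq /= opprK cosB cosD /c; ring.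
  by apply: (cone_ext _ (cone_add c1 (cone_mul c4 (cone_add cc ss)))) => th; rewrite /phi neq /= cosB /c /s; ring.
case neq : (neg e).
  by apply: (cone_ext _ (cone_mul c4 ss)) => th; rewrite /phi neq /= opprK cosB cosD /s; ring.
by apply: (cone_ext _ (cone_const c s (lexx 0))) => th; rewrite /phi neq /= subrr.
Qed.

End SpinBounds.

(** * Monotonicity in the source *)

Section SineCoefficients.
Local Open Scope classical_set_scope.
Local Open Scope ring_scope.
Variable R : realType.

Lemma sin_nat_le (n : nat) (z : R) : `|sin (n%:R * z)| <= n%:R * `|sin z|.
Proof.
elim: n => [|n IH]; first by rewrite !mul0r sin0 normr0.
rewrite -addn1 natrD !mulrDl !mul1r sinD (le_trans (ler_normD _ _)) // lerD //.
  by rewrite normrM (le_trans _ IH) // ler_piMr // cos_max.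
by rewrite normrM ler_piMl // cos_max.
Qed.

Lemma cvg_sin_quot (d : R) : sin (d * h) / h @[h --> 0^'] --> d.
Proof.
have h : is_derive (0 : R) 1 (fun b : R => sin (d * b)) d.
  have h1 : is_derive (0 : R) 1 (fun b : R => d * b) d.
    by apply: is_derive_eq; rewrite /GRing.scale /= mulr1.
  have h2 := is_derive_sin (d * 0).
  have := @is_derive1_comp R (@sin R) (fun b => d * b) 0 _ _ h2 h1.
  by rewrite mulr0 cos0 mul1r.
case: h => /cvg_ex[l hl] dE.
have ld : l = d by rewrite -dE; apply/esym; exact: cvg_lim hl.
move: hl; rewrite ld.
move=> hl; apply: cvg_trans hl; apply: near_eq_cvg; apply: nearW => h /=.
by rewrite addr0 mulr0 sin0 subr0 /GRing.scale /= mulr1 mulrC.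
Qed.

(** Discrete orthogonality of the sines at the odd multiples of [pi / (2 H)]; the sign of [d]
    appears because the sine is odd. *)
Lemma sum_sin_sin (H m : nat) (d : int) : (0 < m)%N -> (`|d| + m < 2 * H)%N ->
  \sum_(j < H) sin (m%:R * ((2 * j).+1%:R * (pi / (2 * H)%:R))) *
    sin (d%:~R * ((2 * j).+1%:R * (pi / (2 * H)%:R))) =
  (H%:R / 2) * (if `|d|%N == m then Num.sg d%:~R else 0) :> R.
Proof.
move=> m0 dmH.
have H0 : (0 < H)%N by lia.
have h2 : 0 < (2 * H)%:R :> R by rewrite ltr0n; lia.
pose S (e : int) : R := \sum_(j < H) cos (e%:~R * ((2 * j).+1%:R * (pi / (2 * H)%:R))).
have SN e : S (- e) = S e by apply: eq_bigr => j _; rewrite mulrNz mulNr cosN.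
have SE (n : nat) : (n < 2 * H)%N -> S n = (if n == 0%N then H%:R else 0).
  move=> nH; case: eqP => [->|/eqP n0].
    by rewrite /S; under eq_bigr do rewrite mul0r cos0; rewrite sumr_const card_ord.
  set z : R := n%:R * (pi / (2 * H)%:R).
  have z0 : 0 < z by rewrite mulr_gt0 ?ltr0n ?lt0n // divr_gt0 ?pi_gt0.
  have zpi : z < pi by rewrite /z mulrCA gtr_pMr ?pi_gt0 // ltr_pdivrMr // mul1r ltr_nat.
  have sz : sin z != 0 by rewrite gt_eqF // sin_gt0_pi // z0.
  have := sum_cos_odd H z.
  have -> : (2 * H)%:R * z = (n%:Z)%:~R * pi.
    by rewrite /z -pmulrn mulrCA [_ * (pi / _)]mulrC divfK // gt_eqF.
  rewrite sin_int_pi => /eqP; rewrite !mulf_eq0 pnatr_eq0 (negbTE sz) /= => /eqP h.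
  by rewrite /S -[RHS]h; apply: eq_bigr => j _; congr cos; rewrite /z -pmulrn; ring.
have SE' (e : int) : (`|e| < 2 * H)%N -> S e = (if e == 0 then H%:R else 0).
  by case: e => n nH; rewrite ?NegzE ?SN SE.
transitivity ((S (m%:Z - d) - S (m%:Z + d)) / 2).
  rewrite /S -sumrB mulr_suml; apply: eq_bigr => j _.
  set w := _ * (pi / _).
  by rewrite rmorphB rmorphD /= [(_ - d%:~R) * w]mulrBl [(_ + d%:~R) * w]mulrDl -!pmulrn cosB cosD; field.
rewrite !SE'; try lia.
have [->|d0] := eqVneq d 0.
  have -> : (m%:Z - 0 == 0) = false by lia.
  by rewrite absz0 eq_sym (gtn_eqF m0) mulr0 subrr mul0r.
have [md|/eqP md] := eqVneq `|d|%N m; last first.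
  by rewrite !ifF ?subrr ?mul0r ?mulr0 //; apply/eqP; lia.
have [dp|dn] := ltrP 0 d.
  by rewrite gtr0_sg ?ltr0z // mulr1 ifT ?ifF ?subr0 //; apply/eqP; lia.
have dn' : d < 0 by rewrite lt_neqAle d0.
by rewrite ltr0_sg ?ltrz0 // mulrN1 ifF ?ifT ?sub0r ?mulNr //; apply/eqP; lia.
Qed.

(* The hypothesis says that the even function with cosine coefficients [w] is
   decreasing on [0, pi]; its derivative is then tested against the
   nonnegative function [m sin z - sin (m z)]. *)
Lemma unimodal_coeff (I : finType) (w : I -> R) (d : I -> int) (m : nat) : (0 < m)%N ->
  (forall al be, 0 <= al <= pi -> 0 <= be <= pi ->
     0 <= \sum_i w i * (sin ((d i)%:~R * al) * sin ((d i)%:~R * be))) ->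
  \sum_(i | `|d i|%N == m) w i <= \sum_(i | `|d i|%N == 1%N) w i.
Proof.
move=> m0 pos.
(* The sign of the derivative is obtained by dividing the hypothesis by [be] and letting [be] tend
   to 0. *)
have G0 al : 0 <= al <= pi -> 0 <= \sum_i w i * ((d i)%:~R * sin ((d i)%:~R * al)).
  move=> alp.
  have cv : \sum_i w i * (sin ((d i)%:~R * al) * (sin ((d i)%:~R * h) / h)) @[h --> 0^'] -->
      \sum_i w i * (sin ((d i)%:~R * al) * (d i)%:~R).
    apply: cvg_big; first exact: add_continuous.
    by move=> i _; apply: cvgMr; apply: cvgMr; exact: cvg_sin_quot.
  have -> : \sum_i w i * ((d i)%:~R * sin ((d i)%:~R * al)) =
      \sum_i w i * (sin ((d i)%:~R * al) * (d i)%:~R) by apply: eq_bigr => i _; ring.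
  apply: cvgr_to_ge cv _.
  have : \forall h \near 0^', h != 0 /\ `|h : R| < pi.
    near=> h; split; first by near: h; exact: nbhs_dnbhs_neq.
    by near: h; apply: dnbhs0_lt; exact: pi_gt0.
  apply: filterS => h [h0 hpi].
  (* The quotient is even in [h], so that the hypothesis on nonnegative angles is applied to the
     absolute value of [h]. *)
  have -> : \sum_i w i * (sin ((d i)%:~R * al) * (sin ((d i)%:~R * h) / h)) =
    `|h|^-1 * \sum_i w i * (sin ((d i)%:~R * al) * sin ((d i)%:~R * `|h|)).
    rewrite mulr_sumr; apply: eq_bigr => i _.
    have [h1|h1] := ger0P h; first by ring.
    by rewrite mulrN sinN invrN; ring.
  rewrite mulr_ge0 ?invr_ge0 //; apply: pos => //.
  by rewrite normr_ge0 ltW.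
set H := ((\max_i `|d i|) + m).+1.
have h2 : 0 < (2 * H)%:R :> R by rewrite ltr0n.
pose al (j : 'I_H) : R := (2 * j).+1%:R * (pi / (2 * H)%:R).
have alp (j : 'I_H) : 0 <= al j <= pi.
  rewrite /al mulr_ge0 ?divr_ge0 ?pi_ge0 //= mulrCA ger_pMr ?pi_gt0 //.
  by rewrite ler_pdivrMr // mul1r ler_nat; have := ltn_ord j; lia.
have dH i : (`|d i| + m < 2 * H)%N.
  have := @leq_bigmax _ (fun i => `|d i|%N) i; rewrite /H; lia.
have : 0 <= \sum_(j < H) (m%:R * sin (al j) - sin (m%:R * al j)) *
   \sum_i w i * ((d i)%:~R * sin ((d i)%:~R * al j)).
  apply: sumr_ge0 => j _; apply: mulr_ge0; last exact: G0.
  have s0 : 0 <= sin (al j) by apply: sin_ge0_pi.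
  have := sin_nat_le m (al j); rewrite (ger0_norm s0) subr_ge0 => h.
  exact: le_trans (ler_norm _) h.
(* Orthogonality leaves the indices with absolute value 1, with factor [m H / 2], and those with
   absolute value [m], with factor [- m H / 2]. *)
have -> : \sum_(j < H) (m%:R * sin (al j) - sin (m%:R * al j)) *
   (\sum_i w i * ((d i)%:~R * sin ((d i)%:~R * al j))) =
   m%:R * H%:R / 2 * (\sum_(i | `|d i|%N == 1%N) w i - \sum_(i | `|d i|%N == m) w i).
  under eq_bigr do rewrite mulr_sumr.
  rewrite exchange_big /= [X in _ * (X - _)]big_mkcond [X in _ * (_ - X)]big_mkcond -sumrB mulr_sumr.
  apply: eq_bigr => i _.
  transitivity (w i * (d i)%:~R * (m%:R * (\sum_(j < H) sin (1%:R * al j) * sin ((d i)%:~R * al j)) -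
     \sum_(j < H) sin (m%:R * al j) * sin ((d i)%:~R * al j))).
    rewrite mulr_sumr -sumrB mulr_sumr; apply: eq_bigr => j _; rewrite mul1r; ring.
  rewrite !sum_sin_sin //; last by have := dH i; lia.
  have sgd (n : nat) : `|d i|%N = n -> (d i)%:~R * Num.sg (d i)%:~R = n%:R :> R.
    by move=> <-; rewrite mulrC -normrEsg natr_absz intr_norm.
  case: eqP => e1; case: eqP => em; rewrite ?mulr0 ?subr0 ?sub0r.
  - by have -> : m = 1%N by [rewrite -em]; ring.
  - by have := sgd _ e1; set D := (d i)%:~R; set g := Num.sg _ => Dg; transitivity (w i * (D * g) * m%:R * (H%:R / 2)); [ring | rewrite Dg; ring].
  - by have := sgd _ em; set D := (d i)%:~R; set g := Num.sg _ => Dg; transitivity (- (w i * (D * g) * (H%:R / 2))); [ring | rewrite Dg; ring].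
  - by ring.
by rewrite pmulr_rge0 ?subr_ge0 // divr_gt0 // mulr_gt0 // ltr0n.
Unshelve. all: by end_near. Qed.

End SineCoefficients.

Section Dipoles.
Variables (V E : finType) (src tgt : E -> V) (x y : V).
Hypothesis xy : x != y.

Local Notation dv := (sdiv src tgt pred0).

Lemma sum_sdiv (k : E -> int) : \sum_v dv k v = 0.
Proof.
rewrite /sdiv sumrB; apply/eqP; rewrite subr_eq0; apply/eqP.
have h (f : E -> V) : \sum_v \sum_(e | f e == v) k e = \sum_e k e.
  by rewrite [RHS](partition_big f predT).
by rewrite !h.
Qed.

Definition offxy (k : E -> int) : bool :=
  [forall v, (v != x) && (v != y) ==> (dv k v == 0)].

Lemma offxy_sum k : offxy k -> dv k y = - dv k x.
Proof.
move=> /forallP h; have := sum_sdiv k.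
rewrite (bigD1 x) //= (bigD1 y) /=; last by rewrite eq_sym.
rewrite big1 ?addr0; first lia.
by move=> v vxy; have := h v; rewrite vxy => /eqP.
Qed.

Lemma offxy_dipole k z : offxy k -> dv k x = z ->
  forall v, dv k v = z * ((v == x)%:R - (v == y)%:R).
Proof.
move=> off dx v; have dy := offxy_sum off.
have [->|vx] := eqVneq v x; first by rewrite (negbTE xy) dx subr0 mulr1.
have [->|vy] := eqVneq v y; first by rewrite dy dx sub0r mulrN1.
by have /forallP/(_ v) := off; rewrite vx vy /= => /eqP ->; rewrite subr0 mulr0.
Qed.

Variables (R : realType) (p : R) (N : nat).
Hypothesis p01 : 0 < p < 1.
Local Notation jw := (jacw p N).
Let H := (4 * N * #|E|).+1.
Local Notation T := (gridT H).

Section Form.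
Variables al be : R.
Hypotheses (alp : 0 <= al <= pi) (bep : 0 <= be <= pi).

(** The signed weights antisymmetrize at the poles: the sum there is [i sin (d al)] at [x] and
    [i sin (- d be)] at [y], with [d] the divergence at [x], whose product is the product of sines
    wanted. *)
Let a v (t : T) : R :=
  if v == x then (if t.2 then al else - al)
  else if v == y then (if t.2 then be else - be) else gang R t.
Let l v (t : T) : R := (if (v == x) || (v == y) then (if t.2 then 1 else -1) else 1) / (4 * H)%:R.

Lemma half_weight_ge0 (z : R) (i j : nat) : 0 <= z <= pi ->
  0 <= \sum_(t : T) (if t.2 then 1 else -1) / (4 * H)%:R *
    (cos ((if t.2 then z else - z) / 2) ^+ i * sin ((if t.2 then z else - z) / 2) ^+ j).
Proof.
move=> zp; rewrite sum_grid /= sumr_ge0 // => u _.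
rewrite [- z / 2]mulNr cosN sinN [(- sin _) ^+ j]exprNn.
have c0 : 0 <= cos (z / 2) by apply: cos_ge0_pihalf; lra.
have s0 : 0 <= sin (z / 2) by apply: sin_ge0_pi; lra.
have := mulr_ge0 (exprn_ge0 i c0) (exprn_ge0 j s0).
have hi : 0 < (4 * H)%:R^-1 :> R by rewrite invr_gt0 ltr0n.
rewrite -(signr_odd _ j); set w := (_ ^+ i * _) => w0.
rewrite !(mulrCA (cos _ ^+ i)) -/w.
by have := mulr_ge0 (ltW hi) w0; case: odd; rewrite ?expr0 ?expr1; nra.
Qed.

(** Griffiths' inequality for half angles. For [z] in [[0, pi]] both [cos (z / 2)] and [sin (z / 2)]
    are nonnegative, whereas [cos z] changes sign, so that the signed weights at the poles have
    nonnegative moments only for the half angles. *)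
Lemma sine_form_ge0 :
  0 <= \sum_(k : flow E N | offxy (fval k)) (\prod_e jw (fval k e)) *
    (sin ((dv (fval k) x)%:~R * al) * sin ((dv (fval k) x)%:~R * be)).
Proof.
have := @spin_flow R V E src tgt T N jw pred0 a (fun v t => (l v t)%:C%C) (jacwN p N).
rewrite (eq_bigr (fun th : {ffun V -> T} => ((\prod_v l v (th v)) *
    \prod_e trig N jw (a (src e) (th (src e)) - a (tgt e) (th (tgt e))))%:C%C)); last first.
  by move=> th _; rewrite [RHS](rmorphM (real_complex R)) [in RHS](rmorph_prod (real_complex R)).
rewrite -rmorph_sum /=.
rewrite [RHS](_ : _ = (\sum_(k : flow E N | offxy (fval k)) (\prod_e jw (fval k e)) *
    (sin ((dv (fval k) x)%:~R * al) * sin ((dv (fval k) x)%:~R * be)))%:C%C); last first.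
  rewrite rmorph_sum /= [RHS]big_mkcond; apply: eq_bigr => k _.
  have pole v z : (v == x) || (v == y) -> (forall t, a v t = if t.2 then z else - z) ->
     \sum_(t : T) (l v t)%:C%C * expi ((dv (fval k) v)%:~R * a v t) =
     Complex 0 (sin ((dv (fval k) v)%:~R * z)).
    move=> vxy az; rewrite /l vxy.
    rewrite (eq_bigr (fun t : T => ((4 * H)%:R^-1 : R)%:C%C * (if t.2 then expi ((dv (fval k) v)%:~R * z) else - expi (- ((dv (fval k) v)%:~R * z))))); last first.
      move=> t _; rewrite az; case: (t.2); first by rewrite mul1r.
      by rewrite mulN1r rmorphN /= mulNr mulrN mulrN.
    rewrite -mulr_sumr sum_grid /= sumr_const card_ord /expi cosN sinN.
    rewrite (_ : _ + _ = Complex 0 (4 * sin ((dv (fval k) v)%:~R * z))); last first.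
      by apply/eqP; rewrite eq_complex /=; apply/andP; split; apply/eqP; ring.
    rewrite -[Complex 0 _ *+ _]mulr_natl -(rmorph_nat (real_complex R)); apply/eqP; rewrite eq_complex /= natrM.
    by apply/andP; split; apply/eqP; field; rewrite pnatr_eq0.
  have plain v : (v != x) && (v != y) ->
     \sum_(t : T) (l v t)%:C%C * expi ((dv (fval k) v)%:~R * a v t) =
     (if dv (fval k) v == 0 then 1 else 0)%:C%C.
    move=> /andP[/negbTE vx /negbTE vy]; rewrite /l /a vx vy /=.
    under eq_bigr do rewrite mul1r.
    by rewrite sum_grid_weight //; have := norm_sdiv src tgt pred0 k v; rewrite /H; lia.
  case: ifP => ofk; last first.
    move/negbT: ofk; rewrite negb_forall => /existsP[v]; rewrite negb_imply => /andP[vxy dv0].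
    by rewrite (bigD1 v) //= (plain v vxy) (negbTE dv0) mul0r mulr0.
  rewrite (bigD1 x) //= (bigD1 y) /=; last by rewrite eq_sym.
  rewrite (pole x al) ?eqxx //; last by move=> t; rewrite /a eqxx.
  rewrite (pole y be) ?eqxx ?orbT //; last by move=> t; rewrite /a eqxx eq_sym (negbTE xy).
  rewrite [X in _ * (_ * (_ * X))]big1 ?mulr1; last first.
    by move=> v vxy; move/forallP/(_ v): ofk; rewrite (plain v vxy) vxy /= => ->.
  rewrite (offxy_sum ofk) mulrNz mulNr sinN.
  by apply/eqP; rewrite eq_complex /=; apply/andP; split; apply/eqP; ring.
move/complexI => <-.
pose c v t := cos (a v t / 2); pose s v t := sin (a v t / 2).
apply: (@cone_ge0 _ _ _ c s) => [v i j|].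
  rewrite /c /s /l /a; have [_|vx] := eqVneq v x; first exact: half_weight_ge0.
  have [_|vy] := eqVneq v y; first exact: half_weight_ge0.
  under eq_bigr do rewrite mul1r; rewrite -mulr_sumr mulr_ge0 ?invr_ge0 //; exact: half_grid_ge0.
have [C C0 CE] := trig_jac p01 N.
apply: (@cone_prod R V T c s E (index_enum E)
  (fun e (th : {ffun V -> T}) => trig N jw (a (src e) (th (src e)) - a (tgt e) (th (tgt e))))) => e.
apply: (cone_ext (fun th => esym (CE (a (src e) (th (src e)) - a (tgt e) (th (tgt e)))))).
apply: cone_mul; first by apply: cone_const; rewrite ltW.
apply: (@cone_prod R V T c s _ (index_enum _)
  (fun (n : 'I_N) (th : {ffun V -> T}) => 1 + (p ^+ (2 * n).+1) ^+ 2 + 2 * p ^+ (2 * n).+1 *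
      cos (a (src e) (th (src e)) - a (tgt e) (th (tgt e))))) => n.
set q := p ^+ _; have q0 : 0 <= q by rewrite exprn_ge0 // ltW // (andP p01).1.
have cs : cone c s (fun th : {ffun V -> T} => c (src e) (th (src e)) * c (tgt e) (th (tgt e)) +
    s (src e) (th (src e)) * s (tgt e) (th (tgt e))).
  by apply: cone_add; apply: cone_mul; (apply: cone_c || apply: cone_s).
have c1 : cone c s (fun=> (1 - q) ^+ 2) by apply: cone_const; exact: sqr_ge0.
have c4 : cone c s (fun=> 4 * q) by apply: cone_const; nra.
(* With [z = u - w], a factor is [(1 - q)^2 + 4 q cos (z / 2)^2], and [cos (z / 2)] is in the cone
   by the addition formula. *)
apply: (cone_ext _ (cone_add c1 (cone_mul c4 (cone_mul cs cs)))) => th.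
rewrite /c /s -cosB; set u := a _ _; set w := a _ _.
have := cos_mulr2n ((u - w) / 2); rewrite (_ : ((u - w) / 2) *+ 2 = u - w); last by rewrite -mulr_natl; field.
by move=> ->; rewrite -mulrBl -expr2; ring.
Qed.

End Form.

Lemma dipole_le (m : nat) : (0 < m)%N ->
  \sum_(k : flow E N | offxy (fval k) && (`|dv (fval k) x|%N == m)) \prod_e jw (fval k e) <=
  \sum_(k : flow E N | offxy (fval k) && (`|dv (fval k) x|%N == 1%N)) \prod_e jw (fval k e).
Proof.
move=> m0.
have := @unimodal_coeff R _ (fun k : flow E N => if offxy (fval k) then \prod_e jw (fval k e) else 0)
   (fun k => dv (fval k) x) m m0.
have e n : \sum_(k : flow E N | `|dv (fval k) x|%N == n)
    (if offxy (fval k) then \prod_e jw (fval k e) else 0) =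
    \sum_(k : flow E N | offxy (fval k) && (`|dv (fval k) x|%N == n)) \prod_e jw (fval k e).
  by rewrite -big_mkcondr; apply: eq_bigl => k; rewrite andbC.
rewrite !e; apply => al be alp bep.
rewrite [X in _ <= X](_ : _ = \sum_(k : flow E N | offxy (fval k)) (\prod_e jw (fval k e)) *
    (sin ((dv (fval k) x)%:~R * al) * sin ((dv (fval k) x)%:~R * be))); first exact: sine_form_ge0.
by rewrite [RHS]big_mkcond; apply: eq_bigr => k _; case: ifP => //; rewrite mul0r.
Qed.

End Dipoles.

(** * Partition functions of integer flows *)

Lemma ler_sum_inj (R : numDomainType) (A B : finType) (f : A -> B) (P : pred A) (Q : pred B)
    (F : A -> R) (G : B -> R) :
  {in P &, injective f} -> (forall a, P a -> Q (f a)) ->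
  (forall b, Q b -> 0 <= G b) -> (forall a, P a -> F a <= G (f a)) ->
  \sum_(a | P a) F a <= \sum_(b | Q b) G b.
Proof.
move=> fI PQ G0 FG; apply: le_trans (ler_sum _ FG) _.
rewrite -(big_imset G fI) /=.
rewrite [X in X <= _]big_mkcond [X in _ <= X]big_mkcond; apply: ler_sum => b _ /=.
case: imsetP => [[a Pa ->]|_]; first by rewrite PQ.
by case: ifP => // /G0.
Qed.

Section Boxes.
Local Open Scope classical_set_scope.
Local Open Scope ring_scope.
Variables (R : realType) (E : finType).

Definition enc (N : nat) (z : int) : 'I_(2 * N).+1 := inord `|z + N%:Z|.

Lemma encK N z : (`|z| <= N)%N -> ib (enc N z) = z.
Proof. move=> zN; rewrite /ib /enc inordK; lia. Qed.

(** Flows that leave the box have weight 0, so that a finite family of distinct flows is controlled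
    by the box alone. *)
Lemma box_sum_le (A : finType) (P : pred A) (Q : (E -> int) -> bool) (ka : A -> E -> int)
    (N : nat) (u : int -> R) :
  (forall k k', k =1 k' -> Q k = Q k') ->
  (forall k, 0 <= u k) -> (forall k, (N < `|k|)%N -> u k = 0) ->
  (forall a b, P a -> P b -> ka a =1 ka b -> a = b) -> (forall a, P a -> Q (ka a)) ->
  \sum_(a | P a) \prod_e u (ka a e) <=
  \sum_(k : flow E N | Q (fval k)) \prod_e u (fval k e).
Proof.
move=> Qext u0 uN kI PQ.
rewrite (bigID (fun a => [forall e, (`|ka a e| <= N)%N])) /=.
rewrite [X in _ + X]big1 ?addr0; last first.
  move=> a /andP[_ /forallPn[e]]; rewrite -ltnNge => ae.
  by rewrite (bigD1 e) //= uN // mul0r.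
have fE a : [forall e, (`|ka a e| <= N)%N] -> fval [ffun e => enc N (ka a e)] =1 ka a.
  by move=> /forallP h e; rewrite /fval ffunE encK.
apply: (@ler_sum_inj R A (flow E N) (fun a => [ffun e => enc N (ka a e)])).
- move=> a b /andP[Pa ha] /andP[Pb hb] ab; apply: kI => // e.
  by rewrite -(fE a ha) -(fE b hb) ab.
- by move=> a /andP[Pa ha]; rewrite (Qext _ _ (fE a ha)) PQ.
- by move=> k _; apply: prodr_ge0.
- by move=> a /andP[Pa ha]; under [X in _ <= X]eq_bigr do rewrite fE //.
Qed.

Lemma fval_inj N (k k' : flow E N) : fval k =1 fval k' -> k = k'.
Proof. by move=> h; apply/ffunP => e; apply/val_inj; have /addIr[] := h e. Qed.

End Boxes.

Section Partition.
Local Open Scope classical_set_scope.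
Local Open Scope ring_scope.
Variables (R : realType) (p : R).
Hypothesis p01 : 0 < p < 1.
Variables (V E : finType) (src tgt : E -> V).
Local Notation dv := (sdiv src tgt pred0).

Definition wt (k : int) : R := p ^+ (`|k| ^ 2).

Lemma wt_ge0 k : 0 <= wt k.
Proof. by rewrite exprn_ge0 // ltW // (andP p01).1. Qed.

Lemma wt_gt0 k : 0 < wt k.
Proof. by rewrite exprn_gt0 // (andP p01).1. Qed.

Lemma jacw_le_wt N k : jacw p N k <= wt k.
Proof. exact: jac_le. Qed.

Lemma prod_jacw_le N (k : E -> int) : \prod_e jacw p N (k e) <= \prod_e wt (k e).
Proof. by apply: ler_prod => e _; rewrite jacw_le_wt andbT; exact: jac_ge0. Qed.

(** The family is finite and [b] does not depend on [N], so that inequalities for the Jacobi weights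
    pass to the Gaussian ones. *)
Lemma wt_sum_le (A : finType) (P : pred A) (ka : A -> E -> int) (b : R) :
  (forall N, \sum_(a | P a) \prod_e jacw p N (ka a e) <= b) ->
  \sum_(a | P a) \prod_e wt (ka a e) <= b.
Proof.
move=> h; apply: (@cvgr_to_le _ \oo _ _ (fun N => \sum_(a | P a) \prod_e jacw p N (ka a e))); last exact: nearW.
apply: cvg_big; first exact: add_continuous.
move=> a _; apply: cvg_big; first exact: mul_continuous.
by move=> e _; exact: cvg_jac.
Qed.

(** A bound uniform in [N], which makes the suprema in [Zsup] finite; it follows from
    [p ^ ((j + 1)^2) <= p ^ j]. *)
Lemma box_total_le N : \sum_(k : flow E N) \prod_e wt (fval k e) <= (1 + 2 / (1 - p)) ^+ #|E|.
Proof.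
have p1 : 0 < 1 - p by have := andP p01; lra.
rewrite /fval -(bigA_distr_bigA (fun e (i : 'I_(2 * N).+1) => wt (ib i))) /= prodr_const cardT -cardE.
apply: lerXn2r; rewrite ?nnegrE.
- by apply: sumr_ge0 => i _; exact: wt_ge0.
- by rewrite addr_ge0 // divr_ge0 // ltW.
rewrite (sum_ib N wt) lerD // /wt ?absz0 //.
have geo n : (1 - p) * \sum_(j < n) p ^+ j = 1 - p ^+ n.
  by elim: n => [|n IH]; rewrite ?big_ord0 ?big_ord_recr /= ?mulrDr ?IH ?exprS; ring.
apply: le_trans (_ : \sum_(j < N) 2 * p ^+ j <= _).
  apply: ler_sum => j _; rewrite abszN absz_nat mulr_natl mulr2n.
  suff : p ^+ (j.+1 ^ 2) <= p ^+ j by move=> h; exact: lerD.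
  by apply: ler_wiXn2l; have := andP p01; [lra | lra | move=> _; nia].
rewrite -mulr_sumr ler_wpM2l // -[leRHS]mul1r ler_pdivlMr // mulrC geo.
by rewrite lerBlDr lerDl exprn_ge0 //; have := andP p01; lra.
Qed.

(* The boxes increase with [N], so that this is the sum over all integer-valued
   [k] satisfying [Q]. *)
Definition Zsup (Q : (E -> int) -> bool) : R :=
  sup [set z | exists N, z = \sum_(k : flow E N | Q (fval k)) \prod_e wt (fval k e)].

Lemma Zsup_ge Q N : \sum_(k : flow E N | Q (fval k)) \prod_e wt (fval k e) <= Zsup Q.
Proof.
apply: ub_le_sup; last by exists N.
exists ((1 + 2 / (1 - p)) ^+ #|E|) => _ [M ->].
apply: le_trans (box_total_le M); rewrite [X in X <= _]big_mkcond; apply: ler_sum => k _.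
by case: ifP => _ //; apply: prodr_ge0 => e _; exact: wt_ge0.
Qed.

Lemma Zsup_le Q b :
  (forall N, \sum_(k : flow E N | Q (fval k)) \prod_e wt (fval k e) <= b) -> Zsup Q <= b.
Proof.
move=> h; apply: ge_sup; first by exists (\sum_(k : flow E 0 | Q (fval k)) \prod_e wt (fval k e)); exists 0%N.
by move=> _ [N ->].
Qed.

Definition Z0 : R := Zsup (fun k => [forall v, dv k v == 0]).

Lemma sdiv_ext neg (k k' : E -> int) v : k =1 k' -> sdiv src tgt neg k v = sdiv src tgt neg k' v.
Proof.
move=> kk; rewrite /sdiv; congr (_ - _); apply: eq_bigr => e _; first exact: kk.
by rewrite kk.
Qed.

Lemma Z0_gt0 : 0 < Z0.
Proof.
apply: lt_le_trans (Zsup_ge _ 0).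
have zE : fval [ffun=> ord0 : 'I_(2 * 0).+1] =1 (fun _ : E => 0) by move=> e; rewrite /fval ffunE.
rewrite (bigD1 [ffun=> ord0]) /=; last first.
  apply/forallP => v; rewrite (sdiv_ext _ _ zE) /sdiv !big1 ?subrr //.
apply: ltr_wpDr; last by apply: prodr_gt0 => e _; exact: wt_gt0.
by apply: sumr_ge0 => k _; apply: prodr_ge0 => e _; exact: wt_ge0.
Qed.

Lemma source_le N (d : V -> int) :
  \sum_(k : flow E N | [forall v, dv (fval k) v == d v]) \prod_e wt (fval k e) <= Z0.
Proof.
apply: wt_sum_le => M.
apply: le_trans (_ : \sum_(k : flow E M | [forall v, dv (fval k) v == d v]) \prod_e jacw p M (fval k e) <= _).
  apply: (@box_sum_le R E _ _ (fun k => [forall v, dv k v == d v])) => //.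
  - by move=> k k' kk; apply: eq_forallb => v; rewrite (sdiv_ext _ _ kk).
  - by move=> k; exact: jac_ge0.
  - by move=> k; exact: jac_gt.
  - by move=> k k' _ _; exact: fval_inj.
(* A source larger than every divergence realized in the box leaves an empty sum. *)
have [dM|] := boolP [forall v, (`|d v| <= 4 * M * #|E|)%N]; last first.
  move=> /forallPn[v]; rewrite -ltnNge => dv'; rewrite big1 ?ltW ?Z0_gt0 // => k /forallP/(_ v)/eqP kd.
  by have := norm_sdiv src tgt pred0 k v; rewrite kd; lia.
apply: le_trans (fourier_max p01 src tgt (forallP dM)) _; apply: le_trans (Zsup_ge _ M).
by apply: ler_sum => k _; exact: prod_jacw_le.
Qed.

Variables x y : V.
Hypothesis xy : x != y.

Definition Zdip (m : nat) : R := Zsup (fun k => offxy src tgt x y k && (`|dv k x| == m)%N).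

Lemma offxy_ext k k' : k =1 k' -> offxy src tgt x y k = offxy src tgt x y k'.
Proof. by move=> kk; apply: eq_forallb => v; rewrite (sdiv_ext _ _ kk). Qed.

Lemma Zdip_le m N : (0 < m)%N ->
  \sum_(k : flow E N | offxy src tgt x y (fval k) && (`|dv (fval k) x| == m)%N) \prod_e wt (fval k e)
  <= Zdip 1.
Proof.
move=> m0; apply: wt_sum_le => M.
apply: le_trans (_ : \sum_(k : flow E M | offxy src tgt x y (fval k) && (`|dv (fval k) x| == m)%N) \prod_e jacw p M (fval k e) <= _).
  apply: (@box_sum_le R E _ _ (fun k => offxy src tgt x y k && (`|dv k x| == m)%N)) => //.
  - by move=> k k' kk; rewrite (offxy_ext kk) (sdiv_ext _ _ kk).
  - by move=> k; exact: jac_ge0.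
  - by move=> k; exact: jac_gt.
  - by move=> k k' _ _; exact: fval_inj.
apply: le_trans (dipole_le src tgt xy M p01 m0) _; apply: le_trans (Zsup_ge _ M).
by apply: ler_sum => k _; exact: prod_jacw_le.
Qed.


Hypothesis deg4 : (#|[pred e | src e == x]| + #|[pred e | tgt e == x]| <= 4)%N.

(** If the edges at [x], at most four, all carried at most [j - 1], the divergence would be at most
    [4 (j - 1) < m]. *)
Lemma sdiv_big_edge (k : E -> int) (m j : nat) : (0 < j)%N -> (4 * j < m + 4)%N -> `|dv k x|%N = m ->
  exists e, ((src e == x) || (tgt e == x)) && (j <= `|k e|)%N.
Proof.
move=> j0 jm dm; apply/existsP; apply: contraPT (jm) => /existsPn small; apply/negP; rewrite -leqNgt.
have h (P : pred E) : (forall e, P e -> (src e == x) || (tgt e == x)) ->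
    (`|(\sum_(e | P e) k e)%R| <= #|P| * j.-1)%N.
  move=> Px.
  apply: leq_trans (_ : \sum_(e | P e) j.-1 <= _)%N; last by rewrite sum_nat_const.
  elim/big_ind2: _ => //; first by move=> a1 a2 b1 b2; lia.
  by move=> e Pe; have := small e; rewrite (Px e Pe) /=; lia.
have h1 : (`|(\sum_(e | src e == x) k e)%R| <= #|[pred e | src e == x]| * j.-1)%N 
  by apply: (h [pred e | src e == x]) => e /= ->.
have h2 : (`|(\sum_(e | tgt e == x) k e)%R| <= #|[pred e | tgt e == x]| * j.-1)%N 
  by apply: (h [pred e | tgt e == x]) => e /= ->; rewrite orbT.
move: dm h1 h2 deg4; rewrite /sdiv /=.
move: #|_| #|_| => c2 c1 dm h1 h2 c4.
have : ((c1 + c2) * j.-1 <= 4 * j.-1)%N by rewrite leq_mul2r c4 orbT.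
rewrite mulnDl; move: dm h1 h2; move: (\sum_(e | src e == x) k e) (\sum_(e | tgt e == x) k e) => s1 s2; move: (c1 * _)%N (c2 * _)%N => a b; lia.
Qed.

(** Removing [j] units from an edge that carries [z] with [j <= z] gains [p ^ (j^2)], because
    [z^2 >= j^2 + (z - j)^2]. The flows are sorted by this edge (at most 4), its sign and the sign
    of the divergence at [x], that is 16 classes; in each class the remaining flow has the fixed
    source [d'], and [source_le] applies. *)
Lemma dipole_decay (m j N : nat) : (0 < j)%N -> (4 * j < m + 4)%N ->
  \sum_(k : flow E N | offxy src tgt x y (fval k) && (`|dv (fval k) x| == m)%N) \prod_e wt (fval k e)
  <= 16 * (p ^+ (j ^ 2) * Z0).
Proof.
move=> j0 jm; have [p0 p1] := andP p01.
pose sg (b : bool) : int := if b then 1 else -1.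
pose star e := (src e == x) || (tgt e == x).
pose cls (c : E * bool * bool) (k : flow E N) :=
  [&& offxy src tgt x y (fval k), dv (fval k) x == sg c.2 * m%:Z & j%:Z <= sg c.1.2 * fval k c.1.1].
apply: le_trans (_ : \sum_(c : E * bool * bool | star c.1.1) \sum_(k : flow E N | cls c k) \prod_e wt (fval k e) <= _).
  rewrite [X in X <= _]big_mkcond; under [X in _ <= X]eq_bigr do rewrite big_mkcond.
  rewrite exchange_big /=; apply: ler_sum => k _.
  have W0 : 0 <= \prod_e wt (fval k e) by apply: prodr_ge0 => e _; exact: wt_ge0.
  case: ifP => [/andP[ofk /eqP dm]|_]; last by apply: sumr_ge0 => c _; case: ifP.
  have [e /andP[se je]] := sdiv_big_edge j0 jm dm.
  have [b1 hb1] : exists b, j%:Z <= sg b * fval k e.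
    have [h|h] := leP 0 (fval k e); [exists true | exists false]; rewrite /sg; lia.
  have [b2 hb2] : exists b, dv (fval k) x = sg b * m%:Z.
    have [h|h] := leP 0 (dv (fval k) x); [exists true | exists false]; rewrite /sg; lia.
  rewrite (bigD1 (e, b1, b2)) //= {1}/cls ofk hb1 hb2 eqxx /= lerDl.
  by apply: sumr_ge0 => c _; case: ifP.
apply: le_trans (_ : \sum_(c : E * bool * bool | star c.1.1) p ^+ (j ^ 2) * Z0 <= _); last first.
  rewrite sumr_const -[leLHS]mulr_natl; apply: ler_wpM2r.
    by rewrite mulr_ge0 ?exprn_ge0 ?ltW // Z0_gt0.
  rewrite (_ : 16 = (4 * (2 * 2))%:R) ?ler_nat; last by rewrite !natrM; ring.
  rewrite (@eq_card _ _ [predX [predX [pred e | star e] & predT : pred bool] & predT : pred bool]); last by move=> c; rewrite !inE !andbT.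
  have cb : #|(predT : pred bool)| = 2%N by rewrite -card_bool; apply: eq_card.
  rewrite !cardX !cb -mulnA leq_mul2r /=.
  apply: leq_trans deg4; rewrite -cardUI; apply: leq_trans (leq_addr _ _).
  by apply: subset_leq_card; apply/fintype.subsetP => e; rewrite !inE.
apply: ler_sum => -[[e b1] b2] /= _.
pose shift (k : E -> int) (e' : E) : int := if e' == e then k e - sg b1 * j%:Z else k e'.
pose d' v : int := (if v == x then sg b2 * m%:Z else if v == y then - (sg b2 * m%:Z) else 0)
   - sg b1 * j%:Z * ((src e == v)%:Z - (tgt e == v)%:Z).
apply: le_trans (_ : p ^+ (j ^ 2) * \sum_(k : flow E N | [forall v, dv (fval k) v == d' v]) \prod_e wt (fval k e) <= _); last first.
  by rewrite ler_wpM2l ?source_le // exprn_ge0 // ltW.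
rewrite mulr_sumr.
have fE k : cls (e, b1, b2) k -> fval [ffun e' => enc N (shift (fval k) e')] =1 shift (fval k).
  move=> /and3P[_ _ /= hk] e'; rewrite /fval ffunE encK // /shift.
  have hib := norm_ib (k e); have hib' := norm_ib (k e').
  by case: ifP => _ //; move: hk hib; rewrite /fval /sg; case: (b1); lia.
apply: (@ler_sum_inj R (flow E N) (flow E N) (fun k => [ffun e' => enc N (shift (fval k) e')])).
- move=> k k' hk hk' kk; apply: fval_inj => e'.
  have : shift (fval k) e' = shift (fval k') e' by rewrite -(fE k hk) -(fE k' hk') kk.
  by rewrite /shift; case: eqP => // -> /addIr.
- move=> k hk; apply/forallP => v; rewrite (sdiv_ext _ _ (fE k hk)) /d'.
  have -> : dv (shift (fval k)) v = dv (fval k) v - sg b1 * j%:Z * ((src e == v)%:Z - (tgt e == v)%:Z).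
    have h (f : E -> V) : \sum_(e' | f e' == v) shift (fval k) e' = \sum_(e' | f e' == v) fval k e' - sg b1 * j%:Z * (f e == v)%:Z.
      rewrite [LHS]big_mkcond [in RHS]big_mkcond /= (bigD1 e) //= [in RHS](bigD1 e) //=.
      rewrite (eq_bigr (fun e' => if f e' == v then fval k e' else 0)); last first.
        by move=> e' /negbTE ee; rewrite /shift ee.
      by rewrite /shift eqxx; case: ifP => _; rewrite ?mulr1 ?mulr0 ?subr0 //= addrAC.
    by rewrite /sdiv /= !h; ring.
  rewrite (inj_eq (addIr _)); have /and3P[ofk /= /eqP dx _] := hk.
  have [->|vx] := eqVneq v x; first by rewrite dx.
  have [->|vy] := eqVneq v y; first by rewrite (offxy_sum xy ofk) dx.
  by move/forallP/(_ v): ofk; rewrite vx vy.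
- by move=> k _; rewrite mulr_ge0 ?exprn_ge0 ?ltW //; apply: prodr_gt0 => e' _; exact: wt_gt0.
- move=> k hk; under [X in _ <= _ * X]eq_bigr do rewrite fE //.
  rewrite (bigD1 e) //= [in X in _ <= X](bigD1 e) //= mulrA.
  rewrite [X in _ <= _ * X](eq_bigr (fun e' => wt (fval k e'))); last first.
    by move=> e' /negbTE ee; rewrite /shift ee.
  apply: ler_wpM2r; first by apply: prodr_ge0 => e' _; exact: wt_ge0.
  rewrite /wt /shift eqxx -exprD; apply: ler_wiXn2l; rewrite ?ltW //.
  have /and3P[_ _ /= hj] := hk; move: hj; rewrite /sg; move: (fval k e) => z.
  have [u hu] : exists u : nat, `|(z - (if b1 then 1 else -1) * j%:Z)%R|%N = u by eexists.
  move=> hj; rewrite hu; have -> : `|z|%N = (j + u)%N by case: (b1) hu hj; lia.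
  by rewrite sqrnD; lia.
Qed.

Lemma twisted_partition N :
  \sum_(k : flow E N | twisted src tgt x y pred0 (fval k)) \prod_e wt (fval k e) <=
  \sum_(m < (2 * N * #|E|).+1 | (0 < m)%N)
    \sum_(k : flow E N | offxy src tgt x y (fval k) && (`|dv (fval k) x| == m)%N) \prod_e wt (fval k e).
Proof.
rewrite [X in X <= _]big_mkcond; under [X in _ <= X]eq_bigr do rewrite big_mkcond.
rewrite exchange_big /=; apply: ler_sum => k _.
have W0 : 0 <= \prod_e wt (fval k e) by apply: prodr_ge0 => e _; exact: wt_ge0.
case: ifP => [/and3P[ofk ox _]|_]; last by apply: sumr_ge0 => c _; case: ifP.
have mN : (`|dv (fval k) x| < (2 * N * #|E|).+1)%N by rewrite ltnS norm_sdiv.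
rewrite (bigD1 (Ordinal mN)) /=; last by case: absz ox.
rewrite {1}/offxy ofk eqxx /= lerDl.
by apply: sumr_ge0 => c _; case: ifP.
Qed.

End Partition.

(** * Summation over the strength of the source *)

Section GaussianSum.
Variable R : realType.

Lemma expR_sqr_le (u : R) : 0 <= u -> expR (- u ^+ 2) <= 2 / (1 + u) ^+ 2.
Proof.
move=> u0; rewrite expRN -[leLHS]mul1r ler_pdivrMr ?expR_gt0 // mulrAC.
rewrite ler_pdivlMr; last by rewrite exprn_gt0 //; lra.
by have := expR_ge1Dx (u ^+ 2); have := sqr_ge0 (1 - u); move: (expR _) => E; rewrite !expr2; lra.
Qed.

(** With [s = sqrt a], [expR_sqr_le] bounds a term by [2 / (1 + s (m + 1))^2], hence by
    [2 / ((1 + s m)(1 + s (m + 1)))], which telescopes. *)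
Lemma gauss_sum_le (a : R) (M : nat) : 0 < a ->
  \sum_(m < M) expR (- (a * m.+1%:R ^+ 2)) <= 2 / Num.sqrt a.
Proof.
move=> a0; set s := Num.sqrt a; have s0 : 0 < s by rewrite sqrtr_gt0.
have -> : a = s ^+ 2 by rewrite sqr_sqrtr // ltW.
apply: le_trans (_ : 2 / s * (1 - (1 + s * M%:R)^-1) <= _); last first.
  apply: ler_piMr; first by rewrite divr_ge0 // ltW.
  by rewrite gerBl invr_ge0 addr_ge0 // mulr_ge0 // ltW.
elim: M => [|M IH]; first by rewrite big_ord0 mulr0 addr0 invr1 subrr mulr0.
rewrite big_ord_recr /=; apply: le_trans (lerD IH (_ : _ <= 2 / s * ((1 + s * M%:R)^-1 - (1 + s * M.+1%:R)^-1))) _; last first.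
  by rewrite -mulrDr addrA subrK.
rewrite -exprMn; apply: le_trans (expR_sqr_le _) _; first by rewrite mulr_ge0 // ltW.
set x := s * M%:R; have x0 : 0 <= x by rewrite mulr_ge0 // ltW.
have -> : s * M.+1%:R = x + s by rewrite -addn1 natrD mulrDr mulr1.
have -> : 2 / s * ((1 + x)^-1 - (1 + (x + s))^-1) = 2 / ((1 + x) * (1 + (x + s))).
  by field; apply/andP; split; rewrite gt_eqF //; lra.
rewrite ler_pM2l // lef_pV2 ?posrE ?mulr_gt0 ?exprn_gt0; nra.
Qed.

Lemma powR_mix_le (a X Y e : R) : 0 <= a -> 0 <= e <= 1 -> a <= X -> a <= Y ->
  a <= X `^ e * Y `^ (1 - e).
Proof.
move=> a0 /andP[e0 e1] aX aY.
have [->|an0] := eqVneq a 0; first by rewrite mulr_ge0 ?powR_ge0.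
have ap : 0 < a by rewrite lt_neqAle eq_sym an0.
rewrite -[X in X <= _]powRr1 // -[X in _ `^ X <= _](subrKC e 1) powRD ?(negbTE an0) ?implybT //.
apply: ler_pM; rewrite ?powR_ge0 //; apply: ge0_ler_powR; rewrite ?nnegrE ?subr_ge0 //.
  exact: le_trans aX.
exact: le_trans aY.
Qed.

End GaussianSum.

Section TwistedBound.
Variables (R : realType) (beta eps : R).
Hypotheses (beta0 : 0 < beta) (eps01 : 0 < eps < 1).
Let p : R := expR (- (2 * beta)^-1).

(** The power of 16 comes from [dipole_decay], and the other factor is [gauss_sum_le] at
    [a = eps / (32 beta)] with [sqrt beta] taken out. *)
Definition twist_const : R := 16 `^ eps * (2 * Num.sqrt (32 / eps)).

Lemma villain_p01 : 0 < p < 1.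
Proof. by rewrite expR_gt0 expR_lt1 oppr_lt0 invr_gt0 mulr_gt0. Qed.

Variables (V E : finType) (src tgt : E -> V) (x y : V).
Hypothesis xy : x != y.
Hypothesis deg4 : (#|[pred e | src e == x]| + #|[pred e | tgt e == x]| <= 4)%N.
Local Notation Z := (Z0 p src tgt).
Local Notation Zd := (Zdip p src tgt x y 1).

(** The Jacobi weights are used only until the twist is removed; the untwisted sum is then bounded
    with Gaussian weights, split by the strength [m] of the source, and [powR_mix_le] interpolates
    between [dipole_decay] and [Zdip_le]. *)
Lemma twisted_sum_le (A : finType) (neg : pred E) (ka : A -> E -> int) :
  (forall a b, ka a =1 ka b -> a = b) ->
  (forall a, twisted src tgt x y neg (ka a)) ->
  \sum_a \prod_e wt p (ka a e) <=
    twist_const * Num.sqrt beta * (Z `^ eps * Zd `^ (1 - eps)).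
Proof.
move=> kaI tka; have p01 := villain_p01; apply: (wt_sum_le p01) => N.
have twext (ng : pred E) k k' : k =1 k' -> twisted src tgt x y ng k = twisted src tgt x y ng k'.
  move=> kk; rewrite /twisted !(sdiv_ext _ _ _ _ kk); congr (_ && _).
  by apply: eq_forallb => v; rewrite (sdiv_ext _ _ _ _ kk).
apply: le_trans (@box_sum_le R E A predT (twisted src tgt x y neg) ka N (jacw p N) (twext neg) _ _ _ _) _ => //.
- by move=> k; exact: jac_ge0.
- by move=> k; exact: jac_gt.
- by move=> a b _ _; exact: kaI.
apply: le_trans (twist_removal p01 src tgt N xy neg) _.
apply: le_trans (_ : \sum_(k : flow E N | twisted src tgt x y pred0 (fval k)) \prod_e wt p (fval k e) <= _).
  by apply: ler_sum => k _; exact: prod_jacw_le.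
apply: le_trans (twisted_partition p01 _ _ _ _ _) _.
pose g (m : nat) := expR (- (eps / (32 * beta) * m%:R ^+ 2)).
have [e0 e1] := andP eps01.
apply: le_trans (_ : \sum_(m < (2 * N * #|E|).+1 | (0 < m)%N)
    (16 `^ eps * (Z `^ eps * Zd `^ (1 - eps))) * g m <= _).
  apply: ler_sum => m m0.
  (* [j] is [m / 4] rounded up, so that [p ^ (j^2)] is at most [exp (- m^2 / (32 beta))]. *)
  have j0 : (0 < (m + 3) %/ 4)%N by rewrite divn_gt0; lia.
  have jm : (4 * ((m + 3) %/ 4) < m + 4)%N by have := leq_trunc_div (m + 3) 4; lia.
  have mj : (m <= 4 * ((m + 3) %/ 4))%N by have := ltn_ceil (m + 3) (isT : 0 < 4)%N; lia.
  have h1 := dipole_decay p01 xy deg4 N j0 jm.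
  have h2 := Zdip_le p01 src tgt xy N m0.
  set S := \sum_(k | _) _ in h1 h2 *.
  have S0 : 0 <= S.
    by apply: sumr_ge0 => k _; apply: prodr_ge0 => e _; exact: wt_ge0.
  have e01 : 0 <= eps <= 1 by rewrite !ltW.
  apply: le_trans (powR_mix_le S0 e01 h1 h2) _.
  have Zge0 : 0 <= Z by rewrite ltW // Z0_gt0.
  rewrite powRM ?mulr_ge0 ?exprn_ge0 ?expR_ge0 // powRM ?exprn_ge0 ?expR_ge0 //.
  rewrite [leRHS](_ : _ = g m * (16 `^ eps * Z `^ eps * Zd `^ (1 - eps))); last by ring.
  rewrite [leLHS](_ : _ = (p ^+ (((m + 3) %/ 4) ^ 2)) `^ eps * (16 `^ eps * Z `^ eps * Zd `^ (1 - eps))); last by ring.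
  apply: ler_wpM2r; first by rewrite !mulr_ge0 ?powR_ge0.
  rewrite /p -expRM_natl -expRM /g ler_expR mulrN mulNr lerN2.
  have : (m%:R <= 4 * ((m + 3) %/ 4)%:R :> R) by rewrite -natrM ler_nat.
  rewrite natrX; set w := (m%:R : R); set z := (((m + 3) %/ 4)%:R : R) => wz.
  have w0 : 0 <= w by [].
  have -> : eps / (32 * beta) * w ^+ 2 = (eps / (2 * beta)) * (w ^+ 2 / 16) by field; rewrite gt_eqF.
  have -> : z ^+ 2 / (2 * beta) * eps = (eps / (2 * beta)) * z ^+ 2 by field; rewrite gt_eqF.
  apply: ler_wpM2l; first by rewrite divr_ge0 // ?mulr_ge0 // ltW.
  by rewrite ler_pdivrMr //; nra.
rewrite -mulr_sumr big_mkcond big_ord_recl /= add0r.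
have a0 : 0 < eps / (32 * beta) by rewrite divr_gt0 // mulr_gt0.
have := gauss_sum_le (2 * N * #|E|) a0.
have -> : 2 / Num.sqrt (eps / (32 * beta)) = 2 * Num.sqrt (32 / eps) * Num.sqrt beta.
  rewrite -mulrA -sqrtrM ?divr_ge0 // ?ltW //; congr (_ * _).
  rewrite -sqrtrV ?ltW //; congr Num.sqrt; field.
  by rewrite !gt_eqF.
move=> h; rewrite /twist_const [leRHS](_ : _ = (16 `^ eps * (Z `^ eps * Zd `^ (1 - eps))) * (2 * Num.sqrt (32 / eps) * Num.sqrt beta)); last by ring.
by apply: ler_wpM2l => //; rewrite !mulr_ge0 ?powR_ge0.
Qed.

End TwistedBound.

(** * Reflection of level sets joined by contours *)

Section EdwardsSokal.
Variables (R : realType) (E F : finType) (l r : E -> F).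

Definition bdry (s : {ffun F -> bool}) : {set E} := [set e | s (l e) != s (r e)].

Variables (conn : {set E} -> bool) (Gam : {set E}).
Hypothesis conn_mono : forall w w' : {set E}, w \subset w' -> conn w -> conn w'.
Hypothesis conn_flip : forall w : {set E}, conn w ->
  exists t : {ffun F -> bool}, forall e, e \notin w -> (t (l e) (+) t (r e)) = (e \in Gam).

(* Writing each weight [a e] as [b e + (a e - b e)] embeds the contours
   [bdry s] in random sets [J]; once [J] is given, the contours and the ones
   shifted by [Gam] are equally many as soon as [conn J]. *)
Lemma contour_shift (a b : E -> R) : (forall e, 0 <= b e <= a e) ->
  \sum_(s : {ffun F -> bool} | conn (bdry s)) \prod_e (if e \in bdry s then b e else a e) <=
  \sum_(s : {ffun F -> bool}) \prod_e (if (e \in bdry s) (+) (e \in Gam) then b e else a e).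
Proof.
move=> ab.
pose c (J eta : {set E}) := \prod_e (if e \in J then b e else if e \in eta then 0 else a e - b e).
have expand (eta : {set E}) :
    \prod_e (if e \in eta then b e else a e) = \sum_(J : {set E}) c J eta.
  rewrite /c -bigA_distr; apply: eq_bigr => e _.
  by case: (e \in eta) => /=; ring.
pose sh (s : {ffun F -> bool}) := [set e | (e \in bdry s) (+) (e \in Gam)].
have -> : \sum_(s : {ffun F -> bool}) \prod_e (if (e \in bdry s) (+) (e \in Gam) then b e else a e) =
    \sum_(s : {ffun F -> bool}) \sum_(J : {set E}) c J (sh s).
  by apply: eq_bigr => s _; rewrite -expand; apply: eq_bigr => e _; rewrite [in RHS]inE.
under eq_bigr do rewrite expand.
rewrite big_mkcond; under eq_bigr do rewrite (fun_if (fun z => z)).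
apply: le_trans (_ : \sum_(s : {ffun F -> bool}) \sum_(J : {set E}) (if conn (bdry s) then c J (bdry s) else 0) <= _).
  by apply: ler_sum => s _; case: ifP => _ //; rewrite big1.
rewrite exchange_big [X in _ <= X]exchange_big /=; apply: ler_sum => J _.
have c0 (eta : {set E}) : 0 <= c J eta.
  by apply: prodr_ge0 => e _; have := ab e; case: ifP => _; [lra|case: ifP => _; lra].
(* [c J eta] vanishes unless [eta] is contained in [J], and then it no longer depends on [eta]: for
   fixed [J] the comparison is a matter of counting spins. *)
have cout (eta : {set E}) : ~~ (eta \subset J) -> c J eta = 0.
  case/subsetPn => e eeta /negbTE eJ; rewrite /c (bigD1 e) //= eJ eeta mul0r //.
have cin (eta : {set E}) : eta \subset J -> c J eta = c J finset.set0.
  move=> sJ; apply: eq_bigr => e _; case: ifP => // eJ; rewrite inE.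
  by case: ifP => // /(fintype.subsetP sJ); rewrite eJ.
have [cJ|ncJ] := boolP (conn J); last first.
  rewrite big1 ?sumr_ge0 // => s _; case: ifP => // cs; apply: cout.
  by apply: contra ncJ => sJ; apply: conn_mono cs.
have [t tP] := conn_flip cJ.
(* Outside [J] the boundary of [t] is [Gam], so that flipping by [t] undoes the shift there: if
   [bdry s] lies in [J], so does the shifted contour of [tau s]. *)
pose tau (s : {ffun F -> bool}) := [ffun f => s f (+) t f].
have tauK : involutive tau by move=> s; apply/ffunP => f; rewrite !ffunE addbK.
rewrite [X in _ <= X](reindex_inj (inv_inj tauK)) /=; apply: ler_sum => s _.
case: ifP => _ //; have [sJ|/cout -> //] := boolP (bdry s \subset J).
rewrite (cin _ sJ) (cin (sh (tau s))) //.
apply/fintype.subsetP => e; rewrite !inE !ffunE; apply: contraLR => eJ.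
have : e \notin bdry s by apply: contra eJ; apply: (fintype.subsetP sJ).
rewrite !inE negbK => /eqP ->; rewrite -(tP e eJ).
by case: (s _) (t _) (t _) => [] [] [].
Qed.

Variable p : R.
Hypothesis p01 : 0 < p < 1.

(* The heights [n] with a level [q] are encoded by [n - q = m + 1/2], with
   [m = h] above the level and [m = - h - 1] below it. *)
Definition spin_height (K : nat) (hs : {ffun F -> 'I_K} * {ffun F -> bool}) (f : F) : int :=
  if hs.2 f then (hs.1 f)%:Z else - (hs.1 f).+1%:Z.

(** For fixed [h] the signs form an Ising model: an edge has weight [a] if the signs agree and [b]
    if they differ, and [b <= a] because [|h - h'| <= h + h' + 1]. Shifting the contours by [Gam]
    exchanges the two weights there. *)
Lemma reflected_sum (K : nat) :
  \sum_(hs : {ffun F -> 'I_K} * {ffun F -> bool} | conn (bdry hs.2))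
    \prod_e wt p (spin_height hs (l e) - spin_height hs (r e)) <=
  \sum_(hs : {ffun F -> 'I_K} * {ffun F -> bool})
    \prod_e wt p (if e \in Gam then spin_height hs (l e) + spin_height hs (r e) + 1
                  else spin_height hs (l e) - spin_height hs (r e)).
Proof.
rewrite -(pair_big predT (fun s => conn (bdry s)) (fun h s => \prod_e wt p (spin_height (h, s) (l e) - spin_height (h, s) (r e)))) /=.
rewrite -(pair_bigA _ (fun h s => \prod_e wt p (if e \in Gam then spin_height (h, s) (l e) + spin_height (h, s) (r e) + 1
                  else spin_height (h, s) (l e) - spin_height (h, s) (r e)))) /=.
apply: ler_sum => h _.
pose a e := wt p ((h (l e))%:Z - (h (r e))%:Z).
pose b e := wt p ((h (l e))%:Z + (h (r e))%:Z + 1).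
have wtE z z' : `|z|%N = `|z'|%N -> wt p z = wt p z' by rewrite /wt => ->.
have := @contour_shift a b; rewrite /a /b => cs.
have {}cs := cs _; apply: le_trans (_ : \sum_(s : {ffun F -> bool} | conn (bdry s)) \prod_e (if e \in bdry s then b e else a e) <= _).
  apply: ler_sum => s _; rewrite le_eqVlt; apply/orP; left; apply/eqP.
  apply: eq_bigr => e _; rewrite inE /spin_height /a /b /=.
  by case: (s (l e)); case: (s (r e)) => /=; apply: wtE; lia.
apply: le_trans (cs _) _.
  move=> e; rewrite wt_ge0 //=; apply: ler_wiXn2l; have [p0 p1] := andP p01; rewrite ?ltW //.
  by rewrite leq_sqr; lia.
apply: ler_sum => s _; rewrite le_eqVlt; apply/orP; left; apply/eqP.
apply: eq_bigr => e _; rewrite inE /spin_height /a /b /=.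
by case: (e \in Gam); case: (s (l e)); case: (s (r e)) => /=; apply: wtE; lia.
Qed.

End EdwardsSokal.

(** * The planar grid *)

Lemma Z4_cases (d : 'Z_4) : [\/ d = 0, d = 1, d = 2 | d = 3].
Proof.
case: d => -[|[|[|[|//]]]] ?; [apply: Or41|apply: Or42|apply: Or43|apply: Or44]; exact/val_inj.
Qed.

#[local] Arguments pos : simpl never.
#[local] Arguments sqpos : simpl never.

Lemma step0 (u : int * int) : u + step 0 = (u.1 + 1, u.2).
Proof. by case: u => a b; congr (_, _); rewrite /= addr0. Qed.

Lemma step1 (u : int * int) : u + step 1 = (u.1, u.2 + 1).
Proof. by case: u => a b; congr (_, _); rewrite /= addr0. Qed.

Section Grid.
Variable L : nat.

Definition edge := {e : oedge L | e \in edges L}.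
Definition esrc (e : edge) : site L := (val e).1.
Definition etgt (e : edge) : site L := tip (val e).
Definition eleft (e : edge) : face L := left_face (val e).
Definition eright (e : edge) : face L := right_face (val e).

Definition in_box (a b : int) : bool := (- L%:Z <= a <= L%:Z) && (- L%:Z <= b <= L%:Z).

Lemma pos_box (v : site L) : in_box (pos v).1 (pos v).2.
Proof. by case: v => i j; rewrite /in_box /pos /=; have := ltn_ord i; have := ltn_ord j; lia. Qed.

Lemma pos_inj : injective (@pos L).
Proof.
move=> [i j] [i' j']; rewrite /pos /= => -[] hi hj; congr (_, _); apply: val_inj => /=; lia.
Qed.

Lemma site_at (a b : int) : in_box a b -> exists v : site L, pos v = (a, b).
Proof.
rewrite /in_box => ab.
have ha : (`|(a + L%:Z)%R| < (2 * L).+1)%N by lia.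
have hb : (`|(b + L%:Z)%R| < (2 * L).+1)%N by lia.
by exists (Ordinal ha, Ordinal hb); rewrite /pos /=; congr (_, _); lia.
Qed.

Lemma nbrP (v : site L) d w : reflect (nbr v d = Some w) (pos w == pos v + step d).
Proof.
rewrite /nbr; apply: (iffP eqP) => [wv|].
  case: pickP => [u /eqP|/(_ w)]; last by rewrite wv eqxx.
  by rewrite -wv => /pos_inj ->.
by case: pickP => // u /eqP uv [<-].
Qed.

Lemma is_edgeP (v : site L) d :
  is_edge (v, d) = in_box ((pos v).1 + (step d).1) ((pos v).2 + (step d).2).
Proof.
rewrite /is_edge /=; apply/idP/idP.
  case E : (nbr v d) => [w|//] _; have := pos_box w.
  by move/nbrP/eqP: E => ->.
move=> /site_at[w pw]; have /nbrP -> // : pos w == pos v + step d.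
by apply/eqP; rewrite pw.
Qed.

Lemma tip_pos (e : oedge L) : is_edge e -> pos (tip e) = pos e.1 + step e.2.
Proof.
rewrite /is_edge /tip; case E : (nbr e.1 e.2) => [w|//] _ /=.
by move/nbrP/eqP: E.
Qed.

Lemma edgesP (e : oedge L) :
  (e \in edges L) = is_edge e && ((e.2 == 0) || (e.2 == 1)).
Proof. by rewrite finset.inE !inE. Qed.

(* The value of [k] on the edge of direction [d] based at [(a, b)], and 0 when
   there is no such edge. *)
Definition at_edge (k : edge -> int) (d : 'Z_4) (a b : int) : int :=
  \sum_(e | (pos (esrc e) == (a, b)) && ((val e).2 == d)) k e.

Definition has_edge (d : 'Z_4) (a b : int) : bool :=
  [&& (d == 0) || (d == 1), in_box a b & in_box (a + (step d).1) (b + (step d).2)].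

Lemma edge_has (e : edge) : has_edge (val e).2 (pos (esrc e)).1 (pos (esrc e)).2.
Proof.
case: e => -[v d] /= he; have := he; rewrite edgesP is_edgeP /= => /andP[h1 h2].
by rewrite /has_edge /= h2 pos_box h1.
Qed.

Lemma at_edge_none k d a b : ~~ has_edge d a b -> at_edge k d a b = 0.
Proof.
move=> h; rewrite /at_edge big_pred0 // => e; apply/negP => /andP[/eqP pe /eqP de].
by move/negP: h; apply; have := edge_has e; rewrite pe de.
Qed.

Lemma at_edgeE k (e : edge) : at_edge k (val e).2 (pos (esrc e)).1 (pos (esrc e)).2 = k e.
Proof.
rewrite /at_edge -surjective_pairing (big_pred1 e) // => e'.
apply/andP/eqP => [[/eqP pe /eqP de]|->]; last by rewrite !eqxx.
have {}pe : (val e').1 = (val e).1 by exact: pos_inj pe.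
by apply: val_inj; rewrite [LHS]surjective_pairing [RHS]surjective_pairing de pe.
Qed.

Lemma edge_exists d a b : has_edge d a b ->
  exists e : edge, [/\ (val e).2 = d, pos (esrc e) = (a, b) & pos (etgt e) = (a, b) + step d].
Proof.
move=> /and3P[d01 /site_at[v pv] h].
have ie : is_edge (v, d) by rewrite is_edgeP pv.
have he : (v, d) \in edges L by rewrite edgesP ie d01.
by exists (exist _ (v, d) he); rewrite /esrc /etgt /= tip_pos // pv.
Qed.

Lemma etgt_pos (e : edge) : pos (etgt e) = pos (esrc e) + step (val e).2.
Proof. by case: e => e he; rewrite /etgt /esrc /= tip_pos //; move: he; rewrite edgesP => /andP[]. Qed.

Lemma edge_dir (e : edge) : ((val e).2 == 0) || ((val e).2 == 1).
Proof. by case: e => e he /=; move: he; rewrite edgesP => /andP[]. Qed.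

Lemma sdiv_at (neg : pred edge) k (v : site L) (a b : int) : pos v = (a, b) ->
  sdiv esrc etgt neg k v =
  at_edge k 0 a b + at_edge k 1 a b
  - (at_edge (fun e => if neg e then - k e else k e) 0 (a - 1) b
   + at_edge (fun e => if neg e then - k e else k e) 1 a (b - 1)).
Proof.
move=> pv; rewrite /sdiv; congr (_ - _).
  rewrite (bigID (fun e => (val e).2 == 0)) /=; congr (_ + _); apply: eq_bigl => e.
    by rewrite -(inj_eq pos_inj) pv.
  rewrite -(inj_eq pos_inj) pv; congr andb.
  by have := edge_dir e; case: eqP => [->|] //=; case: eqP.
rewrite (bigID (fun e => (val e).2 == 0)) /=; congr (_ + _); apply: eq_bigl => e.
  rewrite -(inj_eq pos_inj) pv etgt_pos; have [d0|d0] := eqVneq (val e).2 0; last by rewrite !andbF.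
  rewrite d0 step0 !andbT; case: (pos _) => a' b' /=.
  by rewrite !xpair_eqE; apply/idP/idP; lia.
rewrite -(inj_eq pos_inj) pv etgt_pos; have [d0|d0] := eqVneq (val e).2 0.
  by rewrite d0 !andbF.
have := edge_dir e; rewrite (negbTE d0) /= => /eqP d1; rewrite d1 step1 !andbT.
by case: (pos _) => a' b' /=; rewrite !xpair_eqE; apply/idP/idP; lia.
Qed.

Definition sq (a b : int) : face L := face_at L (a, b).

Lemma sqP (a b : int) (s : square L) : sqpos s = (a, b) -> sq a b = Some s.
Proof.
rewrite /sq /face_at => sab; case: pickP => [u /eqP|/(_ s)]; last by rewrite sab eqxx.
rewrite -sab => -[h1 h2]; congr Some; move: h1 h2 {sab}; rewrite /sqpos; case: u s => [i j] [i' j'] /= h1 h2.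
by congr (_, _); apply: val_inj => /=; lia.
Qed.

Lemma sq_out (a b : int) : ~~ ((- L%:Z <= a < L%:Z) && (- L%:Z <= b < L%:Z)) -> sq a b = None.
Proof.
move=> h; rewrite /sq /face_at; case: pickP => // s /eqP sab; move: h; have -> : a = (sqpos s).1 by rewrite sab.
have -> : b = (sqpos s).2 by rewrite sab.
by case: s {sab} => i j; rewrite /sqpos /=; have := ltn_ord i; have := ltn_ord j; lia.
Qed.

Lemma sq_in (a b : int) : (- L%:Z <= a < L%:Z) && (- L%:Z <= b < L%:Z) ->
  exists s : square L, sqpos s = (a, b).
Proof.
move=> ab.
have ha : (`|(a + L%:Z)%R| < 2 * L)%N by lia.
have hb : (`|(b + L%:Z)%R| < 2 * L)%N by lia.
by exists (Ordinal ha, Ordinal hb); rewrite /sqpos /=; congr (_, _); lia.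
Qed.

Lemma eleftE (e : edge) : eleft e =
  if (val e).2 == 0 then sq (pos (esrc e)).1 (pos (esrc e)).2
  else sq ((pos (esrc e)).1 - 1) (pos (esrc e)).2.
Proof.
rewrite /eleft /left_face /sector /sq; have [d0|d0] := eqVneq (val e).2 0.
  by rewrite d0 /esrc; case: (pos _) => a b; congr face_at; congr (_, _); rewrite /= ?addr0.
have := edge_dir e; rewrite (negbTE d0) orFb => /eqP ->; rewrite /esrc; case: (pos _) => a b.
by congr face_at; congr (_, _); rewrite /= ?addr0.
Qed.

Lemma erightE (e : edge) : eright e =
  if (val e).2 == 0 then sq (pos (esrc e)).1 ((pos (esrc e)).2 - 1)
  else sq (pos (esrc e)).1 (pos (esrc e)).2.
Proof.
rewrite /eright /right_face /sector /sq; have [d0|d0] := eqVneq (val e).2 0.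
  by rewrite d0 /esrc; case: (pos _) => a b; congr face_at; congr (_, _); rewrite /= ?addr0.
have := edge_dir e; rewrite (negbTE d0) orFb => /eqP ->; rewrite /esrc; case: (pos _) => a b.
by congr face_at; congr (_, _); rewrite /= ?addr0.
Qed.

End Grid.

(** * Potentials of divergence-free flows *)

Section Potential.
Variable L : nat.
Local Notation edge := (edge L).
Local Notation dv := (sdiv (@esrc L) (@etgt L) pred0).

Lemma has_east a b : has_edge L 0 a b = (- L%:Z <= a < L%:Z) && (- L%:Z <= b <= L%:Z).
Proof. by rewrite /has_edge /in_box /=; apply/idP/idP; lia. Qed.

Lemma has_north a b : has_edge L 1 a b = (- L%:Z <= a <= L%:Z) && (- L%:Z <= b < L%:Z).
Proof. by rewrite /has_edge /in_box /=; apply/idP/idP; lia. Qed.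

Lemma at_edge_ext (k : edge -> int) (g : 'Z_4 -> int -> int -> int) d a b :
  (forall e : edge, k e = g (val e).2 (pos (esrc e)).1 (pos (esrc e)).2) ->
  (~~ has_edge L d a b -> g d a b = 0) -> at_edge k d a b = g d a b.
Proof.
move=> kg g0; have [h|h] := boolP (has_edge L d a b); last by rewrite at_edge_none // g0.
have [e [ed ea _]] := edge_exists h.
by have := at_edgeE k e; rewrite kg ed ea.
Qed.

(** Outside the box all four values are 0, so that the law holds at every point of the plane. *)
Lemma kirchhoff (k : edge -> int) a b : (forall v, dv k v = 0) ->
  at_edge k 0 a b + at_edge k 1 a b = at_edge k 0 (a - 1) b + at_edge k 1 a (b - 1).
Proof.
move=> k0; have [h|h] := boolP (in_box L a b).
  have [v pv] := site_at h; have := k0 v; rewrite (sdiv_at _ _ pv) /= => /eqP.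
  by rewrite subr_eq0 => /eqP.
by rewrite !at_edge_none // ?has_east ?has_north; move: h; rewrite /in_box; lia.
Qed.

(** [W a b] is the height reached from the outer face on the west by crossing the first [a] north
    edges of row [b]. Kirchhoff's law, propagated along the row, gives the relation across the east
    edges ([WE]). *)
Lemma potential (k : edge -> int) : (forall v, dv k v = 0) ->
  exists n : face L -> int, forall e, k e = n (eleft e) - n (eright e).
Proof.
move=> k0.
pose W (a : nat) (b : int) : int := - \sum_(i < a) at_edge k 1 (i%:Z - L%:Z) b.
have W0 b : W 0%N b = 0 by rewrite /W big_ord0 oppr0.
have WS a b : W a.+1 b = W a b - at_edge k 1 (a%:Z - L%:Z) b by rewrite /W big_ord_recr /= opprD.
have Wout a b : ~~ (- L%:Z <= b < L%:Z) -> W a b = 0.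
  move=> hb; rewrite /W big1 ?oppr0 // => i _; rewrite at_edge_none // has_north.
  by rewrite (negbTE hb) andbF.
have WE (a : nat) b : W a.+1 b - W a.+1 (b - 1) = at_edge k 0 (a%:Z - L%:Z) b.
  elim: a => [|a IH].
    rewrite !WS !W0; have := kirchhoff (0%:Z - L%:Z) b k0.
    by rewrite [at_edge k 0 (_ - 1) b]at_edge_none ?has_east; lia.
  rewrite WS [W a.+2 (b - 1)]WS; have := kirchhoff (a.+1%:Z - L%:Z) b k0.
  have -> : a.+1%:Z - L%:Z - 1 = a%:Z - L%:Z by lia.
  by move: IH; lia.
(* No east edge starts from the last column, so that the total flux through a row does not depend on
   the row; it is 0 below the box. Hence the outer face has height 0 on the east side too. *)
have Wlast (b : nat) : W (2 * L).+1 (b%:Z - L%:Z - 1) = 0.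
  elim: b => [|b IH]; first by apply: Wout; lia.
  have := WE (2 * L)%N (b%:Z - L%:Z); rewrite IH subr0.
  rewrite at_edge_none; last by rewrite has_east; lia.
  by move=> <-; congr W; lia.
pose n (f : face L) : int := if f is Some s then W s.1.+1 (s.2%:Z - L%:Z) else 0.
have nW (a : int) b : - L%:Z <= a + 1 -> a <= L%:Z -> n (sq L a b) = W `|(a + L%:Z + 1)%R|%N b.
  move=> a1 a2; have [h|h] := boolP ((- L%:Z <= a < L%:Z) && (- L%:Z <= b < L%:Z)).
    have [s sab] := sq_in h; rewrite (sqP sab) /n; move: sab; rewrite /sqpos => -[<- <-].
    by congr W; lia.
  rewrite sq_out //=.
  have [hb|hb] := boolP (- L%:Z <= b < L%:Z); last by rewrite Wout.
  have [->|->] : a = - L%:Z - 1 \/ a = L%:Z by move: h; rewrite hb; lia.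
    by have -> : `|(- L%:Z - 1 + L%:Z + 1)%R|%N = 0%N by lia.
  have -> : `|(L%:Z + L%:Z + 1)%R|%N = (2 * L).+1 by lia.
  by have := Wlast `|(b + L%:Z + 1)%R|%N; rewrite (_ : _ - 1 = b) //; lia.
exists n => e; rewrite eleftE erightE -(at_edgeE k e).
have := edge_has e; case: (pos (esrc e)) => a b /=.
have [->|d0] := eqVneq (val e).2 0.
  rewrite has_east => h; rewrite !nW; try lia.
  have := WE `|(a + L%:Z)%R|%N b.
  have -> : `|(a + L%:Z)%R|%N%:Z - L%:Z = a by lia.
  by move=> <-; congr (W _ _ - W _ _); lia.
have := edge_dir e; rewrite (negbTE d0) orFb => /eqP ->.
rewrite has_north => h; rewrite !nW; try lia.
have := WS `|(a + L%:Z)%R|%N b.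
have -> : `|(a + L%:Z)%R|%N%:Z - L%:Z = a by lia.
have -> : `|(a - 1 + L%:Z + 1)%R|%N = `|(a + L%:Z)%R|%N by lia.
have -> : `|(a + L%:Z + 1)%R|%N = `|(a + L%:Z)%R|.+1 by lia.
by move=> ->; lia.
Qed.

Lemma degree_le4 (x : site L) :
  (#|[pred e : edge | esrc e == x]| + #|[pred e : edge | etgt e == x]| <= 4)%N.
Proof.
have h (P : pred edge) : {in P &, injective (fun e : edge => (val e).2)} -> (#|P| <= 2)%N.
  move=> inj;   rewrite -(card_in_imset inj).
  have c2 : #|[set (0 : 'Z_4); 1]%SET| = 2%N by rewrite cards2.
  rewrite -[leqRHS]c2; apply: subset_leq_card; apply/fintype.subsetP => d /imsetP[e _ ->].
  by rewrite !inE edge_dir.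
apply: (@leq_add _ _ 2 2); apply: h => e e'; rewrite !inE => /eqP es /eqP es' dd; apply: val_inj.
  rewrite [LHS]surjective_pairing [RHS]surjective_pairing dd.
  by congr (_, _); move: es es'; rewrite /esrc => -> ->.
rewrite [LHS]surjective_pairing [RHS]surjective_pairing dd.
congr (_, _); apply: pos_inj; have := etgt_pos e; have := etgt_pos e'.
by rewrite es es' dd => -> /addIr.
Qed.

End Potential.

(** * The cut and the twisted flows *)

Section Cut.
Variables (L A B : nat).
Hypotheses (A0 : (0 < A <= L)%N) (B0 : (0 < B <= L)%N).
Local Notation edge := (edge L).
Local Notation dv := (sdiv (@esrc L) (@etgt L) pred0).
Variables x y : site L.
Hypotheses (px : pos x = (0, A%:Z)) (py : pos y = (B%:Z, 0)).

(* The cut is the L-shaped path from [(0, A)] through the origin to [(B, 0)];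
   the edges touching its interior from the north-east side are twisted. *)
Definition cut_at (d : 'Z_4) (a b : int) : bool :=
  if d == 0 then (b == 0) && (0 <= a < B%:Z) else (a == 0) && (0 <= b < A%:Z).

Definition neg_at (d : 'Z_4) (a b : int) : bool :=
  if d == 0 then (a == 0) && (0 < b < A%:Z) else (b == 0) && (0 < a < B%:Z).

Definition cut : {set edge} :=
  [set e | cut_at (val e).2 (pos (esrc e)).1 (pos (esrc e)).2]%SET.

Definition negE (e : edge) : bool := neg_at (val e).2 (pos (esrc e)).1 (pos (esrc e)).2.

(** The absolute values are those of [reflected_sum]; the signs make the four values at an inner
    vertex of the cut cancel. A twisted edge is reversed as seen from the cut, and [negE] restores
    the ordinary gradient at its other end. *)
Definition twist_at (M : int -> int -> int) (d : 'Z_4) (a b : int) : int :=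
  if d == 0 then
    if cut_at d a b then - (M a b + M a (b - 1) + 1)
    else if neg_at d a b then - (M a b - M a (b - 1)) else M a b - M a (b - 1)
  else
    if cut_at d a b then M (a - 1) b + M a b + 1
    else if neg_at d a b then - (M (a - 1) b - M a b) else M (a - 1) b - M a b.

Definition twist (m : face L -> int) (e : edge) : int :=
  twist_at (fun a b => m (sq L a b)) (val e).2 (pos (esrc e)).1 (pos (esrc e)).2.

Lemma twist_norm (m : face L -> int) (e : edge) :
  `|twist m e|%N = `|(if e \in cut then m (eleft e) + m (eright e) + 1
                      else m (eleft e) - m (eright e))%R|%N.
Proof.
rewrite /twist /twist_at eleftE erightE finset.inE.
by case: ifP => _; do 2?case: ifP => _; lia.
Qed.

Lemma twist_none (m : face L -> int) d a b : (d == 0) || (d == 1) -> ~~ has_edge L d a b ->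
  twist_at (fun a b => m (sq L a b)) d a b = 0.
Proof.
have eqs a' b' a'' b'' : ~~ ((- L%:Z <= a' < L%:Z) && (- L%:Z <= b' < L%:Z)) ->
  ~~ ((- L%:Z <= a'' < L%:Z) && (- L%:Z <= b'' < L%:Z)) -> m (sq L a' b') = m (sq L a'' b'').
  by move=> h1 h2; rewrite !sq_out.
move=> /orP[] /eqP ->; rewrite /twist_at /cut_at /neg_at /= ?has_east ?has_north => h.
  rewrite (eqs a b a (b - 1)); try lia.
  by do ?case: ifP => ?; lia.
rewrite (eqs (a - 1) b a b); try lia.
by do ?case: ifP => ?; lia.
Qed.

Lemma twist_sdiv (m : face L -> int) (v : site L) a b : pos v = (a, b) ->
  let M := fun a b => m (sq L a b) in
  let K d a b := if neg_at d a b then - twist_at M d a b else twist_at M d a b in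
  sdiv (@esrc L) (@etgt L) negE (twist m) v =
  twist_at M 0 a b + twist_at M 1 a b - (K 0 (a - 1) b + K 1 a (b - 1)).
Proof.
move=> pv M K; rewrite (sdiv_at _ _ pv).
rewrite !(@at_edge_ext L (twist m) (twist_at M)) //; try exact: twist_none.
rewrite !(@at_edge_ext L (fun e => if negE e then - twist m e else twist m e) K) //.
  by move=> h; rewrite /K twist_none // oppr0 if_same.
by move=> h; rewrite /K twist_none // oppr0 if_same.
Qed.

(** At an end of the cut the divergence is, up to sign, [2 m + 1] with [m] taken on the last square
    along the cut on its north-east side. *)
Lemma twist_twisted (m : face L -> int) : twisted (@esrc L) (@etgt L) x y negE (twist m).
Proof.
apply/and3P; split.
- apply/forallP => v; apply/implyP => /andP[vx vy].
  case pv : (pos v) => [a b]; rewrite (twist_sdiv m pv) /=.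
  have {}vx : ~~ ((a == 0) && (b == A%:Z)).
    by rewrite -xpair_eqE -pv -px (inj_eq (@pos_inj L)).
  have {}vy : ~~ ((a == B%:Z) && (b == 0)).
    by rewrite -xpair_eqE -pv -py (inj_eq (@pos_inj L)).
  rewrite /twist_at /cut_at /neg_at /=.
  move: (m (sq L a b)) (m (sq L (a - 1) b)) (m (sq L a (b - 1))) (m (sq L (a - 1) (b - 1))) => m1 m2 m3 m4.
  by do ?case: ifP => ?; lia.
- rewrite (twist_sdiv m px) /= /twist_at /cut_at /neg_at /=.
  move: (m (sq L 0 A%:Z)) (m (sq L (0 - 1) A%:Z)) (m (sq L 0 (A%:Z - 1))) (m (sq L (0 - 1) (A%:Z - 1))) => m1 m2 m3 m4.
  by do ?case: ifP => ?; lia.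
- rewrite (twist_sdiv m py) /= /twist_at /cut_at /neg_at /=.
  move: (m (sq L B%:Z 0)) (m (sq L (B%:Z - 1) 0)) (m (sq L B%:Z (0 - 1))) (m (sq L (B%:Z - 1) (0 - 1))) => m1 m2 m3 m4.
  by do ?case: ifP => ?; lia.
Qed.

(* Along a row crossing the cut once, the difference of two fields with the same
   image changes sign, while it takes the same value at both ends. *)
Lemma twist_inj (m m' : face L -> int) : twist m =1 twist m' -> m =1 m'.
Proof.
move=> mm; pose D a b := m (sq L a b) - m' (sq L a b).
have step a b : - L%:Z <= a <= L%:Z -> - L%:Z <= b < L%:Z ->
   D a b = if (a == 0) && (0 <= b < A%:Z) then - D (a - 1) b else D (a - 1) b.
  move=> ha hb; have he : has_edge L 1 a b by rewrite has_north ha hb.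
  have [e [ed ea _]] := edge_exists he.
  have := mm e; rewrite /twist /twist_at ed ea /= /cut_at /neg_at /D /=.
  move: (m (sq L (a - 1) b)) (m (sq L a b)) (m' (sq L (a - 1) b)) (m' (sq L a b)) => m1 m2 m3 m4.
  by do ?case: ifP => ?; lia.
have row b : - L%:Z <= b < L%:Z -> forall a : nat, (a <= 2 * L)%N ->
   D (a%:Z - L%:Z) b = if (L <= a)%N && (0 <= b < A%:Z) then - D (- L%:Z - 1) b else D (- L%:Z - 1) b.
  move=> hb; elim=> [|a IH] aL.
    rewrite step //; last lia.
    rewrite (_ : 0%:Z - L%:Z - 1 = - L%:Z - 1); last lia.
    move: (D (- L%:Z - 1) b) => z; by do ?case: ifP => ?; lia.
  rewrite step //; last lia.
  rewrite (_ : a.+1%:Z - L%:Z - 1 = a%:Z - L%:Z); last lia.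
  rewrite IH; last lia.
  move: (D (- L%:Z - 1) b) => z; by do ?case: ifP => ?; lia.
have out a b : ~~ ((- L%:Z <= a < L%:Z) && (- L%:Z <= b < L%:Z)) -> D a b = m None - m' None.
  by move=> h; rewrite /D sq_out.
(* Row 0 crosses the cut since [A >= 1], and both its ends lie in the outer face: the difference
   there equals its opposite. *)
have D0 : m None - m' None = 0.
  have hb0 : - L%:Z <= 0 < L%:Z by lia.
  have := row 0 hb0 (2 * L)%N (leqnn _).
  have -> : (2 * L)%N%:Z - L%:Z = L%:Z by lia.
  rewrite !out; try lia.
  by move: (m None - m' None) => z; case: ifP => h; lia.
move=> [s|]; last lia.
case sab : (sqpos s) => [a b]; have <- := sqP sab.
have [hab|/out h] := boolP ((- L%:Z <= a < L%:Z) && (- L%:Z <= b < L%:Z)); last by move: h; rewrite /D; lia.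
have := row b _ `|(a + L%:Z)%R|%N.
rewrite (_ : `|(a + L%:Z)%R|%N%:Z - L%:Z = a); last lia.
move=> /(_ _ _); rewrite (out (- L%:Z - 1)); last lia.
by rewrite /D D0; case: ifP; lia.
Qed.

(* Connection is witnessed by a unit flow instead of a path: level loops
   carry such flows, and a flow has a potential. *)
Definition connected (w : {set edge}) : bool :=
  `[< exists k : edge -> int, (forall e, e \notin w -> k e = 0) /\
      forall v, dv k v = (v == x)%:Z - (v == y)%:Z >].

Lemma connected_mono (w w' : {set edge}) : w \subset w' -> connected w -> connected w'.
Proof.
move=> ww /asboolP[k [kw kd]]; apply/asboolP; exists k; split => // e ew'.
by apply: kw; apply: contra ew'; exact: (fintype.subsetP ww).
Qed.

Definition cut_flow (e : edge) : int :=
  if cut_at (val e).2 (pos (esrc e)).1 (pos (esrc e)).2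
  then (if (val e).2 == 0 then 1 else -1) else 0.

Lemma cut_flow_div v : dv cut_flow v = (v == x)%:Z - (v == y)%:Z.
Proof.
case pv : (pos v) => [a b]; rewrite (sdiv_at _ _ pv) /=.
rewrite -(inj_eq (@pos_inj L) v x) -(inj_eq (@pos_inj L) v y) px py pv !xpair_eqE.
pose g (d : 'Z_4) a b := if cut_at d a b then (if d == 0 then 1 else -1) else 0 : int.
have ge d a' b' : (d == 0) || (d == 1) -> at_edge cut_flow d a' b' = g d a' b'.
  move=> d01; apply: at_edge_ext => // h; rewrite /g /cut_at.
  by move: d01 h => /orP[] /eqP ->; rewrite ?has_east ?has_north /=; case: ifP; lia.
rewrite [at_edge (fun e => cut_flow e) _ _ _]ge // [at_edge (fun e => cut_flow e) _ _ _]ge // !ge //.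
by rewrite /g /cut_at /=; do 4?case: ifP; lia.
Qed.

(** The witnessing flow and the flow along the cut have the same divergence, so that their
    difference has a potential [n]. Outside [w] only the flow along the cut is left, with values 1
    or -1 on the cut, and the parity of [n] is the required flip. *)
Lemma connected_flip (w : {set edge}) : connected w ->
  exists t : {ffun face L -> bool}, forall e, e \notin w -> (t (eleft e) (+) t (eright e)) = (e \in cut).
Proof.
move=> /asboolP[k [kw kd]].
have [n hn] : exists n : face L -> int, forall e, k e - cut_flow e = n (eleft e) - n (eright e).
  apply: potential => v.
  have -> : dv (fun e => k e - cut_flow e) v = dv k v - dv cut_flow v.
    by rewrite /sdiv /= !sumrB; ring.
  by rewrite kd cut_flow_div subrr.
exists [ffun f => odd `|n f|%N] => e ew; rewrite !ffunE finset.inE.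
have := hn e; rewrite kw // /cut_flow.
by case: ifP => _; [case: ifP => _|]; lia.
Qed.

End Cut.

(** * Level lines *)

Section Loops.
Variable L : nat.
Local Notation edge := (edge L).
Local Notation dv := (sdiv (@esrc L) (@etgt L) pred0).

Lemma left_face_tip (e : oedge L) : is_edge e -> left_face e = sector (tip e) (e.2 + 1).
Proof.
move=> /tip_pos h; rewrite /left_face /sector h; congr face_at.
rewrite -addrA; congr (_ + _).
by have [->|->|->|->] := Z4_cases e.2.
Qed.

Lemma right_face_tip (e : oedge L) : is_edge e -> right_face e = sector (tip e) (e.2 + 2).
Proof.
move=> /tip_pos h; rewrite /right_face /sector h; congr face_at.
rewrite -addrA; congr (_ + _).
by have [->|->|->|->] := Z4_cases e.2.
Qed.

(** A missing edge has the outer face on both sides; [q_edge] can therefore be read from the sectors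
    alone, as in [q_edge_out]. *)
Lemma sector_none (v : site L) (d : 'Z_4) : ~~ is_edge (v, d) -> sector v d = sector v (d - 1).
Proof.
rewrite is_edgeP; case pv : (pos v) => [a b]; have := pos_box v; rewrite /sector pv /in_box /= => h h'.
have [dd|dd|dd|dd] := Z4_cases d; move: h h'; rewrite dd /= => h h'.
- transitivity (None : face L); [apply: (@sq_out L (a + 0) (b + 0)) | apply/esym; apply: (@sq_out L (a + 0) (b + -1))]; lia.
- transitivity (None : face L); [apply: (@sq_out L (a + -1) (b + 0)) | apply/esym; apply: (@sq_out L (a + 0) (b + 0))]; lia.
- transitivity (None : face L); [apply: (@sq_out L (a + -1) (b + -1)) | apply/esym; apply: (@sq_out L (a + -1) (b + 0))]; lia.
- transitivity (None : face L); [apply: (@sq_out L (a + 0) (b + -1)) | apply/esym; apply: (@sq_out L (a + -1) (b + -1))]; lia.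
Qed.

Lemma sdiv_delta (e : edge) (c : int) v :
  dv (fun e' => if e' == e then c else 0) v = c * ((esrc e == v)%:Z - (etgt e == v)%:Z).
Proof.
have h (f : edge -> site L) : \sum_(e' | f e' == v) (if e' == e then c else 0) = c * (f e == v)%:Z.
  rewrite big_mkcond (bigD1 e) //= eqxx big1 ?addr0; first by case: eqP; rewrite ?mulr1 ?mulr0.
  by move=> e' /negbTE ->; case: ifP.
by rewrite /sdiv !h mulrBr.
Qed.

(** Since [edges] keeps only the east and north edges, a west or south edge is represented by its
    reversal carrying -1. *)
Lemma unit_flow (hi : face L -> bool) (e : oedge L) : is_edge e ->
  hi (left_face e) != hi (right_face e) ->
  exists k : edge -> int, (forall e', hi (eleft e') = hi (eright e') -> k e' = 0) /\
    forall v, dv k v = (v == e.1)%:Z - (v == tip e)%:Z.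
Proof.
move=> ie hlr; have [d01|d23] := boolP ((e.2 == 0) || (e.2 == 1)).
  have he : e \in edges L by rewrite edgesP ie d01.
  exists (fun e' => if e' == exist _ e he then 1 else 0); split=> [e'|v].
    by case: eqP => // -> h; move: hlr; rewrite -[left_face e]/(eleft (exist _ e he)) h eqxx.
  by rewrite sdiv_delta mul1r !(eq_sym v).
pose e2 : oedge L := (tip e, e.2 + 2).
have te := tip_pos ie.
have pe2 : pos (tip e) + step (e.2 + 2) = pos e.1.
  rewrite te -addrA [X in _ + X](_ : _ = 0) ?addr0 //.
  by have [->|->|->|->] := Z4_cases e.2.
have ie2 : is_edge e2.
  by rewrite is_edgeP; have := pos_box e.1; rewrite -pe2.
have te2 : tip e2 = e.1 by apply: pos_inj; rewrite tip_pos.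
have he : e2 \in edges L.
  rewrite edgesP ie2 /=; move: d23.
  by have [->|->|->|->] := Z4_cases e.2.
have fl : left_face e2 = right_face e.
  by rewrite right_face_tip.
have fr : right_face e2 = left_face e.
  rewrite left_face_tip // /right_face /=; congr sector.
  by rewrite -addrA; congr (_ + _); apply/val_inj.
exists (fun e' => if e' == exist _ e2 he then -1 else 0); split=> [e'|v].
  case: eqP => // ->; rewrite /eleft /eright /= fl fr => h.
  by move: hlr; rewrite h eqxx.
by rewrite sdiv_delta /esrc /etgt /= te2 mulN1r opprB !(eq_sym v).
Qed.

(** [S] tells which sectors at a vertex are above the level; an incoming edge of direction [d] has
    the sector [d + 1] on its left and [d + 2] on its right. That the turning rule can be inverted
    is checked on the 16 patterns. *)
Lemma turn_inj (S : 'Z_4 -> bool) (d d' : 'Z_4) :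
  S (d + 1) -> ~~ S (d + 2) -> S (d' + 1) -> ~~ S (d' + 2) ->
  (if S (d + 3) then d + 3 else if S d then d else d + 1) =
  (if S (d' + 3) then d' + 3 else if S d' then d' else d' + 1) -> d = d'.
Proof.
pose s (i : nat) := S (inZp i).
have -> : S = (fun d => s d) by apply/funext => u; congr S; apply/val_inj; case: u => u /=; case: (ltnP u 4) => // u4; rewrite modn_small.
move: (s) => {}s.
have [->|->|->|->] := Z4_cases d; have [->|->|->|->] := Z4_cases d';
rewrite /=; case: (s 0%N); case: (s 1%N); case: (s 2%N); case: (s 3%N) => //= _ _ _ _ /(congr1 val).
Qed.

Variables (n : height L) (q : rat).
Hypothesis nq : forall f, (n f)%:~R != q.
Let hi (f : face L) : bool := q < (n f)%:~R.
Local Notation next := (next_q_edge n q).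
Local Notation qedge := (q_edge n q).

Lemma q_edgeE (e : oedge L) : qedge e = [&& is_edge e, ~~ hi (right_face e) & hi (left_face e)].
Proof. by rewrite /q_edge /hi; congr (_ && (_ && _)); rewrite lt_neqAle nq -leNgt. Qed.

Lemma q_edge_out (v : site L) d : qedge (v, d) = ~~ hi (sector v (d - 1)) && hi (sector v d).
Proof.
rewrite q_edgeE /right_face /left_face /=.
have [ie|/sector_none ->] := boolP (is_edge (v, d)); first by [].
by case: hi; rewrite ?andbF.
Qed.

Lemma next_q_edgeE (e : oedge L) : qedge e ->
  [/\ hi (sector (tip e) (e.2 + 1)), ~~ hi (sector (tip e) (e.2 + 2)) &
   next e = (tip e, if hi (sector (tip e) (e.2 + 3)) then e.2 + 3
                    else if hi (sector (tip e) e.2) then e.2 else e.2 + 1)].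
Proof.
rewrite q_edgeE => /and3P[ie hr hl]; rewrite left_face_tip // in hl; rewrite right_face_tip // in hr.
split=> //; rewrite /next_q_edge /= !q_edge_out.
have -> : e.2 + 2 + 1 - 1 = e.2 + 2 by rewrite addrK.
have -> : e.2 + 2 + 1 = e.2 + 3 by rewrite -addrA; congr (_ + _); apply/val_inj.
have -> : e.2 + 2 + 2 - 1 = e.2 + 3 by rewrite -!addrA; congr (_ + _); apply/val_inj.
have -> : e.2 + 2 + 2 = e.2 by rewrite -addrA [X in _ + X](_ : _ = 0) ?addr0 //; apply/val_inj.
have -> : e.2 + 2 + 3 - 1 = e.2 by rewrite -!addrA [X in _ + X](_ : _ = 0) ?addr0 //; apply/val_inj.
have -> : e.2 + 2 + 3 = e.2 + 1 by rewrite -addrA; congr (_ + _); apply/val_inj.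
rewrite (negbTE hr) hl /=.
by case: (hi (sector _ (e.2 + 3))) => //=; case: (hi (sector _ e.2)).
Qed.

Lemma next_base (e : oedge L) : qedge e -> (next e).1 = tip e.
Proof. by move=> /next_q_edgeE[_ _ ->]. Qed.

Lemma next_q_edge_q (e : oedge L) : qedge e -> qedge (next e).
Proof.
move=> /next_q_edgeE[h1 h2 ->]; rewrite q_edge_out.
case h3 : (hi (sector _ (e.2 + 3))).
  by rewrite h3 andbT; have -> : e.2 + 3 - 1 = e.2 + 2 by rewrite -addrA; congr (_ + _); apply/val_inj.
case h0 : (hi (sector _ e.2)).
  have -> : e.2 - 1 = e.2 + 3 by congr (_ + _); apply/val_inj.
  by rewrite h0 h3.
by rewrite h1 addrK h0.
Qed.

Lemma next_inj (e e' : oedge L) : qedge e -> qedge e' -> next e = next e' -> e = e'.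
Proof.
move=> qe qe'; have [h1 h2 ->] := next_q_edgeE qe; have [h1' h2' ->] := next_q_edgeE qe'.
move=> [tt dd].
suff d2 : e.2 = e'.2.
  rewrite [LHS]surjective_pairing [RHS]surjective_pairing d2; congr (_, _); apply: pos_inj.
  move: qe qe'; rewrite !q_edgeE => /and3P[/tip_pos ie _ _] /and3P[/tip_pos ie' _ _].
  by move: ie ie'; rewrite tt d2 => -> /addIr.
rewrite -tt in h1' h2' dd.
exact: (@turn_inj (fun d => hi (sector (tip e) d)) _ _ h1 h2 h1' h2' dd).
Qed.

End Loops.

Section LoopConnections.
Variables (L : nat) (n : height L) (q : rat).
Hypothesis nq : forall f, (n f)%:~R != q.
Local Notation edge := (edge L).
Local Notation dv := (sdiv (@esrc L) (@etgt L) pred0).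
Let hi (f : face L) : bool := q < (n f)%:~R.
Local Notation next := (next_q_edge n q).
Local Notation qedge := (q_edge n q).
Local Notation loop e := [set e' | fconnect next e e']%SET.

Lemma iter_q_edge e i : qedge e -> qedge (iter i next e).
Proof. by move=> qe; elim: i => //= i IH; exact: next_q_edge_q. Qed.

Lemma fconnect_q_edge e e' : qedge e -> fconnect next e e' -> qedge e'.
Proof. by move=> qe /iter_findex <-; exact: iter_q_edge. Qed.

(** [next] is injective on the [q]-edges; extended by the identity it is injective everywhere, which
    makes connection symmetric and the loops disjoint. *)
Let g e := if qedge e then next e else e.

Let g_inj : injective g.
Proof.
move=> e e'; rewrite /g; case: ifP => qe; case: ifP => qe' //.
- exact: next_inj.
- by move=> h; have := next_q_edge_q nq qe; rewrite h qe'.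
- by move=> h; have := next_q_edge_q nq qe'; rewrite -h qe.
Qed.

Let fconnect_g e e' : qedge e -> fconnect next e e' = fconnect g e e'.
Proof.
move=> qe; have ig i : iter i g e = iter i next e.
  by elim: i => //= i ->; rewrite /g iter_q_edge.
by apply/idP/idP => /iter_findex <-; [rewrite -ig | rewrite ig]; exact: fconnect_iter.
Qed.

Lemma loop_eq e e' : qedge e -> e' \in loop e -> loop e = loop e'.
Proof.
move=> qe; rewrite inE => ee'; have qe' := fconnect_q_edge qe ee'.
apply/setP => e2; rewrite !inE !fconnect_g //; apply: same_connect.
  exact: fconnect_sym.
by rewrite -fconnect_g.
Qed.

(** [next] permutes the loop and starts from the tip of the preceding edge; so the increments of a
    function of the sites sum to 0 along a loop. *)
Lemma sum_tip (u : site L -> int) e : qedge e ->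
  \sum_(e' in loop e) u (tip e') = \sum_(e' in loop e) u e'.1.
Proof.
move=> qe; have lq e' : e' \in loop e -> qedge e' by rewrite inE; exact: fconnect_q_edge.
have inj : {in loop e &, injective next} by move=> e1 e2 /lq h1 /lq h2; exact: next_inj.
have im : [set next e' | e' in loop e]%SET = loop e.
  apply/eqP; rewrite eqEcard (card_in_imset inj) leqnn andbT.
  apply/fintype.subsetP => _ /imsetP[e' h ->]; move: h; rewrite !inE => h.
  by apply: connect_trans h _; exact: fconnect1.
rewrite -[in RHS]im big_imset //=; apply: eq_bigr => e' /lq h.
by rewrite next_base.
Qed.

Lemma loop_flow e e' : qedge e -> e' \in loop e ->
  exists k : edge -> int, (forall e1, hi (eleft e1) = hi (eright e1) -> k e1 = 0) /\
    forall v, dv k v = (v == e.1)%:Z - (v == e'.1)%:Z.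
Proof.
move=> qe; rewrite inE => /iter_findex <-; elim: (findex _ _ _) => [|i [k [k0 kd]]].
  by exists (fun=> 0); split => // v; rewrite /sdiv /= !big1 ?subrr.
have qi := iter_q_edge i qe.
have [ie hr hl] : [/\ is_edge (iter i next e), ~~ hi (right_face (iter i next e)) & hi (left_face (iter i next e))].
  by apply/and3P; rewrite -q_edgeE.
have hne : hi (left_face (iter i next e)) != hi (right_face (iter i next e)).
  by rewrite hl (negbTE hr).
have [k1 [k10 k1d]] := unit_flow ie hne.
exists (fun e1 => k e1 + k1 e1); split=> [e1 h|v]; first by rewrite k0 ?k10.
have -> : dv (fun e1 => k e1 + k1 e1) v = dv k v + dv k1 v.
  by rewrite /sdiv /= !big_split /=; ring.
by rewrite kd k1d /= next_base //; ring.
Qed.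

Lemma loop_vertex (e e' : oedge L) : qedge e -> e' \in loop e ->
  exists2 e2, e2 \in loop e & e2.1 = tip e'.
Proof.
move=> qe he'; exists (next e'); last by rewrite next_base //; move: he'; rewrite inE; exact: fconnect_q_edge.
by move: he'; rewrite !inE => h; apply: connect_trans h _; exact: fconnect1.
Qed.

(** A nonzero crossing of the half-line from the center of [f_0] is a vertical edge between [(a, 0)]
    and [(a, 1)] with [a > 0], which yields the site on the horizontal axis. *)
Lemma winding_axes (e : oedge L) (s : square L) : qedge e -> sqpos s = (0, 0) ->
  winding (loop e) (Some s) != 0 ->
  exists t1 t2 : nat, exists e1 e2 : oedge L,
    [/\ e1 \in loop e, e2 \in loop e, pos e1.1 = (0, t1.+1%:Z) & pos e2.1 = (t2.+1%:Z, 0)].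
Proof.
move=> qe s0 w0.
have ie e' : e' \in loop e -> is_edge e'.
  by rewrite inE => h; have := fconnect_q_edge qe h; rewrite q_edgeE // => /and3P[].
have vtx e' (P : int * int -> bool) : e' \in loop e -> P (pos e'.1) || P (pos (tip e')) ->
    exists2 e2, e2 \in loop e & P (pos e2.1).
  move=> he' /orP[Pe|Pe]; first by exists e'.
  by have [e2 he2 e2t] := loop_vertex qe he'; exists e2 => //; rewrite e2t.
have [e2 he2 c2] : exists2 e2, e2 \in loop e & crossing s e2 != 0.
  apply/exists_inP; apply: contraR w0 => /exists_inPn h.
  by rewrite /winding big1 // => e' /h; rewrite negbK => /eqP.
have [f2 hf2 /andP[f2a f2b]] : exists2 f, f \in loop e & (0 < (pos f.1).1) && ((pos f.1).2 == 0).
  apply: (vtx e2 (fun p => (0 < p.1) && (p.2 == 0)) he2).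
  move: c2; rewrite /crossing s0 (tip_pos (ie _ he2)).
  case: (pos e2.1) => a b; have [->|->|->|->] := Z4_cases e2.2; rewrite /= ?addr0;
  by do ?case: ifP => ?; lia.
(* [u] is the indicator of the open quadrant. Its increments sum to 0 along the loop and agree with
   [crossing] on the lower side of the quadrant; as the winding number is not 0, the loop must also
   cross the left side, at an edge where [nc] is not 0. *)
pose u (v : site L) : int := if (0 < (pos v).1) && (0 < (pos v).2) then 1 else 0.
pose nc (e' : oedge L) : int := u (tip e') - u e'.1 - crossing s e'.
have [e1 he1 c1] : exists2 e1, e1 \in loop e & nc e1 != 0.
  apply/exists_inP; apply: contraR w0 => /exists_inPn h.
  have : \sum_(e' in loop e) nc e' = 0 by rewrite big1 // => e' /h; rewrite negbK => /eqP.
  rewrite /nc !sumrB sum_tip // subrr sub0r => /eqP; rewrite oppr_eq0 => /eqP.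
  by rewrite /winding => ->.
have [f1 hf1 /andP[f1a f1b]] : exists2 f, f \in loop e & ((pos f.1).1 == 0) && (0 < (pos f.1).2).
  apply: (vtx e1 (fun p => (p.1 == 0) && (0 < p.2)) he1).
  move: c1; rewrite /nc /u /crossing s0 (tip_pos (ie _ he1)).
  case: (pos e1.1) => a b; have [->|->|->|->] := Z4_cases e1.2; rewrite /= ?addr0;
  by do ?case: ifP => ?; lia.
exists `|(pos f1.1).2|.-1, `|(pos f2.1).1|.-1, f1, f2; split => //.
  by case: (pos f1.1) f1a f1b => a b /= h1 h2; congr (_, _); lia.
by case: (pos f2.1) f2a f2b => a b /= h1 h2; congr (_, _); lia.
Qed.

Hypothesis L0 : (0 < L)%N.

Definition vaxis (i : 'I_L) : site L := (inord L, inord (L + i.+1)).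
Definition haxis (i : 'I_L) : site L := (inord (L + i.+1), inord L).

Lemma pos_vaxis i : pos (vaxis i) = (0, i.+1%:Z).
Proof. by rewrite /pos /vaxis /= !inordK; [congr (_, _); lia | have := ltn_ord i; lia | lia]. Qed.

Lemma pos_haxis i : pos (haxis i) = (i.+1%:Z, 0).
Proof. by rewrite /pos /haxis /= !inordK; [congr (_, _); lia | lia | have := ltn_ord i; lia]. Qed.

(** Each loop is charged to one of its edges issued from the vertical axis. The loops being
    disjoint, this edge determines the loop; the factor 4 counts its directions. *)
Lemma num_q_loops_le (eta : bool) :
  (num_q_loops n q eta (f0 L) <=
   \sum_(i < L) \sum_(j < L) 4 * connected (vaxis i) (haxis j)
      (bdry (@eleft L) (@eright L) [ffun f => hi f]))%N.
Proof.
have [s s0] : exists s : square L, sqpos s = (0, 0) by apply: sq_in; lia.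
have f0E : f0 L = Some s by rewrite /f0 -/(sq L 0 0) (sqP s0).
rewrite /num_q_loops f0E.
set S := [set c in q_loops n q | _]%SET.
pose P (c : {set oedge L}) (t : 'I_L * 'I_L * 'Z_4) :=
  ((vaxis t.1.1, t.2) \in c) && [exists d, (haxis t.1.2, d) \in c].
have Sq c : c \in S -> exists2 e, qedge e & c = loop e.
  rewrite inE => /andP[/imsetP[e]]; rewrite inE => qe -> _; by exists e.
have cS c : c \in S -> (1 <= \sum_t P c t)%N.
  move=> cS; have [e qe ce] := Sq c cS; move: cS; rewrite inE => /and3P[_ sur _].
  have [t1 [t2 [e1 [e2 [h1 h2 p1 p2]]]]] : exists t1 t2 : nat, exists e1 e2 : oedge L,
    [/\ e1 \in loop e, e2 \in loop e, pos e1.1 = (0, t1.+1%:Z) & pos e2.1 = (t2.+1%:Z, 0)].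
    by apply: (winding_axes qe s0); rewrite -ce.
  have l1 : (t1 < L)%N by have := pos_box e1.1; rewrite p1 /in_box /=; lia.
  have l2 : (t2 < L)%N by have := pos_box e2.1; rewrite p2 /in_box /=; lia.
  have v1 : vaxis (Ordinal l1) = e1.1 by apply: pos_inj; rewrite pos_vaxis p1.
  have v2 : haxis (Ordinal l2) = e2.1 by apply: pos_inj; rewrite pos_haxis p2.
  rewrite (bigD1 (Ordinal l1, Ordinal l2, e1.2)) //= {1}/P /= v1 v2 -!surjective_pairing ce h1 /=.
  have -> // : [exists d, (e2.1, d) \in loop e].
  by apply/existsP; exists e2.2; rewrite -surjective_pairing.
rewrite -sum1_card; apply: leq_trans (leq_sum _ cS) _.
rewrite exchange_big /=.
pose cn i j : bool := connected (vaxis i) (haxis j) (bdry (@eleft L) (@eright L) [ffun f => hi f]).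
apply: leq_trans (_ : \sum_(t : 'I_L * 'I_L * 'Z_4) cn t.1.1 t.1.2 <= _)%N.
  apply: leq_sum => -[[i j] d] _ /=.
  have [[c cS' Pc]|no] := pselect (exists2 c, c \in S & P c (i, j, d)); last first.
    rewrite big1 // => c cS'; case Pc : (P c _) => //.
    by exfalso; apply: no; exists c.
  rewrite (bigD1 c) //= Pc big1 ?addn0; last first.
    move=> c' /andP[cS2 cc']; case Pc' : (P c' _) => //; case/eqP: cc'.
    have [e qe ce] := Sq c cS'; have [e' qe' ce'] := Sq c' cS2.
    move: Pc Pc'; rewrite /P /= => /andP[h1 _] /andP[h1' _].
    by rewrite ce ce'; rewrite ce in h1; rewrite ce' in h1'; rewrite (loop_eq qe h1) (loop_eq qe' h1').
  have [e qe ce] := Sq c cS'; move: Pc; rewrite /P /= ce => /andP[h1 /existsP[d' h2]].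
  have q1 : qedge (vaxis i, d) by move: h1; rewrite inE; exact: fconnect_q_edge.
  rewrite (loop_eq qe h1) in h2.
  have [k [k0 kd]] := loop_flow q1 h2.
  suff -> : cn i j by [].
  apply/asboolP; exists k; split => // e1; rewrite inE !ffunE negbK => /eqP; exact: k0.
rewrite -(pair_bigA _ (fun ij d => cn ij.1 ij.2 : nat)) /=.
rewrite (eq_bigr (fun ij : 'I_L * 'I_L => 4 * cn ij.1 ij.2)%N); last first.
  by move=> ij _; rewrite sum_nat_const card_ord.
by rewrite -(pair_bigA _ (fun i j => 4 * cn i j)%N).
Qed.

End LoopConnections.

Local Open Scope classical_set_scope.
Local Open Scope ring_scope.

(** * Poisson summation *)

Section FinitePoisson.
Variable R : realType.
Implicit Types (M N : nat) (z : int).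

Definition cbin M z : R := 'C(2 * M, M + `|z|)%:R.

Lemma cbinN M z : cbin M (- z) = cbin M z.
Proof. by rewrite /cbin abszN. Qed.

Lemma cbin_gt M z : (M < `|z|)%N -> cbin M z = 0.
Proof. by move=> h; rewrite /cbin bin_small //; lia. Qed.

Lemma cos_expr M (u : R) : (2 * cos u) ^+ (2 * M) = trig M (cbin M) (2 * u).
Proof.
have eX n v : expi v ^+ n = expi (n%:R * v) :> R[i].
  elim: n => [|n IH]; first by rewrite mul0r expi0.
  by rewrite exprS IH -expiD -natr1 mulrDl mul1r addrC.
have e1 : (2 * cos u)%:C%C = expi u + expi (- u) :> R[i].
  by apply/eqP; rewrite eq_complex /= cosN sinN; apply/andP; split; apply/eqP; ring.
suff : ((2 * cos u) ^+ (2 * M))%:C%C = \sum_(i < (2 * M).+1) (cbin M (ib i))%:C%C * expi (- ((ib i)%:~R * (2 * u))).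
  move/(congr1 (@complex.Re R)); rewrite Re_sum => h; rewrite -[LHS]/(complex.Re ((2 * cos u) ^+ (2 * M))%:C%C) h; apply: eq_bigr => i _.
  by rewrite Re_realM /= cosN.
rewrite (rmorphXn (real_complex R)) /= e1 exprDn; apply: eq_bigr => i _.
rewrite !eX -expiD -mulr_natl rmorph_nat /=; congr (_ * expi _).
  rewrite /cbin /ib; case: (leqP M i) => h; first by congr (_%:R); congr ('C(_, _)); lia.
  by rewrite -bin_sub; last lia; congr (_%:R); congr ('C(_, _)); have := ltn_ord i; lia.
rewrite /ib natrB; last by have := ltn_ord i; lia.
by rewrite rmorphB /= natrM -!pmulrn; ring.
Qed.

Lemma sum_cos_sym N (v : R) :
  sin v * (\sum_(i < (2 * N).+1) cos ((ib i)%:~R * (2 * v))) = sin ((2 * N).+1%:R * v).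
Proof.
rewrite (sum_ib N (fun z => cos (z%:~R * (2 * v)))) mul0r cos0.
elim: N => [|N IH]; first by rewrite big_ord0 addr0 mulr1 mul1r.
rewrite big_ord_recr /= addrA mulrDr IH mulrNz mulNr cosN -!pmulrn.
have e n : (2 * n).+1%:R = 2 * n%:R + 1 :> R by rewrite -addn1 natrD natrM.
have -> : (2 * N).+1%:R * v = N.+1%:R * (2 * v) - v by rewrite e -addn1 natrD; ring.
have -> : (2 * N.+1).+1%:R * v = N.+1%:R * (2 * v) + v by rewrite e; ring.
by rewrite sinB sinD; ring.
Qed.

Lemma sum_cos_root N (d : int) :
  \sum_(i < (2 * N).+1) cos ((ib i)%:~R * (2 * (d%:~R * pi / (2 * N).+1%:R))) =
  (if ((2 * N).+1%:Z %| d)%Z then (2 * N).+1%:R else 0) :> R.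
Proof.
set H := (2 * N).+1.
have H0 : H%:R != 0 :> R by rewrite pnatr_eq0.
have Hp : 0 < H%:R :> R by rewrite ltr0n.
case: ifP => [/dvdzP[q ->]|nd].
  rewrite -[X in _ = X%:R](card_ord H) -sumr_const; apply: eq_bigr => i _.
  rewrite rmorphM /= -pmulrn [_ * pi]mulrAC mulfK //.
  have -> : (ib i)%:~R * (2 * (q%:~R * pi)) = (2 * (ib i * q))%:~R * pi :> R by rewrite !rmorphM /=; ring.
  by rewrite cos_int_pi abszM exprM sqrrN !expr1n.
set v := _ / _.
have := sum_cos_sym N v.
have -> : H%:R * v = d%:~R * pi by rewrite /v mulrC divfK.
rewrite sin_int_pi => /eqP; rewrite mulf_eq0 => /orP[/eqP s0|/eqP //]; exfalso.
have r0 : 0 < (d %% H%:Z)%Z < H%:Z.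
  by rewrite ltz_pmod // andbT lt_neqAle modz_ge0 // andbT eq_sym; apply/negP => /eqP h; move: nd => /negP; apply; apply/dvdz_mod0P.
have rp : 0 < (d %% H%:Z)%Z%:~R * pi / H%:R :> R by rewrite divr_gt0 // mulr_gt0 ?pi_gt0 // ltr0z; case/andP: r0.
have rpi : (d %% H%:Z)%Z%:~R * pi / H%:R < pi :> R.
  by rewrite ltr_pdivrMr // mulrC ltr_pM2l ?pi_gt0 // [H%:R]pmulrn ltr_int; case/andP: r0.
have : sin v = (-1) ^+ `|(d %/ H%:Z)%Z| * sin ((d %% H%:Z)%Z%:~R * pi / H%:R).
  rewrite /v {1}(divz_eq d H%:Z) rmorphD rmorphM /= -pmulrn !mulrDl.
  rewrite [_ * H%:R * _ / _]mulrAC mulfK // sinD sin_int_pi cos_int_pi mul0r add0r //.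
rewrite s0 => /esym/eqP; rewrite mulf_eq0 signr_eq0 /= gt_eqF //.
by apply: sin_gt0_pi; rewrite rp.
Qed.

(* When [M] is of order [N^2], the left-hand side tends, up to a factor, to a theta
   function of [2 pi j / (2 N + 1)], and the right-hand side to a sum of Gaussians. *)
Lemma finite_poisson M N (j : int) :
  \sum_(i < (2 * N).+1) (2 * cos ((ib i)%:~R * (pi / (2 * N).+1%:R))) ^+ (2 * M) *
     cos ((ib i)%:~R * (2 * (j%:~R * pi / (2 * N).+1%:R))) =
  (2 * N).+1%:R * \sum_(m < (2 * (M + `|j|)).+1) cbin M (j + (2 * N).+1%:Z * ib m) :> R.
Proof.
set H := (2 * N).+1.
(* The sum over [i] keeps only the frequencies congruent to [j] or [- j] modulo [2 N + 1]: this
   aliasing is Poisson's formula in finite form. *)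
pose D (d : int) : R := if (H%:Z %| d)%Z then H%:R else 0.
have DN d : D (- d) = D d by rewrite /D !dvdzE abszN.
have SE : \sum_(i < H) (2 * cos ((ib i)%:~R * (pi / H%:R))) ^+ (2 * M) *
     cos ((ib i)%:~R * (2 * (j%:~R * pi / H%:R))) = \sum_(z < (2 * M).+1) cbin M (ib z) * D (ib z - j).
  transitivity (\sum_(z < (2 * M).+1) cbin M (ib z) * ((D (ib z - j) + D (ib z + j)) / 2)).
    under eq_bigr do rewrite cos_expr /trig mulr_suml.
    rewrite exchange_big /=; apply: eq_bigr => z _.
    rewrite /D -!sum_cos_root -big_split /= mulr_suml mulr_sumr; apply: eq_bigr => i _ /=.
    rewrite -mulrA; congr (_ * _).
    have -> : (ib i)%:~R * (2 * ((ib z - j)%:~R * pi / H%:R)) =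
      (ib z)%:~R * (2 * ((ib i)%:~R * (pi / H%:R))) - (ib i)%:~R * (2 * (j%:~R * pi / H%:R)) :> R.
      by rewrite rmorphB /=; ring.
    have -> : (ib i)%:~R * (2 * ((ib z + j)%:~R * pi / H%:R)) =
      (ib z)%:~R * (2 * ((ib i)%:~R * (pi / H%:R))) + (ib i)%:~R * (2 * (j%:~R * pi / H%:R)) :> R.
      by rewrite rmorphD /=; ring.
    by rewrite cosB cosD; lra.
  under eq_bigr do rewrite mulrA mulrDr mulrDl.
  rewrite big_split /= [X in _ + X](reindex_inj rev_ord_inj) /=.
  under [X in _ + X]eq_bigr do rewrite ib_rev cbinN -DN opprD opprK.
  by rewrite -big_split /=; apply: eq_bigr => z _; lra.
rewrite SE; set K := (M + `|j|)%N.
transitivity (\sum_(m < (2 * K).+1) \sum_(z < (2 * M).+1) (if ib z == j + H%:Z * ib m then H%:R * cbin M (ib z) else 0)).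
  rewrite exchange_big /=; apply: eq_bigr => z _; rewrite /D.
  have bz : (`|ib z| <= M)%N by have := ltn_ord z; rewrite /ib; lia.
  case: ifP => [/dvdzP[q qE]|nd]; last first.
    rewrite mulr0 big1 // => m _; case: eqP => // e; exfalso; move/negP: nd; apply.
    by apply/dvdzP; exists (ib m); rewrite e; ring.
  have qK : (`|q| <= K)%N.
    have : (`|q| <= `|ib z - j|)%N by rewrite qE abszM leq_pmulr.
    rewrite /K; lia.
  pose mq : 'I_(2 * K).+1 := inord `|q + K%:Z|.
  have mqE : ib mq = q by rewrite /ib inordK; lia.
  rewrite (bigD1 mq) //= mqE ifT; last by apply/eqP; rewrite -[LHS](subrK j) qE; ring.
  rewrite big1 ?addr0 1?mulrC // => m mm; case: eqP => // e.
  have /mulIf h : H%:Z != 0 by [].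
  have : ib m = q by apply: h; rewrite -qE e; ring.
  rewrite -mqE /ib => e2; case/eqP: mm; apply/val_inj => /=; move: e2; lia.
rewrite mulr_sumr; apply: eq_bigr => m _; set w := j + _.
case: (leqP `|w| M) => wM.
  pose zw : 'I_(2 * M).+1 := inord `|w + M%:Z|.
  have zwE : ib zw = w by rewrite /ib inordK; lia.
  rewrite (bigD1 zw) //= zwE eqxx big1 ?addr0 // => z zz; case: eqP => // e.
  move: e; rewrite -zwE /ib => e2; case/eqP: zz; apply/val_inj => /=; move: e2; lia.
rewrite cbin_gt // mulr0 big1 // => z _; case: eqP => // e.
have := ltn_ord z; move: wM; rewrite -e /ib; lia.
Qed.

End FinitePoisson.

Section Tannery.
Variable R : realType.

Lemma box_tail_le (f : int -> R) (B r : R) (m K : nat) : 0 <= B -> 0 <= r < 1 -> (m <= K)%N ->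
  (forall k, (`|k| <= K)%N -> `|f k| <= B * r ^+ `|k|) ->
  `|\sum_(i < (2 * K).+1) f (ib i) - \sum_(i < (2 * m).+1) f (ib i)| <= 2 * B / (1 - r) * r ^+ m.
Proof.
move=> B0 r01 mK fB.
have r1 : 0 < 1 - r by have := andP r01; lra.
have r0 : 0 <= r by case/andP: r01.
suff h d : (m + d <= K)%N -> `|\sum_(i < (2 * (m + d)).+1) f (ib i) - \sum_(i < (2 * m).+1) f (ib i)|
   <= 2 * B / (1 - r) * (r ^+ m - r ^+ (m + d)).
  have := h (K - m)%N; rewrite subnKC // => /(_ (leqnn _)) h'; apply: le_trans h' _.
  apply: ler_wpM2l; first by rewrite divr_ge0 ?mulr_ge0 // ltW.
  by rewrite gerBl exprn_ge0.
elim: d => [|d IH] dK; first by rewrite addn0 !subrr normr0 mulr0.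
move: IH => /(_ ltac:(lia)) IH.
rewrite addnS [X in `|X - _|]sum_ib big_ord_recr /= addrA -sum_ib addrAC.
have e : 2 * B / (1 - r) * (r ^+ m - r ^+ (m + d).+1) =
  2 * B / (1 - r) * (r ^+ m - r ^+ (m + d)) + (B * r ^+ (m + d) + B * r ^+ (m + d)).
  by rewrite exprS; field; rewrite gt_eqF.
rewrite e; apply: le_trans (ler_normD _ _) (lerD IH _).
apply: le_trans (ler_normD _ _) (lerD _ _); (apply: le_trans (fB _ _) _; first lia); rewrite ?abszN;
 by apply: ler_wpM2l => //; apply: ler_wiXn2l => //; rewrite ?(ltW (andP r01).2) //; lia.
Qed.

Lemma cvg_geometric0 (c r : R) : 0 <= r < 1 -> c * r ^+ m @[m --> \oo] --> (0 : R).
Proof.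
move=> /andP[r0 r1]; rewrite -[X in _ --> X](mulr0 c).
by apply: cvgMr; apply: cvg_expr; rewrite ger0_norm.
Qed.

Lemma box_sum_cvg (f : int -> R) (B r : R) : 0 <= B -> 0 <= r < 1 ->
  (forall k, `|f k| <= B * r ^+ `|k|) ->
  cvgn (fun N => \sum_(i < (2 * N).+1) f (ib i)).
Proof.
move=> B0 r01 fB.
apply/cauchy_cvgP/cauchy_exP => e e0.
have r1 : 0 < 1 - r by have := andP r01; lra.
have rc := cvg_geometric0 (2 * B / (1 - r)) r01.
have /cvgrPdist_lt/(_ _ e0)[m _ hm] := rc.
exists (\sum_(i < (2 * m).+1) f (ib i)); exists m => // K /= mK.
rewrite /ball /= distrC; apply: le_lt_trans (@box_tail_le f B r m K B0 r01 mK _) _; first by move=> k _; exact: fB.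
have := hm m (leqnn _); rewrite /= sub0r normrN; apply: le_lt_trans; exact: ler_norm.
Qed.

(** Dominated convergence over growing boxes: cut at [m], where the tails are below [e / 3]
    uniformly in [n]. Domination is required only inside the box of size [K n]. *)
Lemma tannery (a : nat -> int -> R) (b : int -> R) (B r s : R) (K : nat -> nat) :
  0 <= B -> 0 <= r < 1 ->
  (\forall n \near \oo, forall k, (`|k| <= K n)%N -> `|a n k| <= B * r ^+ `|k|) ->
  (forall k, a n k @[n --> \oo] --> b k) -> K n @[n --> \oo] --> \oo ->
  \sum_(i < (2 * m).+1) b (ib i) @[m --> \oo] --> s ->
  \sum_(i < (2 * K n).+1) a n (ib i) @[n --> \oo] --> s.
Proof.
move=> B0 r01 aB ab Koo bs; apply/cvgrPdist_lt => e e0.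
have r1 : 0 < 1 - r by have := andP r01; lra.
have rc := cvg_geometric0 (2 * B / (1 - r)) r01.
have e3 : 0 < e / 3 by lra.
have /cvgrPdist_lt/(_ _ e3) h1 := rc.
have /cvgrPdist_lt/(_ _ e3) h2 := bs.
have [m _ /(_ m (leqnn _)) /= [{}h1 {}h2]] : \forall m \near \oo, `|0 - 2 * B / (1 - r) * r ^+ m| < e / 3 /\
   `|s - \sum_(i < (2 * m).+1) b (ib i)| < e / 3.
  by apply: filterS2 h1 h2 => m; split.
have abm : \sum_(i < (2 * m).+1) a n (ib i) @[n --> \oo] --> \sum_(i < (2 * m).+1) b (ib i).
  by apply: cvg_big; [exact: add_continuous|move=> i _; exact: ab].
have /cvgrPdist_lt/(_ _ e3) h3 := abm.
have Km : \forall n \near \oo, (m <= K n)%N by apply: (Koo [set k | (m <= k)%N]); exists m.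
apply: filterS3 aB h3 Km => n aB' h3' Km'.
have := @box_tail_le (a n) B r m (K n) B0 r01 Km' aB'.
move: h1; rewrite sub0r normrN => /(le_lt_trans (ler_norm _)) h1.
move: h2 h3'; move: (\sum_(_ < _) _) => X1; move: (\sum_(_ < _) _) => X2; move: (\sum_(_ < _) _) => X3.
move: h1; move: (_ / _ * _) => X4 h1 h2 h3' h4.
have -> : s - X3 = (s - X1) + (X1 - X2) - (X3 - X2) by ring.
by apply: le_lt_trans (ler_normB _ _) _; have := ler_normD (s - X1) (X1 - X2); lra.
Qed.

End Tannery.

Section LocalLimits.
Variable R : realType.

(** [sin u] is [2 cos (u / 2) sin (u / 2)] and [sin (u / 2) = cos c * (u / 2)] by the mean value
    theorem; both angles are at most [pi / 4], so twice the product of the cosines is at least 1. *)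
Lemma half_le_sin (u : R) : 0 <= u <= pi / 2 -> u / 2 <= sin u.
Proof.
move=> /andP[u0 up].
have [->|un] := eqVneq u 0; first by rewrite mul0r sin0.
have up0 : 0 < u / 2 by rewrite divr_gt0 // lt_neqAle eq_sym un.
have ch (c : R) : 0 <= c <= pi / 4 -> 0 <= cos c /\ 1 <= 2 * cos c ^+ 2.
  move=> /andP[c0 c4]; split; first by apply: cos_ge0_pihalf; have := pi_gt0 R; lra.
  have : 0 <= cos (c *+ 2) by apply: cos_ge0_pihalf; rewrite [c *+ 2]mulr2n; have := pi_gt0 R; lra.
  by rewrite cos_mulr2n -mulr_natl; lra.
have [c /andP[c0 cu]] := @MVT R (@sin R) (@cos R) 0 (u / 2) up0 (fun x _ => is_derive_sin x)
  (continuous_subspaceT (@continuous_sin R)).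
rewrite !bnd_simp in c0 cu; rewrite sin0 !subr0 => sE.
have [a0 a1] := ch c ltac:(lra).
have [b0 b1] := ch (u / 2) ltac:(lra).
have -> : sin u = 2 * (cos (u / 2) * sin (u / 2)).
  have {1}-> : u = (u / 2) *+ 2 by rewrite -[RHS]mulr_natl; field.
  by rewrite sin_mulr2n -[LHS]mulr_natl.
rewrite sE; move: a0 a1 b0 b1; move: (cos c) (cos (u / 2)) => x y x0 x1 y0 y1.
have xy : 1 <= 2 * (x * y).
  have h1 : 1 <= 2 * (x * y) * (2 * (x * y)) by rewrite [leRHS](_ : _ = (2 * x ^+ 2) * (2 * y ^+ 2)); [nra|ring].
  have : 0 <= x * y by exact: mulr_ge0.
  nra.
have -> : 2 * (y * (x * (u / 2))) = (2 * (x * y)) * (u / 2) by ring.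
by rewrite ler_peMl // ltW.
Qed.

Lemma cvg_expR (u : nat -> R) (c : R) : u n @[n --> \oo] --> c ->
  expR (u n) @[n --> \oo] --> expR c.
Proof. by move=> uc; apply: (@continuous_cvg _ _ _ _ _ u expR c) => //; exact: continuous_expR. Qed.

(** Squeezed by [exp (- x / (1 - x)) <= 1 - x <= exp (- x)]. *)
Lemma cvg_one_sub_expr (x : nat -> R) (M : nat -> nat) (c : R) :
  x n @[n --> \oo] --> (0 : R) -> (M n)%:R * x n @[n --> \oo] --> c ->
  (1 - x n) ^+ M n @[n --> \oo] --> expR (- c).
Proof.
move=> x0 Mx.
apply: (@squeeze_cvgr _ _ _ _ (fun n => expR (- ((M n)%:R * x n / (1 - x n)))) (fun n => expR (- ((M n)%:R * x n)))).
- have : \forall n \near \oo, `|0 - x n| < 1 by move/cvgrPdist_lt: x0; apply.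
  apply: filterS => n; rewrite sub0r normrN ltr_norml => /andP[_ x1].
  have y0 : 0 < 1 - x n by lra.
  apply/andP; split; last first.
    by rewrite -mulrN expRM_natl lerXn2r ?nnegrE ?expR_ge0 ?(ltW y0) ?expR_ge1Dx.
  rewrite -mulrA -mulrN expRM_natl lerXn2r ?nnegrE ?expR_ge0 ?(ltW y0) //.
  rewrite expRN invf_ple ?posrE ?expR_gt0 //; apply: le_trans (expR_ge1Dx _).
  by rewrite -subr_ge0 [X in _ <= X](_ : _ = 0) //; field; rewrite gt_eqF.
- apply: cvg_expR; rewrite -[c]divr1; apply: cvgN; apply: cvgM => //; apply: cvgV; first exact: oner_neq0.
  by rewrite -[X in _ --> X]subr0; apply: cvgB => //; exact: cvg_cst.
- by apply: cvg_expR; exact: cvgN.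
Qed.

Lemma cbin0_gt0 M : 0 < cbin R M 0.
Proof. by rewrite /cbin ltr0n bin_gt0; lia. Qed.

Lemma cbinS M (i : nat) : cbin R M i.+1 * (M + i.+1)%:R = cbin R M i * (M - i)%:R.
Proof.
rewrite /cbin !absz_nat -!natrM; congr (_%:R).
by rewrite addnS mulnC mul_bin_left mulnC; congr muln; lia.
Qed.

(** The ratio of consecutive coefficients is [1 - (2 i + 1) / (M + i + 1)], at most
    [exp (- (2 i + 1) / (M + J))], and the odd numbers below [2 J] sum to [J^2]. *)
Lemma cbin_upper M (J : nat) : (J <= M)%N ->
  cbin R M J <= cbin R M 0 * expR (- (J%:R ^+ 2 / (M + J)%:R)).
Proof.
move=> JM; suff h i : (i <= J)%N -> cbin R M i <= cbin R M 0 * expR (- (i%:R ^+ 2 / (M + J)%:R)) by exact: h.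
elim: i => [|i IH] iJ; first by rewrite expr0n /= mul0r oppr0 expR0 mulr1.
have MJ : 0 < (M + J)%:R :> R by rewrite ltr0n; lia.
have Mi : 0 < (M + i.+1)%:R :> R by rewrite ltr0n; lia.
have -> : cbin R M i.+1 = cbin R M i * ((M - i)%:R / (M + i.+1)%:R).
  by rewrite mulrA -cbinS mulfK // gt_eqF.
have -> : - (i.+1%:R ^+ 2 / (M + J)%:R) = - (i%:R ^+ 2 / (M + J)%:R) + - ((2 * i).+1%:R / (M + J)%:R) :> R.
  by rewrite -opprD -mulrDl -natrX -natrX -natrD; congr (- (_%:R / _)); lia.
rewrite expRD mulrA; apply: ler_pM; rewrite ?ler0n ?divr_ge0 //; first exact: IH (ltnW iJ).
apply: le_trans (expR_ge1Dx _).
have -> : (M - i)%:R / (M + i.+1)%:R = 1 - (2 * i).+1%:R / (M + i.+1)%:R :> R.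
  apply: (mulIf (lt0r_neq0 Mi)); rewrite divfK ?gt_eqF // mulrBl mul1r divfK ?gt_eqF // -natrB; last by lia.
  by congr (_%:R); lia.
by rewrite lerD2l lerN2 ler_wpM2l ?lef_pV2 ?posrE // ler_nat; lia.
Qed.

Lemma cbin_lower M (J : nat) : (J <= M)%N ->
  cbin R M 0 * expR (- (J%:R ^+ 2 / (M.+1 - J)%:R)) <= cbin R M J.
Proof.
move=> JM; suff h i : (i <= J)%N -> cbin R M 0 * expR (- (i%:R ^+ 2 / (M.+1 - J)%:R)) <= cbin R M i by exact: h.
elim: i => [|i IH] iJ; first by rewrite expr0n /= mul0r oppr0 expR0 mulr1.
have MJ : 0 < (M.+1 - J)%:R :> R by rewrite ltr0n; lia.
have Mi : 0 < (M + i.+1)%:R :> R by rewrite ltr0n; lia.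
have Mi' : 0 < (M - i)%:R :> R by rewrite ltr0n; lia.
have -> : cbin R M i.+1 = cbin R M i * ((M - i)%:R / (M + i.+1)%:R).
  by rewrite mulrA -cbinS mulfK // gt_eqF.
have -> : - (i.+1%:R ^+ 2 / (M.+1 - J)%:R) = - (i%:R ^+ 2 / (M.+1 - J)%:R) + - ((2 * i).+1%:R / (M.+1 - J)%:R) :> R.
  by rewrite -opprD -mulrDl -natrX -natrX -natrD; congr (- (_%:R / _)); lia.
rewrite expRD mulrA; apply: ler_pM; rewrite ?mulr_ge0 ?expR_ge0 ?ler0n //; first exact: IH (ltnW iJ).
rewrite expRN invf_ple ?posrE ?expR_gt0 ?divr_gt0 //; apply: le_trans (expR_ge1Dx _).
rewrite invf_div.
have -> : (M + i.+1)%:R / (M - i)%:R = 1 + (2 * i).+1%:R / (M - i)%:R :> R.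
  apply: (mulIf (lt0r_neq0 Mi')); rewrite divfK ?gt_eqF // mulrDl mul1r divfK ?gt_eqF // -natrD.
  by congr (_%:R); lia.
by rewrite lerD2l ler_wpM2l ?lef_pV2 ?posrE // ler_nat; lia.
Qed.

(** The local limit theorem of de Moivre and Laplace, normalized at the center so that Stirling's
    formula does not enter. *)
Lemma cbin_cvg (M J : nat -> nat) (h : nat -> R) (al y : R) : 0 < al ->
  (forall n, 0 < h n) -> (h n)^-1 @[n --> \oo] --> (0 : R) ->
  (M n)%:R / h n ^+ 2 @[n --> \oo] --> al ->
  (J n)%:R / h n @[n --> \oo] --> y ->
  cbin R (M n) (J n) / cbin R (M n) 0 @[n --> \oo] --> expR (- (y ^+ 2 / al)).
Proof.
move=> al0 h0 hoo Mh Jh.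
pose w n := (J n)%:R / h n; pose v n := (M n)%:R / h n ^+ 2.
have JM : \forall n \near \oo, (J n <= M n)%N.
  have : v n - w n * (h n)^-1 @[n --> \oo] --> al - y * 0 by apply: cvgB => //; exact: cvgM.
  rewrite mulr0 subr0 => /cvgrPdist_lt/(_ _ al0); apply: filterS => n.
  rewrite ltr_norml => /andP[_ hv].
  have : 0 < v n - w n * (h n)^-1 by lra.
  rewrite subr_gt0 /v /w -mulrA -invfM -expr2 ltr_pM2r ?invr_gt0 ?exprn_gt0 // ltr_nat; exact: ltnW.
apply: (@squeeze_cvgr _ _ _ _ (fun n => expR (- (w n ^+ 2 / (v n + (h n)^-1 * (h n)^-1 - w n * (h n)^-1))))
   (fun n => expR (- (w n ^+ 2 / (v n + w n * (h n)^-1))))).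
- apply: filterS JM => n JM.
  have hn := lt0r_neq0 (h0 n).
  have -> : w n ^+ 2 / (v n + (h n)^-1 * (h n)^-1 - w n * (h n)^-1) = (J n)%:R ^+ 2 / ((M n).+1 - J n)%:R.
    have hh : ((M n).+1 - J n)%:R != 0 :> R by rewrite pnatr_eq0; lia.
    move: hh; rewrite natrB; last lia.
    by move=> hh; rewrite /w /v -natr1 in hh *; field; rewrite hh hn.
  have [M0|M0] := eqVneq (M n) 0%N.
    rewrite /w /v M0; have -> : J n = 0%N by lia.
    by rewrite mul0r expr0n /= mul0r !mul0r oppr0 expR0 divff ?lexx // gt_eqF // cbin0_gt0.
  have -> : w n ^+ 2 / (v n + w n * (h n)^-1) = (J n)%:R ^+ 2 / (M n + J n)%:R.
    have hh : (M n + J n)%:R != 0 :> R by rewrite pnatr_eq0; lia.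
    by rewrite natrD /w /v in hh *; field; rewrite hh hn.
  have c0 := cbin0_gt0 (M n).
  by rewrite ler_pdivlMr // ler_pdivrMr // ![expR _ * _]mulrC cbin_lower // cbin_upper.
- apply: cvg_expR; apply: cvgN; apply: cvgM; first by rewrite !expr2; apply: cvgM.
  apply: cvgV; first by rewrite gt_eqF.
  rewrite [X in _ --> X](_ : al = al + 0 * 0 - y * 0); last by ring.
  by apply: cvgB; [apply: cvgD => //; exact: cvgM|exact: cvgM].
- apply: cvg_expR; apply: cvgN; apply: cvgM; first by rewrite !expr2; apply: cvgM.
  apply: cvgV; first by rewrite gt_eqF.
  rewrite [X in _ --> X](_ : al = al + y * 0); last by ring.
  by apply: cvgD => //; exact: cvgM.
Qed.

End LocalLimits.

Section FiniteSubsums.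
Variables (R : realType) (T : choiceType).
Implicit Types (S : set T) (r : seq T).

Lemma esum_ge_seq S (a : T -> \bar R) r : uniq r -> (forall x, x \in r -> S x) ->
  (\sum_(x <- r) a x <= \esum_(x in S) a x)%E.
Proof.
move=> ur rS; apply: esum_ge; exists [set` r]; first by split => //; exact: finite_seq.
by rewrite fsbig_seq.
Qed.

Lemma esum_le_seq S (a : T -> \bar R) b :
  (forall r, uniq r -> (forall x, x \in r -> S x) -> (\sum_(x <- r) a x <= b)%E) ->
  (\esum_(x in S) a x <= b)%E.
Proof.
move=> h; apply: ub_ereal_sup => _ [X [fX XS] <-].
rewrite fsbig_finite //; apply: h; first exact: finmap.fset_uniq.
by move=> x; rewrite in_fset_set // inE => /XS.
Qed.

Lemma esum_ge_fin (I : finType) (P : pred I) (f : I -> T) S (a : T -> R) :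
  {in P &, injective f} -> (forall i, P i -> S (f i)) ->
  ((\sum_(i | P i) a (f i))%:E <= \esum_(x in S) (a x)%:E)%E.
Proof.
move=> fI fS; rewrite -sumEFin -big_enum -(big_map f xpredT (fun x => (a x)%:E)).
apply: esum_ge_seq.
  by rewrite map_inj_in_uniq ?enum_uniq // => i j; rewrite !mem_enum; exact: fI.
move=> y yr; case: (elimT seq.mapP yr) => i; rewrite mem_enum => /fS h ->; exact: h.
Qed.

End FiniteSubsums.

Lemma esum_box (R : realType) (a : int -> R) (s : R) : (forall k, 0 <= a k) ->
  \sum_(i < (2 * N).+1) a (ib i) @[N --> \oo] --> s ->
  \esum_(k in [set: int]) (a k)%:E = s%:E.
Proof.
move=> a0 as_.
have nd : nondecreasing_seq (fun N => \sum_(i < (2 * N).+1) a (ib i)).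
  apply/nondecreasing_seqP => N; rewrite !sum_ib big_ord_recr /= addrA lerDl.
  by rewrite addr_ge0.
apply/eqP; rewrite eq_le; apply/andP; split.
  apply: esum_le_seq => r ur _; rewrite sumEFin lee_fin.
  apply: (@le_trans _ _ (\sum_(i < (2 * (\max_(k <- r) `|k|)).+1) a (ib i))).
    set N := \max_(k <- r) _.
    have -> : \sum_(k <- r) a k = \sum_(i < (2 * N).+1 | ib i \in r) a (ib i).
      rewrite -(big_map (@ib N) (fun k => k \in r) a) [RHS]big_mkcond -big_mkcondr.
      rewrite -[RHS]big_filter; apply: perm_big; apply: uniq_perm => //.
        rewrite filter_uniq // map_inj_uniq ?index_enum_uniq // => i j /addIr[] ij; exact: val_inj.
      move=> k; rewrite mem_filter; case kr : (k \in r) => //=; apply/esym/seq.mapP.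
      have kN : (`|k| <= N)%N by rewrite /N (big_rem k) //= leq_maxl.
      by exists (enc N k); rewrite ?mem_index_enum // encK.
    by rewrite [X in X <= _]big_mkcond; apply: ler_sum => i _; case: ifP.
  rewrite -(cvg_lim (@Rhausdorff R) as_); apply: nondecreasing_cvgn_le => //.
  by apply/cvg_ex; exists s.
have -> : s%:E = ereal_sup (range (fun N => (\sum_(i < (2 * N).+1) a (ib i))%:E)).
  apply: (@cvg_unique _ (@ereal_hausdorff R) ((fun N => (\sum_(i < (2 * N).+1) a (ib i))%:E) @ \oo)).
    by apply: cvg_EFin => //; exact: nearW.
  by apply: ereal_nondecreasing_cvgn => M N MN; rewrite lee_fin nd.
apply: ub_ereal_sup => _ [N _ <-].
by apply: esum_ge_fin => // i j _ _ /addIr[] ij; exact: val_inj.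
Qed.

(** * The edge weight of the Villain model as a theta function *)

Section ThetaDuality.
Variables (R : realType) (beta : R).
Hypothesis beta0 : 0 < beta.
Let p : R := expR (- (2 * beta)^-1).

Lemma wt_expR k : wt p k = expR (- (k%:~R ^+ 2 / (2 * beta))).
Proof.
rewrite /wt /p -expRM_natl natrX natr_absz intr_norm real_normK ?num_real //.
by rewrite mulrN.
Qed.

Lemma wt_cos_le k t : `|wt p k * cos (k%:~R * t)| <= 1 * p ^+ `|k|.
Proof.
have /andP[p0 p1] := villain_p01 beta0.
rewrite normrM ger0_norm ?(wt_ge0 (villain_p01 beta0)) // mul1r.
apply: le_trans (ler_piMr _ (cos_max _)) _; first exact: wt_ge0 (villain_p01 beta0) _.
by apply: ler_wiXn2l; rewrite ?ltW //; case: `|k|%N => [|i] //; rewrite expnS leq_pmulr ?expn_gt0.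
Qed.

Lemma trig_wt_cvg t : cvgn (fun N => trig N (wt p) t).
Proof.
apply: (@box_sum_cvg R (fun k => wt p k * cos (k%:~R * t)) 1 p) => [//||k]; last exact: wt_cos_le.
by have /andP[p0 ->] := villain_p01 beta0; rewrite ltW.
Qed.

Definition theta (t : R) : R := limn (fun N => trig N (wt p) t).

(** With [M] close to [al h^2], the power [cos (k pi / h) ^ (2 M)] tends to [exp (- al pi^2 k^2)],
    which is [p ^ (k^2)] for this [al]; the binomial side then tends to the Gaussians of the Villain
    weight, [jj] being chosen so that [2 pi jj / h] tends to [t]. *)
Let al : R := (2 * pi ^+ 2 * beta)^-1.
Let h (n : nat) : R := (2 * n).+1%:R.
Let M (n : nat) : nat := Num.truncn (al * h n ^+ 2).
Let jj (t : R) (n : nat) : int := Num.floor (t * h n / (2 * pi)).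

Let al0 : 0 < al.
Proof. by rewrite invr_gt0 !mulr_gt0 ?exprn_gt0 ?pi_gt0. Qed.

Let h0 n : 0 < h n. Proof. by rewrite ltr0n. Qed.

Let hoo : (h n)^-1 @[n --> \oo] --> (0 : R).
Proof.
apply: (squeeze_cvgr _ (cvg_cst 0) (@cvg_harmonic R)); apply: nearW => n.
by rewrite invr_ge0 ler0n /= lef_pV2 ?posrE ?ltr0n // ler_nat; lia.
Qed.

Let M_itv n : (M n)%:R <= al * h n ^+ 2 < (M n)%:R + 1.
Proof. by rewrite natr1 truncn_itv // mulr_ge0 ?exprn_ge0 // ltW. Qed.

Let Mh : (M n)%:R / h n ^+ 2 @[n --> \oo] --> al.
Proof.
have lo : al - (h n)^-1 * (h n)^-1 @[n --> \oo] --> al - 0 * 0.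
  by apply: cvgB; [exact: cvg_cst|exact: cvgM].
rewrite mulr0 subr0 in lo.
apply: (squeeze_cvgr _ lo (cvg_cst al)); apply: nearW => n.
have /andP[m1 m2] := M_itv n; have hn := exprn_gt0 2 (h0 n).
rewrite ler_pdivlMr // ler_pdivrMr // m1 andbT mulrBl -invfM -expr2 mulVf ?gt_eqF //.
by lra.
Qed.

Let jh t : (jj t n)%:~R / h n @[n --> \oo] --> t / (2 * pi).
Proof.
have lo : t / (2 * pi) - (h n)^-1 @[n --> \oo] --> t / (2 * pi) - 0 by apply: cvgB => //; exact: cvg_cst.
rewrite subr0 in lo.
apply: (squeeze_cvgr _ lo (cvg_cst _)); apply: nearW => n.
have := floor_itv (t * h n / (2 * pi)); rewrite -/(jj t n) rmorphD /= => /andP[j1 j2].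
have e : t / (2 * pi) * h n = t * h n / (2 * pi) by rewrite mulrAC.
by rewrite ler_pdivlMr // ler_pdivrMr // e j1 andbT mulrBl e mulVf ?gt_eqF //; lra.
Qed.

Let JE t (m : int) n :
  (absz (jj t n + (2 * n).+1%:Z * m))%:R / h n = `|(jj t n)%:~R / h n + m%:~R|.
Proof.
rewrite natr_absz intr_norm -[in LHS](ger0_norm (ltW (h0 n))) -normf_div.
congr (`|_|); rewrite rmorphD rmorphM /= -pmulrn mulrDl; congr (_ + _).
by rewrite mulrAC divff ?mul1r // gt_eqF.
Qed.

Let Jm t (m : int) :
  (absz (jj t n + (2 * n).+1%:Z * m))%:R / h n @[n --> \oo] --> `|t / (2 * pi) + m%:~R|.
Proof.
rewrite (_ : (fun n => _) = (fun n => `|(jj t n)%:~R / h n + m%:~R|)); last by apply/funext => n; exact: JE.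
by apply: cvg_norm; apply: cvgD; [exact: jh|exact: cvg_cst].
Qed.

Let Moo : M n @[n --> \oo] --> \oo.
Proof.
move=> A [k _ kA]; exists (Num.truncn (k.+1%:R / al)).+1 => // n /= kn; apply: kA => /=.
have /andP[_ m2] := M_itv n.
have h1 : 1 <= h n by rewrite ler1n.
have h2 : n%:R <= h n by rewrite ler_nat; lia.
have : k.+1%:R / al < n%:R.
  have /andP[_ h3] := @truncn_itv R (k.+1%:R / al) ltac:(by rewrite divr_ge0 // ltW).
  by apply: lt_le_trans h3 _; rewrite ler_nat.
rewrite ltr_pdivrMr // => h3; rewrite -ltnS -(ltr_nat R) -[X in _ < X]natr1.
have := al0; nra.
Qed.

Lemma cbin_term_cvg t (m : int) :
  cbin R (M n) (jj t n + (2 * n).+1%:Z * m) / cbin R (M n) 0 @[n --> \oo] -->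
  expR (- (beta / 2) * (t + 2 * pi * m%:~R) ^+ 2).
Proof.
have -> : - (beta / 2) * (t + 2 * pi * m%:~R) ^+ 2 = - (`|t / (2 * pi) + m%:~R| ^+ 2 / al).
  rewrite real_normK ?num_real // /al; have pn := lt0r_neq0 (pi_gt0 R); have bn := lt0r_neq0 beta0.
  by move: (pi : R) pn => q qn; field; rewrite qn bn.
have -> : (fun n => cbin R (M n) (jj t n + (2 * n).+1%:Z * m) / cbin R (M n) 0) =
    (fun n => cbin R (M n) (absz (jj t n + (2 * n).+1%:Z * m)) / cbin R (M n) 0).
  by apply/funext => n; rewrite /cbin absz_nat.
exact: (cbin_cvg (J := fun n => absz (jj t n + (2 * n).+1%:Z * m)) al0 h0 hoo Mh (@Jm t m)).
Qed.

Lemma cos_term_cvg k : cos (k%:~R * (pi / (2 * n).+1%:R)) ^+ (2 * M n) @[n --> \oo] --> wt p k.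
Proof.
pose s n := k%:~R * (pi / h n).
have sh : h n * sin (s n) @[n --> \oo] --> k%:~R * pi.
  have d0' : pi / h n @[n --> \oo] --> 0.
    by rewrite -(mulr0 pi); apply: cvgM => //; exact: cvg_cst.
  have d0 : pi / h n @[n --> \oo] --> 0^'.
    move=> A A0; have := d0' _ A0; rewrite /nbhs /=; apply: filterS => n; apply.
    by rewrite mulf_neq0 ?invr_eq0 // gt_eqF ?pi_gt0.
  have -> : (fun n => h n * sin (s n)) = (fun n => sin (k%:~R * (pi / h n)) / (pi / h n) * pi).
    apply/funext => n; rewrite /s; have pn := lt0r_neq0 (pi_gt0 R); have hn := lt0r_neq0 (h0 n).
    by set z := sin _; move: z (pi : R) (h n) pn hn => z q w qn wn; field; rewrite wn qn.
  have h1 : sin (k%:~R * (pi / h n)) / (pi / h n) @[n --> \oo] --> (k%:~R : R).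
    exact: (cvg_comp _ _ d0 (@cvg_sin_quot R k%:~R)).
  exact: (cvgM h1 (cvg_cst _)).
have -> : (fun n => cos (k%:~R * (pi / (2 * n).+1%:R)) ^+ (2 * M n)) = (fun n => (1 - sin (s n) ^+ 2) ^+ M n).
  by apply/funext => n; rewrite exprM cos2sin2.
have -> : wt p k = expR (- (al * (k%:~R * pi) ^+ 2)).
  rewrite wt_expR /al; congr expR; have pn := lt0r_neq0 (pi_gt0 R); have bn := lt0r_neq0 beta0.
  by move: (pi : R) pn => q qn; field; rewrite qn bn.
have sE n : sin (s n) ^+ 2 = ((h n * sin (s n)) * (h n)^-1) ^+ 2 by rewrite [h n * _]mulrC mulfK // gt_eqF.
apply: cvg_one_sub_expr.
  have h1 : h n * sin (s n) * (h n)^-1 @[n --> \oo] --> k%:~R * pi * 0.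
    exact: (cvgM sh hoo).
  rewrite mulr0 in h1.
  have h2 : h n * sin (s n) * (h n)^-1 * (h n * sin (s n) * (h n)^-1) @[n --> \oo] --> (0 * 0 : R).
    exact: (cvgM h1 h1).
  rewrite mulr0 in h2.
  have -> : (fun n => sin (s n) ^+ 2) = (fun n => h n * sin (s n) * (h n)^-1 * (h n * sin (s n) * (h n)^-1)).
    by apply/funext => n; rewrite sE expr2.
  exact: h2.
have -> : (fun n => (M n)%:R * sin (s n) ^+ 2) = (fun n => ((M n)%:R / h n ^+ 2) * ((h n * sin (s n)) * (h n * sin (s n)))).
  by apply/funext => n; field; rewrite gt_eqF.
by rewrite expr2; apply: cvgM => //; apply: cvgM.
Qed.

(** Geometric domination, uniform in [n]. For [J <= M] one has [M + J <= 2 al h^2], and the Gaussian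
    in [z = J / h] is weakened by [z^2 >= 2 z - 1], where [z >= |m| - |t / (2 pi)| - 1]. *)
Lemma cbin_pos_le (m : int) n t : cbin R (M n) (jj t n + (2 * n).+1%:Z * m) / cbin R (M n) 0 <=
  expR ((2 * (`|t / (2 * pi)| + 1) + 1) / (2 * al)) * expR (- al^-1) ^+ `|m|.
Proof.
have c0 := cbin0_gt0 R (M n).
rewrite -expRM_natl -expRD.
set J := absz (jj t n + (2 * n).+1%:Z * m).
have -> : cbin R (M n) (jj t n + (2 * n).+1%:Z * m) = cbin R (M n) J by rewrite /cbin absz_nat.
case: (leqP J (M n)) => JM; last by rewrite cbin_gt ?absz_nat // mul0r expR_ge0.
rewrite ler_pdivrMr //.
apply: le_trans (cbin_upper R JM) _; rewrite mulrC ler_pM2r // ler_expR.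
have jlo : `|m%:~R : R| - `|t / (2 * pi)| - 1 <= J%:R / h n.
  have := floor_itv (t * h n / (2 * pi)); rewrite -/(jj t n) rmorphD /= => /andP[j1 j2].
  rewrite /J JE.
  set x := _ / h n; set y := t / _.
  have xy : `|x - y| <= 1.
    have h1 : 1 <= h n by rewrite ler1n.
    have e : y * h n = t * h n / (2 * pi) by rewrite /y mulrAC.
    have xh : x * h n = (jj t n)%:~R by rewrite divfK // gt_eqF.
    rewrite -[x - y](mulfK (lt0r_neq0 (h0 n))) normf_div (ger0_norm (ltW (h0 n))) ler_pdivrMr // mul1r.
    by rewrite mulrBl xh e ler_norml; apply/andP; split; lra.
  have := ler_normB (x + m%:~R) (x - y); have := ler_normD y m%:~R.
  have := ler_normB (y + m%:~R) y; rewrite addrAC subrr add0r.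
  have -> : x + m%:~R - (x - y) = y + m%:~R by ring.
  by move: xy; lra.
have /andP[m1 _] := M_itv n.
have [J0|J0] := posnP J.
  rewrite J0 mul0r in jlo; rewrite J0 expr0n /= mul0r oppr0 natr_absz intr_norm.
  have -> : (2 * (`|t / (2 * pi)| + 1) + 1) / (2 * al) + `|m%:~R| * - al^-1 =
    ((`|t / (2 * pi)| + 1 - `|m%:~R|) + 1 / 2) / al by field; rewrite gt_eqF.
  by rewrite divr_ge0 ?(ltW al0) //; lra.
have MJ : 0 < (M n + J)%:R :> R by rewrite ltr0n; lia.
have : (J%:R / h n) ^+ 2 / (2 * al) <= J%:R ^+ 2 / (M n + J)%:R.
  rewrite expr_div_n -mulrA -invfM ler_wpM2l ?exprn_ge0 // lef_pV2 ?posrE ?mulr_gt0 ?exprn_gt0 //.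
  rewrite natrD; have : J%:R <= (M n)%:R :> R by rewrite ler_nat.
  by move: m1; nra.
move=> h1; apply: le_trans (_ : - ((J%:R / h n) ^+ 2 / (2 * al)) <= _); first by rewrite lerN2.
rewrite [(absz m)%:R]natr_absz intr_norm.
have -> : (2 * (`|t / (2 * pi)| + 1) + 1) / (2 * al) + `|m%:~R| * - al^-1 =
    ((2 * (`|t / (2 * pi)| + 1) + 1) - 2 * `|m%:~R|) / (2 * al) by field; rewrite gt_eqF.
rewrite -mulNr ler_wpM2r ?invr_ge0 ?mulr_ge0 ?(ltW al0) //.
by have := sqr_ge0 (J%:R / h n - 1); rewrite sqrrB1; move: jlo; move: (J%:R / h n) `|m%:~R : R| `|t / (2 * pi)| => z x y; lra.
Qed.

(** From [cos^2 u <= exp (- sin^2 u)] and [sin u >= u / 2 >= K / h], where [pi >= 2]; the square of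
    [K] is then weakened to [K]. *)
Lemma cos_pos_le k n : (`|k| <= n)%N -> al / 2 * h n ^+ 2 <= (M n)%:R ->
  cos (k%:~R * (pi / (2 * n).+1%:R)) ^+ (2 * M n) <= expR (- (al / 2)) ^+ `|k|.
Proof.
move=> kn mn; rewrite -cos_norm normrM [`|pi / _|]ger0_norm ?divr_ge0 ?pi_ge0 //.
rewrite -intr_norm -natr_absz; set K := `|k|%N; set u := _ * _.
have p0 := pi_gt0 R; have p2 := pi_ge2 R.
have uh : u * h n = K%:R * pi by rewrite /u mulrA divfK // gt_eqF.
have Kh : 2 * K%:R <= h n by rewrite -natrM ler_nat; lia.
have u01 : 0 <= u <= pi / 2.
  rewrite mulr_ge0 ?divr_ge0 ?ler0n ?(ltW p0) //= -(ler_pM2r (h0 n)) uh; nra.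
have su := half_le_sin u01.
have sK : K%:R / h n <= sin u.
  apply: le_trans su; rewrite /u ler_pdivrMr //.
  have -> : K%:R * (pi / (2 * n).+1%:R) / 2 * h n = K%:R * (pi / 2) by rewrite -/(h n); field; rewrite gt_eqF.
  by rewrite ler_peMr ?ler0n //; lra.
rewrite exprM cos2sin2 -expRM_natl.
apply: le_trans (_ : expR (- sin u ^+ 2) ^+ M n <= _).
  rewrite lerXn2r ?nnegrE ?expR_ge0 ?expR_ge1Dx // -cos2sin2 sqr_ge0 //.
rewrite -expRM_natl ler_expR !mulrN lerN2.
have [K0|K0] := posnP K; first by rewrite K0 mul0r mulr_ge0 ?sqr_ge0.
have q0 : 0 <= K%:R / h n by rewrite divr_ge0 // ltW.
apply: le_trans (_ : al / 2 * h n ^+ 2 * (K%:R / h n) ^+ 2 <= _).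
  have -> : al / 2 * h n ^+ 2 * (K%:R / h n) ^+ 2 = K%:R * K%:R * (al / 2) by field; rewrite gt_eqF.
  rewrite ler_wpM2r ?divr_ge0 ?(ltW al0) // ler_peMr ?ler0n // ler1n //.
apply: ler_pM => //; rewrite ?mulr_ge0 ?divr_ge0 ?exprn_ge0 ?(ltW al0) ?invr_ge0 ?(ltW (h0 n)) ?ler0n //.
by rewrite lerXn2r ?nnegrE ?(le_trans q0).
Qed.

Let S t n : R := \sum_(i < (2 * (M n + `|jj t n|)).+1) cbin R (M n) (jj t n + (2 * n).+1%:Z * ib i) / cbin R (M n) 0.
Let T t n : R := \sum_(i < (2 * n).+1) cos ((ib i)%:~R * (pi / (2 * n).+1%:R)) ^+ (2 * M n) *
    cos ((ib i)%:~R * (2 * ((jj t n)%:~R * pi / (2 * n).+1%:R))).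

Let TS t n : 2 ^+ (2 * M n) * T t n = (2 * n).+1%:R * cbin R (M n) 0 * S t n.
Proof.
have E := @finite_poisson R (M n) n (jj t n).
have -> : S t n = (\sum_(i < (2 * (M n + `|jj t n|)).+1) cbin R (M n) (jj t n + (2 * n).+1%:Z * ib i)) / cbin R (M n) 0.
  by rewrite /S mulr_suml.
rewrite -[RHS]mulrA [cbin R (M n) 0 * _]mulrC divfK; last by rewrite gt_eqF // cbin0_gt0.
rewrite -E /T mulr_sumr; apply: eq_bigr => i _; rewrite mulrA -exprMn //.
Qed.

Let T_cvg t : T t n @[n --> \oo] --> theta t.
Proof.
apply: (@tannery R (fun n k => cos (k%:~R * (pi / (2 * n).+1%:R)) ^+ (2 * M n) *
    cos (k%:~R * (2 * ((jj t n)%:~R * pi / (2 * n).+1%:R)))) (fun k => wt p k * cos (k%:~R * t)) 1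
    (expR (- (al / 2))) (theta t) id) => //.
- by rewrite expR_ge0 expR_lt1 oppr_lt0 divr_gt0.
- have al2 : 0 < al / 2 by rewrite divr_gt0.
  have := Mh => /cvgrPdist_lt/(_ _ al2); apply: filterS => n.
  rewrite ltr_norml => /andP[_ hn] k kn.
  have mn : al / 2 * h n ^+ 2 <= (M n)%:R.
    by rewrite -ler_pdivlMr ?exprn_gt0 //; move: hn; move: ((M n)%:R / h n ^+ 2) al => z a; lra.
  rewrite mul1r normrM; apply: le_trans (ler_piMr _ (cos_max _)) _ => //.
  by rewrite ger0_norm ?cos_pos_le // exprM exprn_ge0 // sqr_ge0.
- move=> k; apply: cvgM; first exact: cos_term_cvg.
  have h1 : k%:~R * (2 * ((jj t n)%:~R * pi / (2 * n).+1%:R)) @[n --> \oo] --> k%:~R * t.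
    have -> : k%:~R * t = t / (2 * pi) * (k%:~R * (2 * pi)).
      by rewrite mulrCA divfK // mulf_neq0 // gt_eqF // pi_gt0.
    have -> : (fun n => k%:~R * (2 * ((jj t n)%:~R * pi / (2 * n).+1%:R))) =
      (fun n => (jj t n)%:~R / h n * (k%:~R * (2 * pi))) by apply/funext => n; rewrite /h; ring.
    exact: (cvgM (@jh t) (cvg_cst _)).
  exact: (@continuous_cvg _ _ _ _ _ _ (@cos R) _ (@continuous_cos R _) h1).
- exact: trig_wt_cvg.
Qed.

Let G t (m : int) : R := expR (- (beta / 2) * (t + 2 * pi * m%:~R) ^+ 2).
Let B t : R := expR ((2 * (`|t / (2 * pi)| + 1) + 1) / (2 * al)).

Let r01 : 0 <= expR (- al^-1) < 1.
Proof. by rewrite expR_ge0 expR_lt1 oppr_lt0 invr_gt0. Qed.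

Let G_cvg t : cvgn (fun N => \sum_(i < (2 * N).+1) G t (ib i)).
Proof.
apply: (@box_sum_cvg R (G t) (B t) (expR (- al^-1))) => //; first exact: expR_ge0.
move=> m; rewrite ger0_norm ?expR_ge0 //.
by apply: cvgr_to_le (@cbin_term_cvg t m) _; apply: nearW => n; exact: cbin_pos_le.
Qed.

Lemma villain_edge_cvg t : \sum_(i < (2 * N).+1) G t (ib i) @[N --> \oo] --> villain_edge beta t.
Proof.
rewrite /villain_edge (@esum_box R (G t) (limn (fun N => \sum_(i < (2 * N).+1) G t (ib i)))) //.
by move=> k; exact: expR_ge0.
Qed.

Let S_cvg t : S t n @[n --> \oo] --> villain_edge beta t.
Proof.
apply: (@tannery R (fun n k => cbin R (M n) (jj t n + (2 * n).+1%:Z * k) / cbin R (M n) 0) (G t) (B t)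
    (expR (- al^-1)) _ (fun n => (M n + `|jj t n|)%N)) => //.
- exact: expR_ge0.
- apply: nearW => n k _; rewrite ger0_norm ?cbin_pos_le //.
  by rewrite divr_ge0 ?ler0n.
- by move=> k; exact: cbin_term_cvg.
- move=> A [k _ kA]; have [k' _ hk] := Moo (ex_intro2 _ _ k I (fun i (h : (k <= i)%N) => h)).
  by exists k' => // n /hk /= kn; apply: kA => /=; exact: leq_trans kn (leq_addr _ _).
- exact: villain_edge_cvg.
Qed.

(** In [TS] the two sides differ by a prefactor independent of [t]; comparing with [t = 0]
    eliminates it, and its asymptotics are never computed. *)
Lemma villain_edge_theta t : villain_edge beta t * theta 0 = villain_edge beta 0 * theta t.
Proof.
have TSn n : S t n * T 0 n = S 0 n * T t n.
  have q0 : (2 * n).+1%:R * cbin R (M n) 0 != 0.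
    by apply/lt0r_neq0/mulr_gt0; [exact: h0|exact: cbin0_gt0].
  have w0 : 2 ^+ (2 * M n) != 0 :> R by rewrite expf_neq0.
  apply: (mulfI q0); apply: (mulfI w0).
  have := TS 0 n; have := TS t n; move: (S t n) (S 0 n) (T t n) (T 0 n) (_ * cbin R (M n) 0) (2 ^+ _).
  move=> s s0 u u0 q w eu eu0.
  by transitivity ((w * u0) * (q * s)); [ring|rewrite eu0 -eu; ring].
apply: (@cvg_unique _ (@Rhausdorff R) ((fun n => S t n * T 0 n) @ \oo)).
  exact: (cvgM (@S_cvg t) (@T_cvg 0)).
rewrite (_ : (fun n => S t n * T 0 n) = (fun n => S 0 n * T t n)); last exact/funext.
exact: (cvgM (@S_cvg 0) (@T_cvg t)).
Qed.

Lemma theta0_gt0 : 0 < theta 0.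
Proof.
apply: (@lt_le_trans _ _ 1) => //; apply: cvgr_to_ge (@trig_wt_cvg 0) _; apply: nearW => N.
rewrite /trig (sum_ib N (fun k => wt p k * cos (k%:~R * 0))) mul0r cos0 mulr1 /wt absz0 expr0 lerDl.
by apply: sumr_ge0 => j _; rewrite !mulr0 cos0 !mulr1 addr_ge0 // exprn_ge0 ?expR_ge0.
Qed.

Lemma villain_edge0_gt0 : 0 < villain_edge beta 0.
Proof.
apply: (@lt_le_trans _ _ (G 0 0)); first exact: expR_gt0.
apply: cvgr_to_ge (@villain_edge_cvg 0) _; apply: nearW => N.
by rewrite (sum_ib N (G 0)) lerDl sumr_ge0 // => j _; rewrite addr_ge0 ?expR_ge0.
Qed.

Definition edge_const : R := villain_edge beta 0 / theta 0.

Lemma edge_const_gt0 : 0 < edge_const.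
Proof. by rewrite divr_gt0 ?villain_edge0_gt0 ?theta0_gt0. Qed.

Lemma villain_edgeE t : villain_edge beta t = edge_const * theta t.
Proof. by rewrite /edge_const mulrAC -villain_edge_theta mulfK // gt_eqF // theta0_gt0. Qed.

Lemma theta_approx t N : `|theta t - trig N (wt p) t| <= 2 / (1 - p) * p ^+ N.
Proof.
have /andP[p0 p1] := villain_p01 beta0.
have c : `|trig K (wt p) t - trig N (wt p) t| @[K --> \oo] --> `|theta t - trig N (wt p) t|.
  by apply: cvg_norm; apply: cvgB; [exact: trig_wt_cvg|exact: cvg_cst].
apply: cvgr_to_le c _; exists N => // K /= NK; rewrite -{1}[2]mulr1.
apply: (@box_tail_le R (fun k => wt p k * cos (k%:~R * t)) 1 p) => [//||//|k _]; last exact: wt_cos_le.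
by rewrite p1 ltW.
Qed.

Lemma theta_unif e : 0 < e -> exists N0, forall N t, (N0 <= N)%N -> `|theta t - trig N (wt p) t| < e.
Proof.
move=> e0; have /andP[p0 p1] := villain_p01 beta0.
have p01 : 0 <= p < 1 by rewrite p1 ltW.
have /cvgrPdist_lt/(_ _ e0)[N0 _ h1] := cvg_geometric0 (2 / (1 - p)) p01; exists N0 => N t NN.
apply: le_lt_trans (theta_approx t N) _.
by have := h1 N NN; rewrite sub0r normrN; apply: le_lt_trans; exact: ler_norm.
Qed.

End ThetaDuality.

(** * Integration over the angles *)

Section CircleIntegral.
Variable R : realType.
Local Notation mu := (@lebesgue_measure R).
Local Notation circle := ([set` `[(- pi : R), pi[]).

Lemma mu_circle : mu circle = (2 * pi)%:E.
Proof.
rewrite lebesgue_measure_itv /= lte_fin ifT; last by have := pi_gt0 R; lra.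
by rewrite -EFinB; congr EFin; lra.
Qed.

Lemma circle_integrable (f : R -> R) (B : R) : measurable_fun circle f ->
  (forall t, `|f t| <= B) -> mu.-integrable circle (EFin \o f).
Proof.
move=> mf fB; apply: measurable_bounded_integrable => //.
  by rewrite [X in (X < _)%E]mu_circle ltry.
by exists B; split; [exact: num_real|move=> x Bx t _ /=; exact: le_trans (fB t) (ltW Bx)].
Qed.

Lemma circle_integral_approx (f g : R -> R) (B e : R) :
  measurable_fun circle f -> measurable_fun circle g ->
  (forall t, `|f t| <= B) -> (forall t, `|g t| <= B) -> (forall t, `|f t - g t| <= e) ->
  `|\int[mu]_(t in circle) f t - \int[mu]_(t in circle) g t| <= 2 * pi * e.
Proof.
move=> mf mg fB gB fg.
have If := circle_integrable mf fB; have Ig := circle_integrable mg gB.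
rewrite -RintegralB //.
have mfg : measurable_fun circle (fun t => f t - g t) by exact: measurable_funB.
have Ifg : mu.-integrable circle (EFin \o (fun t => f t - g t)) by exact: circle_integrable mfg fg.
apply: le_trans (le_normr_Rintegral _ Ifg) _ => //.
have -> : 2 * pi * e = \int[mu]_(t in circle) e.
  by rewrite Rintegral_cst // [X in fine X]mu_circle mulrC.
apply: le_Rintegral => //.
- by apply: (@circle_integrable (fun t => `|f t - g t|) e) => [|t]; [exact: measurableT_comp|rewrite normr_id].
- by apply: (@circle_integrable _ `|e|).
Qed.

Lemma continuous_circle (f : R -> R) : continuous f -> measurable_fun circle f.
Proof. by move=> cf; apply: measurable_funTS; exact: continuous_measurable_fun. Qed.

Lemma continuous_cos_affine (k r : R) : continuous (fun t : R => cos (k * t + r)).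
Proof.
move=> t; apply: (@continuous_comp _ _ _ (fun t : R => k * t + r) (@cos R)); last exact: continuous_cos.
by apply: cvgD; [apply: cvgM; [exact: cvg_cst|exact: cvg_id]|exact: cvg_cst].
Qed.

Lemma circle_integral_cos (k : int) (r : R) :
  \int[mu]_(t in circle) cos (k%:~R * t + r) = (if k == 0 then 2 * pi else 0) * cos r.
Proof.
case: eqP => [->|/eqP k0].
  under eq_Rintegral do rewrite mul0r add0r.
  by rewrite Rintegral_cst // [X in fine X]mu_circle mulrC.
have cf := @continuous_cos_affine k%:~R r.
rewrite mul0r Rintegral_itv_bndo_bndc; last first.
  apply: (@circle_integrable _ 1) => [|t]; [exact: continuous_circle|exact: cos_max].
have k0' : k%:~R != 0 :> R by rewrite intr_eq0.
pose F (t : R) : R := k%:~R^-1 * sin (k%:~R * t + r).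
have dF (t : R) : is_derive t 1 F (cos (k%:~R * t + r)).
  have h1 : is_derive t 1 (fun t : R => k%:~R * t + r) (k%:~R).
    by apply: is_derive_eq; rewrite /GRing.scale /= mulr1 addr0.
  have h2 := @is_derive1_comp R (@sin R) (fun t => k%:~R * t + r) t _ _ (is_derive_sin _) h1.
  apply: is_derive_eq.
  by rewrite /GRing.scale /= mulrCA mulVf // mulr1.
rewrite /Rintegral (@continuous_FTC2 R _ F).
- rewrite -EFinB /= /F mulrN -mulrBr.
  have -> : k%:~R * pi + r = (- (k%:~R * pi) + r) + (2 * k)%:~R * pi by rewrite rmorphM /=; ring.
  by rewrite sinD sin_int_pi cos_int_pi abszM exprM sqrrN expr1n expr1n mulr1 mulr0 addr0 subrr mulr0.
- by have := pi_gt0 R; lra.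
- exact: continuous_subspaceT.
- have cF : continuous F by move=> t; apply: differentiable_continuous; apply/derivable1_diffP; case: (dF t).
  split; [by move=> t _; case: (dF t)| |].
    exact/cvg_at_right_filter/cF.
  exact/cvg_at_left_filter/cF.
- by move=> t _; rewrite derive1E; case: (dF t).
Qed.

Lemma circle_integral_trig (I : Type) (s : seq I) (a r : I -> R) (k : I -> int) :
  \int[mu]_(t in circle) (\sum_(i <- s) a i * cos ((k i)%:~R * t + r i)) =
  \sum_(i <- s) a i * ((if k i == 0 then 2 * pi else 0) * cos (r i)).
Proof.
elim: s => [|i s IH].
  by under eq_Rintegral do rewrite big_nil; rewrite big_nil Rintegral_cst // mul0r.
under eq_Rintegral do rewrite big_cons.
have mc j : measurable_fun circle (fun t : R => a j * cos ((k j)%:~R * t + r j)).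
  by apply: measurable_funM => //; apply: continuous_circle; exact: continuous_cos_affine.
have I1 j : mu.-integrable circle (EFin \o (fun t => cos ((k j)%:~R * t + r j))).
  apply: (@circle_integrable _ 1) => [|t]; last exact: cos_max.
  by apply: continuous_circle; exact: continuous_cos_affine.
rewrite big_cons -IH -circle_integral_cos -RintegralZl // RintegralD //.
  apply: (@circle_integrable _ `|a i|) => // t.
  by rewrite normrM ler_piMr // cos_max.
apply: (@circle_integrable _ (\sum_(i <- s) `|a i|)) => [|t].
  by apply: measurable_sum => j; exact: mc.
apply: le_trans (ler_norm_sum _ _ _) _; apply: ler_sum => j _.
by rewrite normrM ler_piMr // cos_max.
Qed.

End CircleIntegral.

Section TrigonometricPolynomials.
Variables (R : realType) (L : nat).
Local Notation V := (site L).
Implicit Types (S : seq (R * (V -> int))) (th : V -> R) (s : seq V).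
Local Notation mu := (@lebesgue_measure R).
Local Notation circle := ([set` `[(- pi : R), pi[]).

Definition tpoly S th : R := \sum_(x <- S) x.1 * cos (\sum_v (x.2 v)%:~R * th v).

Definition avg s (d : V -> int) : R := \prod_(v <- s) (if d v == 0 then 2 * pi else 0).

Lemma tpoly_with S th v t : tpoly S [eta th with v |-> t] =
  \sum_(x <- S) x.1 * cos ((x.2 v)%:~R * t + \sum_(u | u != v) (x.2 u)%:~R * th u).
Proof.
apply: eq_bigr => x _; congr (_ * cos _); rewrite (bigD1 v) //= eqxx; congr (_ + _).
by apply: eq_bigr => u /negbTE uv; rewrite uv.
Qed.

Lemma angle_tpoly s S th : angle_integral s (tpoly S) th = tpoly [seq (x.1 * avg s x.2, x.2) | x <- S] th.
Proof.
elim: s th => [|v s IH] th /=.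
  by rewrite /tpoly big_map; apply: eq_bigr => x _ /=; rewrite /avg big_nil mulr1.
under eq_Rintegral do rewrite IH tpoly_with.
rewrite circle_integral_trig /tpoly !big_map; apply: eq_bigr => x _ /=.
rewrite /avg big_cons -/(avg s x.2) -!mulrA; congr (_ * _); rewrite [RHS]mulrCA; congr (_ * _).
case: eqP => [x0|_]; last by rewrite !mul0r.
by rewrite [in RHS](bigD1 v) //= x0 mul0r add0r.
Qed.

Lemma tpoly_le S th : `|tpoly S th| <= \sum_(x <- S) `|x.1|.
Proof.
apply: le_trans (ler_norm_sum _ _ _) _; apply: ler_sum => j _.
by rewrite normrM ler_piMr // cos_max.
Qed.

Lemma measurable_tpoly_with S th v : measurable_fun circle (fun t => tpoly S [eta th with v |-> t]).
Proof.
have -> : (fun t => tpoly S [eta th with v |-> t]) = (fun t => \sum_(x <- S)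
    x.1 * cos ((x.2 v)%:~R * t + \sum_(u | u != v) (x.2 u)%:~R * th u)).
  by apply/funext => t; exact: tpoly_with.
apply: measurable_sum => x.
by apply: measurable_funM => //; apply: continuous_circle; exact: continuous_cos_affine.
Qed.

(** The partially integrated [F] is measurable as a pointwise limit of trigonometric polynomials,
    which [angle_tpoly] keeps in this class. A uniform error grows by a factor [2 pi] for each
    variable. *)
Lemma angle_integral_approx (F : (V -> R) -> R) (S : nat -> seq (R * (V -> int))) :
  (forall e, 0 < e -> exists N, forall n th, (N <= n)%N -> `|F th - tpoly (S n) th| <= e) ->
  forall s e, 0 < e -> exists N, forall n th, (N <= n)%N ->
    `|angle_integral s F th - angle_integral s (tpoly (S n)) th| <= e.
Proof.
move=> FS; elim=> [|v s IH] e e0 /=; first exact: FS.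
have p0 : 0 < 2 * pi :> R by rewrite mulr_gt0 ?pi_gt0.
have [N hN] := IH (e / (2 * pi)) (divr_gt0 e0 p0).
exists N => n th Nn.
pose Sn n := [seq (x.1 * avg s x.2, x.2) | x <- S n].
have TE n' : angle_integral s (tpoly (S n')) = tpoly (Sn n') by apply/funext => th'; rewrite angle_tpoly.
pose B := \sum_(x <- Sn n) `|x.1| + e / (2 * pi).
have -> : e = 2 * pi * (e / (2 * pi)) by rewrite mulrC divfK // gt_eqF.
apply: (@circle_integral_approx R _ _ B).
- apply: (@measurable_fun_cvg _ _ _ _ (fun n t => tpoly (Sn n) [eta th with v |-> t])).
    by move=> m; exact: measurable_tpoly_with.
  move=> t _; apply/cvgrPdist_le => e' e0'; have [N' hN'] := IH _ e0'.
  by exists N' => // m /= Nm; rewrite -TE; exact: hN'.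
- by rewrite TE; exact: measurable_tpoly_with.
- move=> t; set z := angle_integral s F _.
  have := hN n [eta th with v |-> t] Nn; rewrite TE -/z.
  have := tpoly_le (Sn n) [eta th with v |-> t]; rewrite /B.
  move: (tpoly _ _) => y h1 h2; rewrite -[z](subrK y).
  by apply: le_trans (ler_normD _ _) _; rewrite addrC lerD.
- move=> t; rewrite TE; apply: le_trans (tpoly_le _ _) _.
  by rewrite lerDl ltW // divr_gt0.
- by move=> t; exact: hN.
Qed.

Lemma spin_tpoly S : spin_integral (tpoly S) =
  (2 * pi) ^+ #|{: V}| * \sum_(x <- S | [forall v, x.2 v == 0]) x.1.
Proof.
rewrite /spin_integral angle_tpoly /tpoly big_map [in RHS]big_mkcond mulr_sumr; apply: eq_bigr => x _ /=.
rewrite big1; last by move=> v _; rewrite mulr0.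
rewrite cos0 mulr1 /avg; case: ifP => [/forallP x0|/negbT/forallPn[v xv]].
  rewrite (eq_bigr (fun=> 2 * pi)) => [|v _]; last by rewrite x0.
  by rewrite big_const_seq count_predT -cardE iter_mulr_1 mulrC.
rewrite (bigD1_seq v) /= ?mem_enum ?enum_uniq // (negbTE xv).
by rewrite mul0r !mulr0.
Qed.

Lemma spin_integral_cvg (F : (V -> R) -> R) (S : nat -> seq (R * (V -> int))) (z : R) :
  (forall e, 0 < e -> exists N, forall n th, (N <= n)%N -> `|F th - tpoly (S n) th| <= e) ->
  \sum_(x <- S n | [forall v, x.2 v == 0]) x.1 @[n --> \oo] --> z ->
  spin_integral F = (2 * pi) ^+ #|{: V}| * z.
Proof.
move=> FS Sz; apply: (@cvg_unique _ (@Rhausdorff R) ((fun n => spin_integral (tpoly (S n))) @ \oo)).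
  apply/cvgrPdist_le => e e0; have [N hN] := angle_integral_approx FS (enum {: V}) e0.
  by exists N => // n /= Nn; exact: hN.
rewrite (_ : (fun n => spin_integral (tpoly (S n))) = (fun n => (2 * pi) ^+ #|{: V}| *
    \sum_(x <- S n | [forall v, x.2 v == 0]) x.1)).
  exact: (cvgM (cvg_cst _) Sz).
by apply/funext => n; exact: spin_tpoly.
Qed.

End TrigonometricPolynomials.

Lemma prod_approx (R : realFieldType) (I : Type) (r : seq I) (a b : I -> R) (B d : R) :
  1 <= B -> (forall i, `|a i| <= B) -> (forall i, `|b i| <= B) -> (forall i, `|a i - b i| <= d) ->
  `|\prod_(i <- r) a i - \prod_(i <- r) b i| <= (size r)%:R * B ^+ size r * d.
Proof.
move=> B1 aB bB ab; have B0 : 0 <= B by apply: le_trans B1.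
elim: r => [|i r IH]; first by rewrite !big_nil subrr normr0 !mul0r.
have d0 : 0 <= d by apply: le_trans (ab i).
rewrite !big_cons.
have -> : a i * \prod_(j <- r) a j - b i * \prod_(j <- r) b j =
   a i * (\prod_(j <- r) a j - \prod_(j <- r) b j) + (a i - b i) * \prod_(j <- r) b j by ring.
apply: le_trans (ler_normD _ _) _; rewrite !normrM /= -natr1 exprS.
have -> : ((size r)%:R + 1) * (B * B ^+ size r) * d =
  B * ((size r)%:R * B ^+ size r * d) + d * (B * B ^+ size r) by ring.
apply: lerD; apply: ler_pM => //.
apply: le_trans (_ : B ^+ size r <= _); last by rewrite ler_peMl ?exprn_ge0.
rewrite normr_prod; elim: r {IH} => [|j r IH] /=; first by rewrite big_nil expr0.
by rewrite big_cons exprS ler_pM ?prodr_ge0.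
Qed.

(** * Flow expansion of the two-point function *)

Section FlowLimit.
Variables (R : realType) (p : R) (E : finType).
Hypothesis p01 : 0 < p < 1.

Lemma Zsup_cvg (Q : (E -> int) -> bool) : (forall k k', k =1 k' -> Q k = Q k') ->
  \sum_(k : flow E N | Q (fval k)) \prod_e wt p (fval k e) @[N --> \oo] --> Zsup p Q.
Proof.
move=> Qext; set u := fun N => _.
have -> : Zsup p Q = sup (range u).
  by congr sup; apply/seteqP; split=> [_ [N ->]|_ [N _ <-]]; exists N.
apply: nondecreasing_cvgn; last by exists (Zsup p Q) => _ [N _ <-]; exact: Zsup_ge.
move=> M N MN; rewrite /u.
have fE (k : flow E M) : fval [ffun e => enc N (fval k e)] =1 fval k.
  by move=> e; rewrite /fval ffunE encK //; apply: leq_trans (norm_ib _) MN.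
apply: (@ler_sum_inj R _ _ (fun k : flow E M => [ffun e => enc N (fval k e)])).
- move=> k k' _ _ kk; apply: fval_inj => e.
  by rewrite -(fE k) -(fE k') kk.
- by move=> k; rewrite (Qext _ _ (fE k)).
- by move=> k _; apply: prodr_ge0 => e _; exact: wt_ge0.
- by move=> k _; apply: ler_prod => e _; rewrite fE wt_ge0 //= lexx.
Qed.

Lemma prod_trig_cos (V : finType) (src tgt : E -> V) N (a : V -> R) :
  \prod_e trig N (wt p) (a (src e) - a (tgt e)) =
  \sum_(k : flow E N) (\prod_e wt p (fval k e)) * cos (\sum_v (sdiv src tgt pred0 (fval k) v)%:~R * a v).
Proof.
have wN k : wt p (- k) = wt p k by rewrite /wt abszN.
have := @prod_trig R V E src tgt N (wt p) pred0 a wN.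
move=> /(congr1 (@complex.Re R)); rewrite Re_sum => h; rewrite -[LHS]/(complex.Re (_%:C%C)) h.
by apply: eq_bigr => k _; rewrite Re_realM -expi_sum.
Qed.

End FlowLimit.

Section TwoPoint.
Variables (R : realType) (beta : R) (L : nat).
Hypothesis beta0 : 0 < beta.
Local Notation V := (site L).
Local Notation E := (edge L).
Local Notation p := (expR (- (2 * beta)^-1) : R).
Local Notation dv := (sdiv (@esrc L) (@etgt L) pred0).
Local Notation ZZ := (Z0 p (@esrc L) (@etgt L)).
Let p01 := villain_p01 beta0.
Let c := edge_const beta.
Let ce : R := c ^+ #|{: E}|.

Lemma villain_densityE (th : V -> R) :
  villain_density beta th = ce * \prod_(e : E) theta beta (th (esrc e) - th (etgt e)).
Proof.
rewrite /villain_density big_sub /=; under eq_bigr do rewrite villain_edgeE //.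
by rewrite big_split /= prodr_const.
Qed.

Lemma density_approx e : 0 < e -> exists N0, forall N (th : V -> R), (N0 <= N)%N ->
  `|villain_density beta th - ce * \prod_(e : E) trig N (wt p) (th (esrc e) - th (etgt e))| <= e.
Proof.
move=> e0; have [p0 p1] := andP p01.
have q0 : 0 <= 2 / (1 - p) by rewrite divr_ge0 // subr_ge0 ltW.
have ce0 : 0 < ce by rewrite exprn_gt0 // edge_const_gt0.
pose B := 1 + 2 / (1 - p) + 2 / (1 - p).
have thB t : `|theta beta t| <= 1 + 2 / (1 - p).
  have := theta_approx beta0 t 0; rewrite expr0 mulr1 /trig (sum_ib 0 (fun k => wt p k * cos (k%:~R * t))).
  rewrite big_ord0 addr0 mul0r cos0 mulr1 /wt absz0 expr0 => h.
  rewrite -[theta beta t](subrK 1) [leRHS]addrC; apply: le_trans (ler_normD _ _) _.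
  by rewrite normr1 lerD2r.
have trB N t : `|trig N (wt p) t| <= B.
  have := theta_approx beta0 t N; have := thB t; rewrite /B; move: (theta beta t) (trig _ _ _) => x y h1 h2.
  have : 2 / (1 - p) * p ^+ N <= 2 / (1 - p) by rewrite ler_piMr // exprn_ile1 ?ltW.
  have := ler_normB x (x - y); rewrite (_ : x - (x - y) = y); last by ring.
  by move: h1 h2; lra.
have thB' t : `|theta beta t| <= B by apply: le_trans (thB t) _; rewrite /B lerDl.
have B1 : 1 <= B by rewrite /B; lra.
pose C := ce * ((size (index_enum E))%:R * B ^+ size (index_enum E)) + 1.
have C0 : 0 < C.
  by rewrite ltr_wpDl // mulr_ge0 ?(ltW ce0) // mulr_ge0 ?ler0n // exprn_ge0 // (le_trans ler01).
have [N0 hN] := theta_unif beta0 (divr_gt0 e0 C0).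
exists N0 => N th NN; rewrite villain_densityE -mulrBr normrM (gtr0_norm ce0).
have := @prod_approx R E (index_enum E) (fun e => theta beta (th (esrc e) - th (etgt e)))
  (fun e => trig N (wt p) (th (esrc e) - th (etgt e))) B (e / C) B1 (fun _ => thB' _) (fun _ => trB _ _)
  (fun _ => ltW (hN _ _ NN)).
move=> h; apply: le_trans (ler_wpM2l (ltW ce0) h) _.
rewrite mulrA; apply: le_trans (_ : C * (e / C) <= _); last by rewrite mulrC divfK // gt_eqF.
by rewrite ler_wpM2r ?divr_ge0 ?(ltW e0) ?(ltW C0) // /C lerDl.
Qed.

Let S N : seq (R * (V -> int)) := [seq (ce * \prod_e wt p (fval k e), dv (fval k)) | k <- index_enum (flow E N)].

Lemma spin_density : spin_integral (@villain_density R L beta) =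
  (2 * pi) ^+ #|{: V}| * (ce * ZZ).
Proof.
apply: (@spin_integral_cvg R L _ S).
  move=> e e0; have [N0 hN] := density_approx e0; exists N0 => N th NN.
  rewrite (_ : tpoly (S N) th = ce * \prod_e trig N (wt p) (th (esrc e) - th (etgt e))); first exact: hN.
  rewrite prod_trig_cos mulr_sumr /tpoly /S big_map; apply: eq_bigr => k _ /=.
  by rewrite mulrA.
have h : \sum_(k : flow E N | [forall v, dv (fval k) v == 0]) \prod_e wt p (fval k e) @[N --> \oo] -->
   ZZ.
  apply: (Zsup_cvg p01) => k k' kk; apply: eq_forallb => v; rewrite (sdiv_ext _ _ _ _ kk) //.
rewrite (_ : (fun n => _) = (fun N => ce * \sum_(k : flow E N | [forall v, dv (fval k) v == 0]) \prod_e wt p (fval k e))).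
  exact: (cvgM (cvg_cst _) h).
by apply/funext => N; rewrite /S big_map mulr_sumr.
Qed.

Variables x y : V.
Hypothesis xy : x != y.

Local Notation Zd := (Zdip p (@esrc L) (@etgt L) x y 1).
Local Notation off := (offxy (@esrc L) (@etgt L) x y).

(** Multiplying by [cos (th x - th y)] shifts the frequencies by plus or minus the dipole, each with
    weight one half. *)
Let dl (b : bool) (v : V) : int := (if b then 1 else -1) * ((v == x)%:R - (v == y)%:R).
Let S' N : seq (R * (V -> int)) := [seq (ce / 2 * \prod_e wt p (fval kb.1 e), fun v => dv (fval kb.1) v + dl kb.2 v)
   | kb <- index_enum (flow E N * bool)%type].

Let sum_dl (b : bool) (th : V -> R) : \sum_v (dl b v)%:~R * th v = (if b then 1 else -1) * (th x - th y).
Proof.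
rewrite (bigD1 x) //= (bigD1 y) /=; last by rewrite eq_sym.
rewrite big1 => [|v /andP[/negbTE vx /negbTE vy]]; last by rewrite /dl vx vy subr0 mulr0 mul0r.
by rewrite /dl !eqxx (negbTE xy) eq_sym (negbTE xy); case: b; rewrite /=; ring.
Qed.

Lemma spin_correlation :
  spin_integral (fun th => cos (th x - th y) * villain_density beta th) =
  (2 * pi) ^+ #|{: V}| * (ce / 2 * Zd).
Proof.
apply: (@spin_integral_cvg R L _ S').
  move=> e e0; have [N0 hN] := density_approx e0; exists N0 => N th NN.
  rewrite (_ : tpoly (S' N) th = cos (th x - th y) * (ce * \prod_e trig N (wt p) (th (esrc e) - th (etgt e)))).
    rewrite -mulrBr normrM; apply: le_trans (hN N th NN).
    by apply: ler_piMl => //; exact: cos_max.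
  rewrite prod_trig_cos !mulr_sumr /tpoly /S' big_map.
  rewrite -(pair_bigA _ (fun (k : flow E N) b => ce / 2 * (\prod_e wt p (fval k e)) *
    cos (\sum_v (dv (fval k) v + dl b v)%:~R * th v))) /=; apply: eq_bigr => k _.
  rewrite big_bool /=.
  have eb b : \sum_v (dv (fval k) v + dl b v)%:~R * th v =
     \sum_v (dv (fval k) v)%:~R * th v + (if b then 1 else -1) * (th x - th y).
    by rewrite -sum_dl -big_split /=; apply: eq_bigr => v _; rewrite rmorphD mulrDl.
  by rewrite !eb mul1r mulN1r; move: (th x - th y) => D; rewrite cosB cosD; field.
have h : \sum_(k : flow E N | off (fval k) && (`|dv (fval k) x| == 1)%N) \prod_e wt p (fval k e)
    @[N --> \oo] --> Zd.
  by apply: (Zsup_cvg p01) => k k' kk; rewrite (offxy_ext _ _ _ _ kk) (sdiv_ext _ _ _ _ kk).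
rewrite (_ : (fun n => _) = (fun N => ce / 2 * \sum_(k : flow E N | off (fval k) && (`|dv (fval k) x| == 1)%N) \prod_e wt p (fval k e))).
  exact: (cvgM (cvg_cst _) h).
apply/funext => N; rewrite /S' big_map big_mkcond /=.
rewrite -(pair_bigA _ (fun (k : flow E N) b => if [forall v, dv (fval k) v + dl b v == 0] then
   ce / 2 * (\prod_e wt p (fval k e)) else 0)) /= mulr_sumr [RHS]big_mkcond; apply: eq_bigr => k _.
rewrite big_bool /=; set f := fval k.
have P b : [forall v, dv f v + dl b v == 0] = off f && (dv f x == if b then -1 else 1).
  apply/forallP/andP => [h0|[xyk /eqP dx] v].
    split; last by have := h0 x; rewrite /dl eqxx (negbTE xy); case: b {h0} => /=; lia.
    apply/forallP => v; apply/implyP => /andP[/negbTE vx /negbTE vy].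
    by have := h0 v; rewrite /dl vx vy subr0 mulr0 addr0.
  by rewrite (offxy_dipole xy xyk dx) /dl; case: (b); rewrite -?mulrDl subrr ?mul0r ?addNr.
rewrite !P; case: (off _) => //=; last by rewrite addr0.
case d1 : (dv f x == 1).
  by rewrite (eqP d1) /= add0r.
case d2 : (dv f x == -1).
  by rewrite (eqP d2) /= addr0.
by rewrite addr0 ifF //; move: d1 d2; move: (dv f x) => z; clear; lia.
Qed.

(** The powers of [2 pi] and of [edge_const] are common to both integrals and cancel. *)
Lemma two_pointE : villain_two_point beta x y =
  Zd / (2 * ZZ).
Proof.
rewrite /villain_two_point /villain_expect spin_correlation spin_density.
have z0 : ZZ != 0 by rewrite gt_eqF // Z0_gt0.
have c0 : ce != 0 by rewrite expf_neq0 // gt_eqF // edge_const_gt0.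
have w0 : (2 * pi) ^+ #|{: V}| != 0 :> R by rewrite expf_neq0 // mulf_neq0 // gt_eqF // pi_gt0.
by move: (_ ^+ #|{: V}|) w0 => w w0; field; rewrite z0 c0 w0.
Qed.

Lemma two_point_ge0 : 0 <= villain_two_point beta x y.
Proof.
rewrite two_pointE divr_ge0 //; last by rewrite mulr_ge0 // ltW // Z0_gt0.
apply: le_trans (Zsup_ge p01 _ 0); apply: sumr_ge0 => k _; apply: prodr_ge0 => e _; exact: wt_ge0.
Qed.

(** The flows with divergence 1 or -1 at [x] split into two prescribed sources, and each is bounded
    by [source_le]. *)
Lemma two_point_le1 : villain_two_point beta x y <= 1.
Proof.
have z0 : 0 < ZZ := Z0_gt0 p01 _ _.
rewrite two_pointE ler_pdivrMr ?mul1r ?mulr_gt0 //; apply: Zsup_le => N.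
pose D b := \sum_(k : flow E N | [forall v, dv (fval k) v == dl b v]) \prod_e wt p (fval k e).
apply: (@le_trans _ _ (D true + D false)); last by rewrite mulr_natl mulr2n lerD // source_le.
rewrite /D [leLHS]big_mkcond [X in _ <= X + _]big_mkcond [X in _ <= _ + X]big_mkcond -big_split /=.
apply: ler_sum => k _; set f := fval k.
have w0 : 0 <= \prod_e wt p (f e) by apply: prodr_ge0 => e _; exact: wt_ge0.
case: ifP => [/andP[xyk dx]|_]; last by apply: addr_ge0; case: ifP.
have P b : dv f x = (if b then 1 else -1) -> [forall v, dv f v == dl b v].
  by move=> db; apply/forallP => v; rewrite (offxy_dipole xy xyk db).
have [d1|d1] := eqVneq (dv f x) 1; first by rewrite (P true d1) lerDl; case: ifP.
have d2 : dv f x = -1 by move: dx d1; move: (dv f x) => z; clear; lia.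
by rewrite (P false d2) lerDr; case: ifP.
Qed.

End TwoPoint.

(** * The expected number of level lines *)

Lemma ler_sum_seq_inj (R : numDomainType) (T : eqType) (I : finType) (r : seq T) (P : pred T) (Q : pred I)
    (f : T -> I) (F : T -> R) (G : I -> R) :
  uniq r -> {in r &, injective f} -> (forall x, x \in r -> P x -> Q (f x)) ->
  (forall i, Q i -> 0 <= G i) -> (forall x, x \in r -> P x -> F x <= G (f x)) ->
  \sum_(x <- r | P x) F x <= \sum_(i | Q i) G i.
Proof.
move=> ur fI PQ G0 FG.
apply: le_trans (_ : \sum_(x <- r | P x) G (f x) <= _).
  by rewrite big_seq_cond [leRHS]big_seq_cond; apply: ler_sum => x /andP[xr Px]; exact: FG.
rewrite -big_filter -(big_map f xpredT G).
rewrite big_uniq /=; last first.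
  rewrite map_inj_in_uniq ?filter_uniq // => x y; rewrite !mem_filter => /andP[_ xr] /andP[_ yr].
  exact: fI.
rewrite big_mkcond [leRHS]big_mkcond; apply: ler_sum => i _.
case: ifP => [|_]; last by case: ifP => // /G0.
by case/seq.mapP => x; rewrite mem_filter => /andP[Px xr] ->; rewrite PQ.
Qed.

Section ScaledEsum.
Variables (R : realType) (T : choiceType) (S : set T).
Implicit Type a : T -> \bar R.

Lemma esumZ_le a (c : R) : 0 <= c -> (forall x, 0 <= a x)%E ->
  (\esum_(x in S) (c%:E * a x) <= c%:E * \esum_(x in S) a x)%E.
Proof.
move=> c0 a0; apply: esum_le_seq => r ur rS.
by rewrite -ge0_sume_distrr // lee_wpmul2l ?lee_fin // esum_ge_seq.
Qed.

Lemma esumZ a (c : R) : 0 < c -> (forall x, 0 <= a x)%E ->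
  \esum_(x in S) (c%:E * a x)%E = (c%:E * \esum_(x in S) a x)%E.
Proof.
move=> c0 a0; apply/eqP; rewrite eq_le esumZ_le ?(ltW c0) //=.
have ci : 0 <= c^-1 by rewrite invr_ge0 ltW.
have ca x : (0 <= c%:E * a x)%E by rewrite mule_ge0 // lee_fin ltW.
have := @esumZ_le (fun x => c%:E * a x)%E _ ci ca.
under eq_esum do rewrite muleA -EFinM mulVf ?gt_eqF // mul1e.
move=> h; apply: le_trans (lee_wpmul2l _ h) _; first by rewrite lee_fin ltW.
by rewrite muleA -EFinM divff ?gt_eqF // mul1e.
Qed.

End ScaledEsum.

Section LevelLineSum.
Variables (R : realType) (beta eps : R) (L : nat).
Hypothesis beta0 : 0 < beta.
Hypothesis eps01 : 0 < eps < 1.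
Hypothesis L0 : (0 < L)%N.
Local Notation p := (expR (- (2 * beta)^-1) : R).
Local Notation E := (edge L).
Local Notation ZZ := (Z0 p (@esrc L) (@etgt L)).
Local Notation Zd i j := (Zdip p (@esrc L) (@etgt L) (vaxis i) (haxis j) 1).
Let p01 := villain_p01 beta0.

Definition gradient_weight (m : face L -> int) : R := \prod_(e : E) wt p (m (eleft e) - m (eright e)).
Local Notation W := gradient_weight.

Lemma gradient_weight_ge0 m : 0 <= W m.
Proof. by apply: prodr_ge0 => e _; exact: wt_ge0. Qed.

Lemma ivg_weightE (n : height L) : ivg_weight beta^-1 n = W n.
Proof.
rewrite /ivg_weight big_sub /= mulr_sumr expR_sum; apply: eq_bigr => e _.
by rewrite wt_expR // invfM /eleft /eright; congr expR; field; rewrite gt_eqF.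
Qed.

(** A divergence-free flow is the gradient of a height that can be normalized to vanish on the outer
    face, and the gradient determines the flow. *)
Lemma partition_ge :
  (ZZ%:E <= \esum_(n in @zero_boundary L) (ivg_weight beta^-1 n)%:E)%E.
Proof.
set Z := \esum_(n in _) _.
have Zge0 : (0 <= Z)%E by apply: esum_ge0 => n _; rewrite lee_fin ivg_weightE gradient_weight_ge0.
have [->|Zy] := eqVneq Z +oo%E; first by rewrite leey.
have Zfin : Z \is a fin_num by rewrite ge0_fin_numE // lt_neqAle Zy leey.
rewrite -(fineK Zfin) lee_fin; apply: Zsup_le => N; rewrite -lee_fin (fineK Zfin).
have /choice[f fP] : forall k : flow E N, exists n : height L, n None = 0 /\
    ([forall v, sdiv (@esrc L) (@etgt L) pred0 (fval k) v == 0] ->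
     forall e, fval k e = n (eleft e) - n (eright e)).
  move=> k; case: forallP => [k0|_]; last by exists [ffun=> 0]; rewrite ffunE.
  have [n nk] := potential (fun v => eqP (k0 v)).
  exists [ffun f => n f - n None]; rewrite ffunE subrr; split => // _ e.
  by rewrite !ffunE nk; lia.
rewrite (eq_bigr (fun k => ivg_weight beta^-1 (f k))) => [|k k0].
  apply: (@esum_ge_fin R _ _ _ f (@zero_boundary L) (@ivg_weight R L beta^-1)) => [k k' k0 k0' ff|k _]; last by case: (fP k).
  apply: fval_inj => e; have [_ h] := fP k; have [_ h'] := fP k'.
  by rewrite (h k0) (h' k0') ff.
rewrite ivg_weightE; apply: eq_bigr => e _.
by have [_ ->] := fP k.
Qed.

(** All levels are treated at once: [(n, q)] becomes the field [mm], which is not pinned on the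
    outer face, and by injectivity one sum over such fields bounds the sum over [n] and [q]. Then
    come the reflection across the cut, the twisted flows and [twisted_sum_le]. *)
Lemma connection_sum_le (i j : 'I_L) (r : seq (height L * rat)) : uniq r ->
  (forall x, x \in r -> x.1 None = 0 /\ half_integer x.2) ->
  \sum_(x <- r | connected (vaxis i) (haxis j)
      (bdry (@eleft L) (@eright L) [ffun f => x.2 < (x.1 f)%:~R])) W x.1 <=
  twist_const eps * Num.sqrt beta * (ZZ `^ eps * Zd i j `^ (1 - eps)).
Proof.
move=> ur rH.
have iA : (0 < i.+1 <= L)%N by case: i. have jB : (0 < j.+1 <= L)%N by case: j.
have px := pos_vaxis L0 i; have py := pos_haxis L0 j.
have xy : vaxis i != haxis j by apply/eqP => e; move: px; rewrite e py => -[].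
(* [(n, q)] is recovered from [m = n - (floor q + 1)] because [n None = 0]. *)
pose mm (x : height L * rat) (f : face L) : int := x.1 f - (Num.floor x.2 + 1).
have mm_ge0 x f : x \in r -> (0 <= mm x f) = (x.2 < (x.1 f)%:~R).
  case/rH => _ [k qE]; rewrite /mm qE.
  have -> : Num.floor (k%:~R + 2^-1 : rat) = k by apply: floor_def; rewrite rmorphD /=; apply/andP; split; lra.
  apply/idP/idP => h.
    have : (k + 1)%:~R <= (x.1 f)%:~R :> rat by rewrite ler_int -subr_ge0.
    rewrite rmorphD /=; lra.
  have : (k%:~R : rat) < (x.1 f)%:~R by lra.
  by rewrite ltr_int -lezD1 -subr_ge0.
(* As [r] is finite, its fields have a bounded range and fit the finite type used in
   [spin_height]. *)
pose K := (\max_(x <- r) \max_f `|mm x f|).+1.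
have mmK x f : x \in r -> (`|mm x f| < K)%N.
  move=> xr; rewrite ltnS (big_rem x xr) /= leq_max; apply/orP; left.
  exact: (leq_bigmax (F := fun f => absz (mm x f)) f).
pose hs (x : height L * rat) : {ffun face L -> 'I_K} * {ffun face L -> bool} :=
  ([ffun f => inord (if 0 <= mm x f then absz (mm x f) else (absz (mm x f)).-1)], [ffun f => 0 <= mm x f]).
have hsE x : x \in r -> spin_height (hs x) =1 mm x.
  move=> xr f; have := mmK x f xr; rewrite /spin_height /hs /= !ffunE; move: (mm x f) => z zK.
  by clear -zK; case z0 : (0 <= z); rewrite inordK; lia.
have hsI : {in r &, injective hs}.
  move=> x y xr yr e.
  have mE f : mm x f = mm y f by rewrite -hsE // -[RHS]hsE // e.
  have [x0 [k xk]] := rH x xr; have [y0 [k' yk]] := rH y yr.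
  have fl (z : int) : Num.floor (z%:~R + 2^-1 : rat) = z.
    by apply: floor_def; rewrite rmorphD /=; apply/andP; split; lra.
  have qq : x.2 = y.2.
    have := mE None; by rewrite /mm x0 y0 xk yk !fl => /addrI/oppr_inj/addIr ->.
  have nn : x.1 = y.1 by apply/ffunP => f; have := mE f; rewrite /mm qq => /addIr.
  by rewrite (surjective_pairing x) (surjective_pairing y) nn qq.
pose cn := @connected L (vaxis i) (haxis j).
apply: le_trans (_ : \sum_(h : {ffun face L -> 'I_K} * {ffun face L -> bool} | cn (bdry (@eleft L) (@eright L) h.2))
    \prod_e wt p (spin_height h (eleft e) - spin_height h (eright e)) <= _).
  apply: (ler_sum_seq_inj (f := hs)) => //.
  - move=> x xr; rewrite /cn /hs /=; congr (is_true (connected _ _ (bdry _ _ _))).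
    by apply/ffunP => f; rewrite !ffunE mm_ge0.
  - by move=> h _; apply: prodr_ge0 => e _; exact: wt_ge0.
  - move=> x xr _; rewrite /W; apply: ler_prod => e _; rewrite wt_ge0 //= !hsE // /mm.
    by rewrite opprB addrA subrK.
apply: le_trans (reflected_sum (@connected_mono L _ _) (@connected_flip L _ _ iA jB _ _ px py) p01 K) _.
have h := @twisted_sum_le R beta eps beta0 eps01 _ E (@esrc L) (@etgt L) _ _ xy (degree_le4 _) _
  (negE i.+1 j.+1) (fun h : {ffun face L -> 'I_K} * {ffun face L -> bool} => twist i.+1 j.+1 (spin_height h)).
apply: le_trans (h _ _); last 2 first.
- move=> a b /(twist_inj iA jB) ab.
  have sp (u v : bool) (g h' : nat) : (if u then g%:Z else - g.+1%:Z) = (if v then h'%:Z else - h'.+1%:Z) -> u = v /\ g = h'.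
    by clear; case: u; case: v => // gh; split => //; lia.
  have s2 : a.2 = b.2 by apply/ffunP => f; have /sp[] := ab f.
  have s1 : a.1 = b.1 by apply/ffunP => f; apply: val_inj; have /sp[] := ab f.
  by rewrite (surjective_pairing a) (surjective_pairing b) s1 s2.
- by move=> a; exact: twist_twisted.
apply: ler_sum => a _; apply: ler_prod => e _; rewrite wt_ge0 //=.
by rewrite /wt twist_norm.
Qed.

Lemma gradient_weight_gt0 m : 0 < W m.
Proof. by apply: prodr_gt0 => e _; exact: wt_gt0. Qed.

Definition crossings (n : height L) (q : rat) : nat :=
  (\sum_(i < L) \sum_(j < L) 4 * connected (vaxis i) (haxis j)
      (bdry (@eleft L) (@eright L) [ffun f => (q < (n f)%:~R)%R]))%N.

Lemma num_loops_le (eta r : bool) (n : height L) :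
  (num_loops R eta r (f0 L) n <= \esum_(q in half_integer) (crossings n q)%:R%:E)%E.
Proof.
apply: esum_le_seq => s us sH.
apply: le_trans (_ : (\sum_(q <- s) (crossings n q)%:R%:E <= _)%E).
  rewrite !sumEFin lee_fin big_seq [leRHS]big_seq; apply: ler_sum => q qs; rewrite ler_nat.
  (* An integer height equal to a half-integer level would make 1 even. *)
  apply: num_q_loops_le => // f; apply/eqP; case: (sH q qs) => -[k ->] _ nf.
  have : (2 * (n f - k))%:~R = 1%:~R :> rat by rewrite rmorphM rmorphB /= nf; field.
  by move/intr_inj; lia.
by apply: esum_ge_seq => // q /sH[].
Qed.

(** With [Zdip] equal to [2 Z] times the two-point function, the powers of [Z] recombine to [Z], and
    [2 ^ (1 - eps)] is at most 2. *)
Lemma dipole_ratio (x y : site L) : x != y ->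
  ZZ `^ eps * Zdip p (@esrc L) (@etgt L) x y 1 `^ (1 - eps) <=
  2 * ZZ * villain_two_point beta x y `^ (1 - eps).
Proof.
move=> xy; have z0 : 0 < ZZ := Z0_gt0 p01 _ _.
have T0 := two_point_ge0 beta0 xy.
have -> : Zdip p (@esrc L) (@etgt L) x y 1 = 2 * ZZ * villain_two_point beta x y.
  by rewrite two_pointE // [RHS]mulrC divfK // gt_eqF // mulr_gt0.
have z1 := ltW z0; have z2 : 0 <= 2 * ZZ by rewrite mulr_ge0.
rewrite powRM // powRM // !mulrA ler_wpM2r ?powR_ge0 //.
rewrite [_ * 2 `^ _]mulrC -mulrA -powRD; last by rewrite (gt_eqF z0) implybT.
have -> : eps + (1 - eps) = 1 by ring.
rewrite powRr1 ?(ltW z0) // ler_wpM2r ?(ltW z0) //.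
rewrite -[leRHS]powRr1 //; apply: ler_powR; first by lra.
by have := andP eps01; lra.
Qed.

(** 16 is the product of 2 for the two families of loops, 4 for the directions in [num_q_loops_le]
    and 2 from [dipole_ratio]. The ratio [ZZ / Zp] is at most 1 by [partition_ge]. *)
Lemma ivg_expect_le :
  (ivg_expect beta^-1 (fun n : height L => num_loops R true true (f0 L) n + num_loops R false false (f0 L) n)
   <= (16 * twist_const eps * Num.sqrt beta *
        \sum_(i < L) \sum_(j < L) villain_two_point beta (vaxis i) (haxis j) `^ (1 - eps))%:E)%E.
Proof.
have tc0 : 0 <= twist_const eps by rewrite /twist_const mulr_ge0 ?powR_ge0 ?mulr_ge0 ?sqrtr_ge0.
have S0 : 0 <= \sum_(i < L) \sum_(j < L) villain_two_point beta (vaxis i) (haxis j) `^ (1 - eps).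
  by apply: sumr_ge0 => i _; apply: sumr_ge0 => j _; exact: powR_ge0.
rewrite /ivg_expect.
have [Zy|Zy] := eqVneq (\esum_(n in @zero_boundary L) (ivg_weight beta^-1 n)%:E) +oo%E.
  (* Then [ivg_partition] is [fine +oo = 0] and the expectation vanishes. *)
  rewrite esum1; last by move=> n _; rewrite /ivg_partition Zy /= invr0 mulr0 mul0e.
  by rewrite lee_fin !mulr_ge0 ?sqrtr_ge0.
set Zp := ivg_partition L beta^-1.
have ZZp : ZZ <= Zp.
  rewrite -lee_fin /Zp /ivg_partition fineK ?partition_ge // ge0_fin_numE ?lt_neqAle ?Zy ?leey //.
  by apply: esum_ge0 => n _; rewrite lee_fin ivg_weightE gradient_weight_ge0.
have z0 : 0 < ZZ := Z0_gt0 p01 _ _.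
have Zp0 : 0 < Zp by apply: lt_le_trans ZZp.
pose c (n : height L) : R := 2 * W n / Zp.
have c0 n : 0 < c n by rewrite /c divr_gt0 // mulr_gt0 // gradient_weight_gt0.
apply: le_trans (_ : (\esum_(n in @zero_boundary L)
   \esum_(q in half_integer) ((c n)%:E * (crossings n q)%:R%:E) <= _)%E).
  apply: le_esum => n _; rewrite esumZ //; set Y := \esum_(_ in _) _.
  have Y0 : (0 <= Y)%E by apply: esum_ge0 => q _; rewrite lee_fin.
  apply: le_trans (_ : ((W n / Zp)%:E * (Y + Y) <= _)%E).
    rewrite ivg_weightE lee_wpmul2l //; last by rewrite leeD // num_loops_le.
    by rewrite lee_fin divr_ge0 ?gradient_weight_ge0 ?(ltW Zp0).
  have -> : c n = W n / Zp + W n / Zp by rewrite /c; field; rewrite gt_eqF.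
  have w0 : 0 <= W n / Zp by rewrite divr_ge0 ?gradient_weight_ge0 ?(ltW Zp0).
  by rewrite EFinD ge0_muleDl ?lee_fin // ge0_muleDr.
rewrite esum_esum; last by move=> n q _ _; rewrite mule_ge0 ?lee_fin ?(ltW (c0 n)).
apply: esum_le_seq => r ur rH /=.
have rH' x : x \in r -> x.1 None = 0 /\ half_integer x.2 by move=> /rH[].
rewrite (eq_bigr (fun x => (c x.1 * (crossings x.1 x.2)%:R)%:E)); last by move=> x _; rewrite EFinM.
rewrite sumEFin lee_fin.
have -> : \sum_(x <- r) c x.1 * (crossings x.1 x.2)%:R = 8 / Zp *
    \sum_(i < L) \sum_(j < L) \sum_(x <- r | connected (vaxis i) (haxis j)
      (bdry (@eleft L) (@eright L) [ffun f => x.2 < (x.1 f)%:~R])) W x.1.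
  transitivity (\sum_(x <- r) \sum_(i < L) \sum_(j < L) 8 / Zp * (if connected (vaxis i) (haxis j)
      (bdry (@eleft L) (@eright L) [ffun f => x.2 < (x.1 f)%:~R]) then W x.1 else 0)).
    apply: eq_bigr => x _; rewrite /crossings natr_sum mulr_sumr; apply: eq_bigr => i _.
    rewrite natr_sum mulr_sumr; apply: eq_bigr => j _.
    by rewrite /c; case: (connected _ _ _); rewrite ?muln0 ?muln1 ?mulr0 //; field; rewrite gt_eqF.
  rewrite exchange_big /= mulr_sumr; apply: eq_bigr => i _.
  rewrite exchange_big /= mulr_sumr; apply: eq_bigr => j _.
  by rewrite -mulr_sumr -big_mkcond.
apply: le_trans (_ : 8 / Zp * \sum_(i < L) \sum_(j < L) twist_const eps * Num.sqrt beta *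
    (2 * ZZ * villain_two_point beta (vaxis i) (haxis j) `^ (1 - eps)) <= _).
  rewrite ler_wpM2l ?divr_ge0 ?(ltW Zp0) //; apply: ler_sum => i _; apply: ler_sum => j _.
  apply: le_trans (connection_sum_le i j ur rH') _.
  rewrite ler_wpM2l ?mulr_ge0 ?sqrtr_ge0 // dipole_ratio //.
  by apply/eqP => e; have := pos_vaxis L0 i; rewrite e pos_haxis // => -[].
move: S0; set S := \sum_(i < L) \sum_(j < L) (_ `^ _) => S0.
have -> : \sum_(i < L) \sum_(j < L) twist_const eps * Num.sqrt beta *
    (2 * ZZ * villain_two_point beta (vaxis i) (haxis j) `^ (1 - eps)) = twist_const eps * Num.sqrt beta * (2 * ZZ * S).
  by rewrite !mulr_sumr; apply: eq_bigr => i _; rewrite !mulr_sumr.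
have -> : 8 / Zp * (twist_const eps * Num.sqrt beta * (2 * ZZ * S)) =
   (ZZ / Zp) * (16 * twist_const eps * Num.sqrt beta * S) by field; rewrite gt_eqF.
by rewrite ler_piMl ?mulr_ge0 ?sqrtr_ge0 // ler_pdivrMr // mul1r.
Qed.

End LevelLineSum.

Theorem theorem5p3 (R : realType) (eps : R) (eps_gt0 : 0 < eps) :
  exists C : R, 0 < C /\
    forall (beta : R) (L : nat), 0 < beta -> (1 <= L)%N ->
      ((4 * C / Num.sqrt beta)%:E *
         ivg_expect beta^-1
           (fun n : height L => num_loops R true true (f0 L) n +
                                num_loops R false false (f0 L) n)
       <= (\sum_(j < 4) \sum_(z in boundary_pairs L j)
             villain_two_point beta z.1 z.2 `^ (1 - eps))%R%:E)%E.
Proof.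
(* The flow bounds require an exponent below 1; as the two-point function lies in [[0, 1]], lowering
   [eps] to [e] only decreases its power. *)
pose e := Num.min eps 2^-1.
have e01 : 0 < e < 1 by rewrite /e lt_min eps_gt0 invr_gt0 ltr0n gt_min /= invf_lt1 ?ltr1n ?orbT.
have ee : e <= eps by rewrite ge_min lexx.
have tc0 : 0 < twist_const e.
  have /andP[e0 _] := e01.
  by rewrite /twist_const mulr_gt0 ?powR_gt0 // mulr_gt0 // sqrtr_gt0 divr_gt0.
(* 64 is 4, from the statement, times 16, from [ivg_expect_le]. *)
exists (64 * twist_const e)^-1; split; first by rewrite invr_gt0 mulr_gt0.
move=> beta L beta0 L0.
have b0 : 0 < Num.sqrt beta by rewrite sqrtr_gt0.
apply: le_trans (lee_wpmul2l _ (ivg_expect_le beta0 e01 L0)) _.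
  by rewrite lee_fin divr_ge0 ?sqrtr_ge0 // mulr_ge0 // invr_ge0 mulr_ge0 // ltW.
rewrite -EFinM lee_fin; set S := \sum_(i < L) _.
have -> : 4 / (64 * twist_const e) / Num.sqrt beta * (16 * twist_const e * Num.sqrt beta * S) = S.
  by field; rewrite !gt_eqF.
pose vh (ij : 'I_L * 'I_L) : site L * site L := (vaxis ij.1, haxis ij.2).
have vhne (i j : 'I_L) : vaxis i != haxis j.
  by apply/eqP => vh_eq; have := pos_vaxis L0 i; rewrite vh_eq pos_haxis // => -[].
(* The pairs [(vaxis i, haxis j)] lie on the boundary of the first quadrant; the other quadrants
   contribute nonnegative terms. *)
apply: le_trans (_ : \sum_(z in boundary_pairs L 0) villain_two_point beta z.1 z.2 `^ (1 - eps) <= _); last first.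
  rewrite [leRHS](bigD1 ord0) //= lerDl.
  by apply: sumr_ge0 => j _; apply: sumr_ge0 => z _; exact: powR_ge0.
rewrite /S pair_bigA /=.
apply: (@ler_sum_inj R _ _ vh xpredT (fun z => z \in boundary_pairs L 0)).
- move=> [i j] [i' j'] _ _ vv.
  have vi : vaxis i = vaxis i' := congr1 fst vv; have hj : haxis j = haxis j' := congr1 snd vv.
  have := pos_vaxis L0 i; rewrite vi pos_vaxis // => -[ii'].
  have := pos_haxis L0 j; rewrite hj pos_haxis // => -[jj'].
  by congr (_, _); apply: val_inj.
- by move=> [i j] _; rewrite finset.inE /vertical_boundary /horizontal_boundary /quadrant pos_vaxis ?pos_haxis //= vhne.
- by move=> z _; exact: powR_ge0.
move=> [i j] _ /=; set T := villain_two_point _ _ _.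
have T0 : 0 <= T by exact: two_point_ge0.
have T1 : T <= 1 by exact: two_point_le1.
(* The power of 0 with exponent 0 is 1 by convention; here [1 - e] is not 0 and the left-hand side
   vanishes. *)
have [->|Tn] := eqVneq T 0.
  by rewrite powR0 ?powR_ge0 // subr_eq0 gt_eqF //; case/andP: e01.
by apply: ger_powR; [rewrite lt_neqAle eq_sym Tn T0 T1|rewrite lerD2l lerN2].
Qed.
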